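(* Fix $L>0$ and initial data $$\rho(0)=\rho_0>0,\quad u(0)=u_0\neq0,\quad p(0)=p_0,\quad k_1(0)=a_0,\quad k_2(0)=b_0,\quad q(0)=q_0,$$ with $p_0,a_0,b_0,q_0\in\mathbb R$. Then there is a unique real-analytic solution, on some interval $(-\delta,\delta)$, of the system $$\begin{aligned}\rho'&=q\rho,\\ u'&=p,\\ p'&=-qp-\Bigl(k_1^2+k_2^2-\tfrac{2}{L^2}\Bigr)u,\\ k_2'&=q(k_1-k_2),\\ k_1'&=-2k_1\tfrac{p}{u}-q(k_1-k_2),\\ q'&=\tfrac1{L^2}+k_1k_2-q^2\end{aligned}$$ with these initial data. Define $H=-\frac{k_1+k_2}{2}$. If $$H_0:=-\frac{a_0+b_0}{2}\neq0,\qquad \frac{u_0}{H_0}>0,$$ then, after decreasing $\delta$ if necessary, $\lambda^2:=u/H>0$ on $(-\delta,\delta)$ and there exists a spacelike immersion $\phi:\bigl((-\delta,\delta)\times J,g\bigr)\to\mathrm{AdS}_3(L)$, $J\subset\mathbb R$ an interval with coordinate $t$, with induced metric $g=ds^2+\rho(s)^2dt^2$, with timelike unit normal $\xi$, and with shape operator given by $Ae_1=k_1(s)e_1$, $Ae_2=k_2(s)e_2$, where $e_1=\partial_s$, $e_2=\rho^{-1}\partial_t$. The conformally reparametrized immersion $$\phi:\bigl((-\delta,\delta)\times J,\lambda^{-2}g\bigr)\to\mathrm{AdS}_3(L)$$ is biharmonic. It is proper biharmonic, in the sense of being nonharmonic, because $\tau_{\lambda^{-2}g}(\phi)=2u\xi\neq0$.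 Locally, the immersion is unique up to an ambient isometry of $\mathrm{AdS}_3(L)$.
   Context: $\mathrm{AdS}_3(L)=\{X\in\mathbb R^{2,2}:\langle X,X\rangle=-L^2\}$ with $\langle X,X\rangle=-X_0^2-X_1^2+X_2^2+X_3^2$, carrying the induced Lorentzian metric $h$ (signature $(-,+,+)$) of constant sectional curvature $-1/L^2$. An immersion $\phi:M^2\to\mathrm{AdS}_3(L)$ is spacelike if $g=\phi^*h$ is Riemannian; its unit normal $\xi$ then satisfies $h(\xi,\xi)=-1$. The shape operator is defined by $\nabla^N_X\xi=-AX$ with $\nabla^N$ the Levi-Civita connection of $h$; the scalar mean curvature $H$ is defined by $\mathbf H=H\xi$, with $\mathbf H$ half the trace of the second fundamental form, so $H=-\frac12\operatorname{tr}_gA$. For a smooth map $\phi:(M,g')\to(N,h)$ between pseudo-Riemannian manifolds, $\tau_{g'}(\phi)=\operatorname{tr}_{g'}\nabla d\phi$ is the tension field, and the bitension field is $\tau_{2,g'}(\phi)=\Delta^\phi_{g'}\tau_{g'}(\phi)-\sum_i\epsilon_iR^N(d\phi(e_i),\tau_{g'}(\phi))d\phi(e_i)$, where $\{e_i\}$ is a local $g'$-pseudo-orthonormal frame with $g'(e_i,e_j)=\epsilon_i\delta_{ij}$, $\Delta^\phi_{g'}V=\sum_i\epsilon_i(\nabla^\phi_{e_i}\nabla^\phi_{e_i}V-\nabla^\phi_{\nabla_{e_i}e_i}V)$, and $R^N(X,Y)=[\nabla^N_X,\nabla^N_Y]-\nabla^N_{[X,Y]}$. The map is biharmonic (with respect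 to $g'$) if $\tau_{2,g'}(\phi)=0$, and harmonic if $\tau_{g'}(\phi)=0$. Primes denote $d/ds$. *)

(* Defs.v *)
From HB Require Import structures.
From mathcomp Require Import all_boot all_order all_algebra.
From mathcomp Require Import all_classical all_reals all_analysis.

Set Implicit Arguments.
Unset Strict Implicit.
Unset Printing Implicit Defensive.

Import Order.TTheory GRing.Theory Num.Theory.
Import numFieldNormedType.Exports.

Local Open Scope classical_set_scope.
Local Open Scope ring_scope.

(* Vectors are row vectors; 'D_v f x is the differential of f at x applied to
   v, and a point x : 'rV_2 of the surface has coordinates s = x 0 0,
   t = x 0 1. *)

Section Smoothness.
Context {R : realType} {V W : normedModType R}.

(* Only used for U open and V finite-dimensional, where continuity of all
   iterated directional derivatives of order at most n is C^n regularity. *)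
Fixpoint Ck_on (n : nat) (U : set V) (f : V -> W) : Prop :=
  (forall x, U x -> {for x, continuous f}) /\
  if n is m.+1 then
    forall v, (forall x, U x -> derivable f x v) /\ Ck_on m U ('D_v f)
  else True.

Definition smooth_on (U : set V) (f : V -> W) : Prop :=
  forall n, Ck_on n U f.

End Smoothness.

Definition real_analytic_on {R : realType} (I : set R) (f : R -> R) : Prop :=
  forall s0, I s0 -> exists a : nat -> R, exists2 r : R, 0 < r &
    forall s, `|s - s0| < r -> pseries a (s - s0) @ \oo --> f s.

Section AntiDeSitter.
Context {R : realType}.
Implicit Types (L : R) (x v w z : 'rV[R]_4) (X Y Z : 'rV[R]_4 -> 'rV[R]_4).

Definition ip v w : R :=
  - (v 0 0 * w 0 0) - v 0 1 * w 0 1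
  + v 0 (inord 2) * w 0 (inord 2) + v 0 (inord 3) * w 0 (inord 3).

Definition AdS L : set 'rV[R]_4 := [set x | ip x x = - L ^+ 2].

Definition tangent_AdS x v : Prop := ip v x = 0.

(* Since <x, x> = - L^2, this is the orthogonal projection onto T_x AdS. *)
Definition tproj L x v : 'rV[R]_4 := v + (ip v x / L ^+ 2) *: x.

(* Vector fields on AdS are represented by fields on R^{2,2} that are tangent
   along AdS.  As for every nondegenerate submanifold of a flat space, the
   Levi-Civita connection of the induced metric is the tangential part of the
   flat derivative. *)
Definition nablaN L X Y : 'rV[R]_4 -> 'rV[R]_4 :=
  fun x => tproj L x ('D_(X x) Y x).

Definition lie_bracket X Y : 'rV[R]_4 -> 'rV[R]_4 :=
  fun x => 'D_(X x) Y x - 'D_(Y x) X x.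

Definition curvature_field L X Y Z : 'rV[R]_4 -> 'rV[R]_4 :=
  fun x => nablaN L X (nablaN L Y Z) x - nablaN L Y (nablaN L X Z) x
           - nablaN L (lie_bracket X Y) Z x.

(* R^N_x(v, w) z: by tensoriality v, w, z in T_x AdS may be extended by any
   tangent fields, here by y |-> tproj L y v, whose value at x is v. *)
Definition curvature L x v w z : 'rV[R]_4 :=
  curvature_field L (tproj L ^~ v) (tproj L ^~ w) (tproj L ^~ z) x.

(* Smooth maps of the closed submanifold AdS are restrictions of maps that are
   smooth on an open neighbourhood of it. *)
Definition smooth_on_AdS L (F : 'rV[R]_4 -> 'rV[R]_4) : Prop :=
  exists O : set 'rV[R]_4, [/\ open O, AdS L `<=` O & smooth_on O F].

Definition isometry_AdS L (F : 'rV[R]_4 -> 'rV[R]_4) : Prop :=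
  [/\ smooth_on_AdS L F,
      forall x, AdS L x -> AdS L (F x),
      exists G : 'rV[R]_4 -> 'rV[R]_4,
        [/\ smooth_on_AdS L G,
            forall x, AdS L x -> AdS L (G x),
            forall x, AdS L x -> G (F x) = x &
            forall x, AdS L x -> F (G x) = x] &
      forall x v w, AdS L x -> tangent_AdS x v -> tangent_AdS x w ->
        ip ('D_v F x) ('D_w F x) = ip v w].

End AntiDeSitter.

Section SurfaceMetric.
Context {R : realType}.
Implicit Types (G : 'rV[R]_2 -> 'M[R]_2) (X Y : 'rV[R]_2 -> 'rV[R]_2).

Definition coord_vec (i : 'I_2) : 'rV[R]_2 := delta_mx 0 i.

Definition christoffel G (x : 'rV[R]_2) (i j k : 'I_2) : R :=
  2^-1 * \sum_l invmx (G x) k l *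
    ('D_(coord_vec i) (fun y => G y j l) x + 'D_(coord_vec j) (fun y => G y i l) x
     - 'D_(coord_vec l) (fun y => G y i j) x).

Definition nablaM G X Y : 'rV[R]_2 -> 'rV[R]_2 :=
  fun x => 'D_(X x) Y x
    + \row_k \sum_i \sum_j christoffel G x i j k * X x 0 i * Y x 0 j.

Definition metric_app G (x v w : 'rV[R]_2) : R := (v *m G x *m w^T) 0 0.

Definition orthonormal_frame G (W : set 'rV[R]_2) (eps : 'I_2 -> R)
    (e : 'I_2 -> 'rV[R]_2 -> 'rV[R]_2) : Prop :=
  [/\ forall i, eps i = 1 \/ eps i = -1,
      forall i, smooth_on W (e i) &
      forall x i j, W x ->
        metric_app G x (e i x) (e j x) = if i == j then eps i else 0].

End SurfaceMetric.

Section Biharmonic.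
Context {R : realType} (L : R) (G : 'rV[R]_2 -> 'M[R]_2).
Implicit Types (phi V : 'rV[R]_2 -> 'rV[R]_4) (x : 'rV[R]_2).

(* The pullback connection: V is a section of phi^* T AdS. *)
Definition nablaphi phi (v : 'rV[R]_2) V : 'rV[R]_2 -> 'rV[R]_4 :=
  fun x => tproj L (phi x) ('D_v V x).

Definition nabla_dphi phi (X Y : 'rV[R]_2 -> 'rV[R]_2) :
    'rV[R]_2 -> 'rV[R]_4 :=
  fun x => nablaphi phi (X x) (fun y => 'D_(Y y) phi y) x
           - 'D_(nablaM G X Y x) phi x.

Definition tension_field phi : 'rV[R]_2 -> 'rV[R]_4 :=
  fun x => \sum_i \sum_j invmx (G x) i j *:
    nabla_dphi phi (fun=> coord_vec i) (fun=> coord_vec j) x.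

Definition rough_laplacian (eps : 'I_2 -> R)
    (e : 'I_2 -> 'rV[R]_2 -> 'rV[R]_2) phi V : 'rV[R]_2 -> 'rV[R]_4 :=
  fun x => \sum_i eps i *:
    (nablaphi phi (e i x) (fun y => nablaphi phi (e i y) V y) x
     - nablaphi phi (nablaM G (e i) (e i) x) V x).

Definition bitension_field (eps : 'I_2 -> R)
    (e : 'I_2 -> 'rV[R]_2 -> 'rV[R]_2) phi : 'rV[R]_2 -> 'rV[R]_4 :=
  fun x => rough_laplacian eps e phi (tension_field phi) x
    - \sum_i eps i *: curvature L (phi x)
        ('D_(e i x) phi x) (tension_field phi x) ('D_(e i x) phi x).

Definition harmonic_map (U : set 'rV[R]_2) phi : Prop :=
  forall x, U x -> tension_field phi x = 0.

Definition biharmonic_map (U : set 'rV[R]_2) phi : Prop :=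
  forall (W : set 'rV[R]_2) (eps : 'I_2 -> R)
         (e : 'I_2 -> 'rV[R]_2 -> 'rV[R]_2),
    open W -> W `<=` U -> orthonormal_frame G W eps e ->
    forall x, W x -> bitension_field eps e phi x = 0.

End Biharmonic.

Section Immersions.
Context {R : realType} (L : R).
Implicit Types (U : set 'rV[R]_2) (phi xi : 'rV[R]_2 -> 'rV[R]_4).

Definition pullback_metric phi : 'rV[R]_2 -> 'M[R]_2 :=
  fun x => \matrix_(i, j) ip ('D_(coord_vec i) phi x) ('D_(coord_vec j) phi x).

Definition spacelike_immersion U phi : Prop :=
  [/\ smooth_on U phi,
      forall x, U x -> AdS L (phi x),
      forall x v, U x -> 'D_v phi x = 0 -> v = 0 &
      forall x v, U x -> v != 0 -> 0 < metric_app (pullback_metric phi) x v v].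

Definition timelike_unit_normal U phi xi : Prop :=
  smooth_on U xi /\
  forall x, U x ->
    [/\ tangent_AdS (phi x) (xi x),
        forall v, ip (xi x) ('D_v phi x) = 0 &
        ip (xi x) (xi x) = -1].

(* The endomorphism A x acts on tangent row vectors from the right. *)
Definition shape_operator U phi xi (A : 'rV[R]_2 -> 'M[R]_2) : Prop :=
  forall x v, U x -> nablaphi L phi v xi x = - 'D_(v *m A x) phi x.

End Immersions.

Section System.
Context {R : realType}.

Record profile := Profile {
  rho_of : R -> R; u_of : R -> R; p_of : R -> R;
  k1_of : R -> R; k2_of : R -> R; q_of : R -> R }.

Implicit Types (y z : profile) (L delta s : R).

Definition sym_itv delta : set R := [set s | - delta < s < delta].

Definition profile_eq y z s : Prop :=
  [/\ rho_of y s = rho_of z s, u_of y s = u_of z s & p_of y s = p_of z s] /\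
  [/\ k1_of y s = k1_of z s, k2_of y s = k2_of z s & q_of y s = q_of z s].

Definition analytic_profile delta y : Prop :=
  [/\ real_analytic_on (sym_itv delta) (rho_of y),
      real_analytic_on (sym_itv delta) (u_of y) &
      real_analytic_on (sym_itv delta) (p_of y)] /\
  [/\ real_analytic_on (sym_itv delta) (k1_of y),
      real_analytic_on (sym_itv delta) (k2_of y) &
      real_analytic_on (sym_itv delta) (q_of y)].

(* The clause u <> 0 is the domain of definition of the system, which
   contains the quotient p / u. *)
Definition solves_system L delta y : Prop :=
  forall s, sym_itv delta s ->
  [/\ u_of y s != 0,
      is_derive s 1 (rho_of y) (q_of y s * rho_of y s),
      is_derive s 1 (u_of y) (p_of y s) &
      is_derive s 1 (p_of y)
        (- (q_of y s * p_of y s)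
         - (k1_of y s ^+ 2 + k2_of y s ^+ 2 - 2 / L ^+ 2) * u_of y s)] /\
  [/\ is_derive s 1 (k2_of y) (q_of y s * (k1_of y s - k2_of y s)),
      is_derive s 1 (k1_of y)
        (- (2 * k1_of y s * (p_of y s / u_of y s))
         - q_of y s * (k1_of y s - k2_of y s)) &
      is_derive s 1 (q_of y) (1 / L ^+ 2 + k1_of y s * k2_of y s - q_of y s ^+ 2)].

Definition initial_data (rho0 u0 p0 a0 b0 q0 : R) y : Prop :=
  [/\ rho_of y 0 = rho0, u_of y 0 = u0 & p_of y 0 = p0] /\
  [/\ k1_of y 0 = a0, k2_of y 0 = b0 & q_of y 0 = q0].

Definition analytic_solution L (rho0 u0 p0 a0 b0 q0 delta : R) y : Prop :=
  [/\ analytic_profile delta y,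
      solves_system L delta y &
      initial_data rho0 u0 p0 a0 b0 q0 y].

Definition mean_curv y s : R := - ((k1_of y s + k2_of y s) / 2).

Definition lambda_sq y s : R := u_of y s / mean_curv y s.

Definition strip delta (J : set R) : set 'rV[R]_2 :=
  [set x | sym_itv delta (x 0 0) /\ J (x 0 1)].

Definition metric_g y (x : 'rV[R]_2) : 'M[R]_2 :=
  \matrix_(i, j)
    if i == j then (if i == 0 then 1 else rho_of y (x 0 0) ^+ 2) else 0.

Definition metric_conf y (x : 'rV[R]_2) : 'M[R]_2 :=
  (lambda_sq y (x 0 0))^-1 *: metric_g y x.

Definition frame_e1 (x : 'rV[R]_2) : 'rV[R]_2 := coord_vec 0.

Definition frame_e2 y (x : 'rV[R]_2) : 'rV[R]_2 :=
  (rho_of y (x 0 0))^-1 *: coord_vec 1.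

Definition realizes L y (U : set 'rV[R]_2) (phi xi : 'rV[R]_2 -> 'rV[R]_4) :
    Prop :=
  [/\ spacelike_immersion L U phi,
      forall x, U x -> pullback_metric phi x = metric_g y x,
      timelike_unit_normal U phi xi &
      exists2 A : 'rV[R]_2 -> 'M[R]_2, shape_operator L U phi xi A &
        forall x, U x ->
          frame_e1 x *m A x = k1_of y (x 0 0) *: frame_e1 x /\
          frame_e2 y x *m A x = k2_of y (x 0 0) *: frame_e2 y x].

Definition locally_unique L y (U : set 'rV[R]_2)
    (phi : 'rV[R]_2 -> 'rV[R]_4) : Prop :=
  forall (W : set 'rV[R]_2) (psi eta : 'rV[R]_2 -> 'rV[R]_4),
    open W -> W `<=` U -> realizes L y W psi eta ->
    forall x, W x -> exists (W' : set 'rV[R]_2) (F : 'rV[R]_4 -> 'rV[R]_4),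
      [/\ open W', W' x, W' `<=` W, isometry_AdS L F &
          forall x', W' x' -> psi x' = F (phi x')].

End System.

Arguments profile : clear implicits.

(* Main.v *)
Require Import Defs.
From HB Require Import structures.
From mathcomp Require Import all_boot all_order all_algebra.
From mathcomp Require Import all_classical all_reals all_analysis.
From mathcomp Require Import ring lra.
Import Order.TTheory GRing.Theory Num.Theory.
Import numFieldNormedType.Exports.
Local Open Scope classical_set_scope.
Local Open Scope ring_scope.
Set Implicit Arguments.
Unset Strict Implicit.
Unset Printing Implicit Defensive.

(** The proof rests on three observations.

    First, with r = p / u the profile system becomes quadratic: u' = r u and
    r' = - q r - k1^2 - k2^2 + 2/L^2 - r^2, the other equations being quadratic
    already.  The Taylor coefficients of a solution of a quadratic system obey
    |a_m| <= C K^m, by induction along the Cauchy product (taylor_bound), so the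
    formal solution converges and solves the system (quad_ode_exists).
    Gronwall's inequality gives uniqueness (quad_ode_unique), and uniqueness
    gives analyticity at every point: solve again from there and compare
    (quad_ode_analytic).

    Second, write the surface with its moving frame: F is the 4x4 matrix with
    rows phi, e1, e2, xi.  The Gauss and Weingarten formulas say that
    dF/ds = S F and dF/dt = T F, where S and T depend on s only; the equations
    for rho, k2 and q are the Gauss and Codazzi equations, in the Lax form
    T' = S T - T S (codazzi_gauss).  If M solves M' = S M, then the matrix
    N = M^-1 T M is constant, and F(s, t) = M(s) exp(t N) solves both equations
    (frame_exists).  The entries of M are appended to the quadratic system, and
    T^3 = mu T makes exp(t N) a quadratic polynomial in N (matrix_exp_cubic).
    S and T are infinitesimal isometries, so the scalar products of the frame
    vectors stay those of an adapted frame.  Conversely, the frame G of any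
    other immersion with the same data satisfies the same two equations, the
    mixed partial derivatives being needed to identify its second fundamental
    form (gauss_formula), so F^-1 G is locally a constant isometry
    (surf_locally_unique).

    Third, along the surface every vector field is a combination of the frame
    vectors, which turns the tension and bitension fields into algebra
    (der_cmb).  In dimension two a conformal change of the metric multiplies
    the trace of a Hessian by a factor: the derivative of lambda drops out of
    tr (nabla d phi), which is 2 H lambda^2 xi = 2 u xi (tension_surf), and of
    the rough Laplacian.  As AdS has constant curvature, the bitension field is
    a combination of xi and e1; its xi component vanishes by the equation for
    p', and its e1 component by the equation for k1' (surf_biharmonic). *)

(** * Rules of differentiation *)

Section DeriveRules.
Context {R : realType} {V : normedModType R}.
Implicit Types (f g : V -> R) (x v : V).

Lemma derC (c : R) x v : is_derive x v (fun=> c) 0.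
Proof. exact: is_derive_cst. Qed.

Lemma derD f g x v df dg : is_derive x v f df -> is_derive x v g dg ->
  is_derive x v (fun y => f y + g y) (df + dg).
Proof. exact: is_deriveD. Qed.

Lemma derN f x v df : is_derive x v f df -> is_derive x v (fun y => - f y) (- df).
Proof. exact: is_deriveN. Qed.

Lemma derB f g x v df dg : is_derive x v f df -> is_derive x v g dg ->
  is_derive x v (fun y => f y - g y) (df - dg).
Proof. exact: is_deriveB. Qed.

Lemma derM f g x v df dg : is_derive x v f df -> is_derive x v g dg ->
  is_derive x v (fun y => f y * g y) (df * g x + f x * dg).
Proof.
move=> fd gd; apply: is_derive_eq (is_deriveM fd gd) _.
by rewrite -![_ *: _]/(_ * _) addrC mulrC.
Qed.

Lemma derX2 f x v df : is_derive x v f df ->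
  is_derive x v (fun y => f y ^+ 2) (2 * (f x * df)).
Proof.
move=> fd; apply: is_derive_eq (derM fd fd : is_derive x v (fun y => f y ^+ 2) _) _.
by ring.
Qed.

Lemma derV f x v df : f x != 0 -> is_derive x v f df ->
  is_derive x v (fun y => (f y)^-1) (- (df / f x ^+ 2)).
Proof.
move=> f0 fd; apply: DeriveDef; first by apply: derivableV => //; case: fd.
by have [fx <-] := fd; rewrite deriveV // -[_ *: _]/(_ * _) mulNr mulrC.
Qed.

Lemma der_sum (I : Type) (r : seq I) (P : pred I) (f : I -> V -> R) x v df :
  (forall i, P i -> is_derive x v (f i) (df i)) ->
  is_derive x v (fun y => \sum_(i <- r | P i) f i y) (\sum_(i <- r | P i) df i).
Proof.
move=> fd; elim: r => [|i r IH].
  under eq_fun do rewrite big_nil.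
  by rewrite big_nil; exact: derC.
under eq_fun do rewrite big_cons.
by rewrite big_cons; case: ifP => // Pi; apply: derD => //; apply: fd.
Qed.

Lemma der_sum_nat n (f : nat -> V -> R) x v df :
  (forall i, (i < n)%N -> is_derive x v (f i) (df i)) ->
  is_derive x v (fun y => \sum_(i < n) f i y) (\sum_(i < n) df i).
Proof. by move=> fd; apply: der_sum => i _; apply: fd. Qed.
End DeriveRules.

(** * Power series with geometrically bounded coefficients *)

Section PowerSeries.
Context {R : realType}.
Implicit Types (a b c : nat -> R) (C K x : R).

Definition cauchy_conv a b (m : nat) : R := \sum_(0 <= l < m.+1) a l * b (m - l)%N.

(** Both sides are sums over the pairs (l, j) with l + j < n, along the
    antidiagonals on the left and along the rows on the right. *)
Lemma exchange_big_triangle (f : nat -> nat -> R) n :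
  \sum_(0 <= m < n) \sum_(0 <= l < m.+1) f l (m - l)%N =
  \sum_(0 <= l < n) \sum_(0 <= j < n - l) f l j.
Proof.
elim: n => [|n IH]; first by rewrite !big_nil.
rewrite big_nat_recr //= IH big_nat_recr // [in RHS]big_nat_recr //=.
rewrite subSnn big_nat1 subnn addrA; congr (_ + _).
rewrite -big_split /=; apply: eq_big_nat => l /andP[_ ln].
by rewrite subSn ?(ltnW ln) // big_nat_recr.
Qed.

Lemma cvg_pseries_geom c C K x : (forall m, `|c m| <= C * K ^+ m) ->
  K * `|x| < 1 -> 0 <= K -> cvgn (pseries c x).
Proof.
move=> cb Kx K0; rewrite /pseries; apply: normed_cvg.
have C0 : 0 <= C by have := cb 0%N; rewrite expr0 mulr1; apply: le_trans.
apply: (@series_le_cvg _ _ (geometric C (K * `|x|))) => [n|n|n|].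
- by rewrite normr_ge0.
- by rewrite /geometric /= mulr_ge0 // exprn_ge0 // mulr_ge0.
- by rewrite /geometric /= normrM normrX exprMn mulrA ler_wpM2r // exprn_ge0.
by apply: is_cvg_geometric_series; rewrite ger0_norm // mulr_ge0.
Qed.

(** The factor m + 1 is absorbed by 2^m, at the cost of halving the radius. *)
Lemma pseries_diffs_geom c C K : (forall m, `|c m| <= C * K ^+ m) -> 0 <= K ->
  forall m, `|pseries_diffs c m| <= (C * K) * (2 * K) ^+ m.
Proof.
move=> cb K0 m; rewrite /pseries_diffs normrM normr_nat.
have C0 : 0 <= C by have := cb 0%N; rewrite expr0 mulr1; apply: le_trans.
apply: le_trans (_ : (2 ^ m)%:R * (C * K ^+ m.+1) <= _).
  by apply: ler_pM => //; rewrite ler_nat ltn_expl.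
by rewrite natrX exprMn exprS le_eqVlt; apply/orP; left; apply/eqP; ring.
Qed.

Lemma cvg_sqr_geom (r : R) : 0 <= r -> 4 * r < 1 ->
  (fun n : nat => n%:R ^+ 2 * r ^+ n) @ \oo --> 0.
Proof.
move=> r0 r1.
apply: (@squeeze_cvgr _ _ _ _ (fun=> 0) (geometric 1 (4 * r))).
- apply: nearW => n /=; rewrite mul1r mulr_ge0 ?exprn_ge0 ?ler0n //=.
  rewrite exprMn ler_wpM2r ?exprn_ge0 //.
  have -> : 4 ^+ n = (2 ^+ n) ^+ 2 :> R.
    by rewrite -exprM mulnC exprM; congr (_ ^+ _); rewrite expr2 -natrM.
  by rewrite lerXn2r ?nnegrE ?ler0n ?exprn_ge0 // -natrX ler_nat ltnW // ltn_expl.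
- exact: cvg_cst.
- by apply: cvg_geometric; rewrite ger0_norm // mulr_ge0.
Qed.

(** Crude form of the theorem of Mertens.  The product of the partial sums and
    the partial sum of the Cauchy product differ by at most n^2 terms, each
    bounded by C^2 r^n with r = K |x|; the factor 4 in the hypothesis is there so that the
    bound n^2 <= 4^n suffices. *)
Lemma cvg_pseries_conv a b C K x :
  (forall m, `|a m| <= C * K ^+ m) -> (forall m, `|b m| <= C * K ^+ m) ->
  4 * (K * `|x|) < 1 -> 0 <= K ->
  pseries (cauchy_conv a b) x @ \oo --> limn (pseries a x) * limn (pseries b x).
Proof.
move=> ab bb Kx K0; set r := K * `|x|.
have C0 : 0 <= C by have := ab 0%N; rewrite expr0 mulr1; apply: le_trans.
have r0 : 0 <= r by rewrite mulr_ge0.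
have r1 : r < 1 by rewrite -/r in Kx; lra.
have ca : cvgn (pseries a x) := cvg_pseries_geom ab r1 K0.
have cb : cvgn (pseries b x) := cvg_pseries_geom bb r1 K0.
have term (c : nat -> R) i : (forall m, `|c m| <= C * K ^+ m) ->
    `|c i * x ^+ i| <= C * r ^+ i.
  by move=> cm; rewrite normrM normrX exprMn mulrA ler_wpM2r ?exprn_ge0.
have diff n : `|pseries a x n * pseries b x n - pseries (cauchy_conv a b) x n| <=
    C ^+ 2 * (n%:R ^+ 2 * r ^+ n).
  have -> : pseries (cauchy_conv a b) x n = \sum_(0 <= i < n)
      \sum_(0 <= j < n - i) (a i * x ^+ i) * (b j * x ^+ j).
    rewrite -exchange_big_triangle /pseries /series /=.
    apply: eq_big_nat => m _; rewrite /cauchy_conv big_distrl /=.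
    apply: eq_big_nat => l /andP[_ lm].
    have -> : x ^+ m = x ^+ l * x ^+ (m - l) by rewrite -exprD subnKC.
    ring.
  rewrite /pseries /series /= big_distrl /= -sumrB.
  have -> : \sum_(0 <= i < n) (a i * x ^+ i * (\sum_(0 <= k < n) b k * x ^+ k) -
     \sum_(0 <= j < n - i) a i * x ^+ i * (b j * x ^+ j)) =
     \sum_(0 <= i < n) \sum_(n - i <= j < n) (a i * x ^+ i) * (b j * x ^+ j).
    apply: eq_big_nat => i _; rewrite big_distrr /=.
    rewrite [X in X - _](@big_cat_nat _ _ _ (n - i)) ?leq_subr //=.
    by rewrite [X in X - _]addrC addrK.
  apply: (le_trans (ler_norm_sum _ _ _)).
  apply: (@le_trans _ _ (\sum_(0 <= i < n) n%:R * (C ^+ 2 * r ^+ n))); last first.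
    rewrite sumr_const_nat subn0 -mulr_natl le_eqVlt; apply/orP; left.
    by apply/eqP; ring.
  apply: ler_sum_nat => i /andP[_ iln].
  apply: (le_trans (ler_norm_sum _ _ _)).
  apply: (@le_trans _ _ (\sum_(n - i <= j < n) (C ^+ 2 * r ^+ n))); last first.
    rewrite sumr_const_nat -[leLHS]mulr_natl ler_wpM2r ?ler_nat ?leq_subr //.
    by rewrite mulr_ge0 ?exprn_ge0.
  apply: ler_sum_nat => j /andP[nij jn]; rewrite normrM.
  apply: (@le_trans _ _ ((C * r ^+ i) * (C * r ^+ j))).
    by apply: ler_pM; rewrite ?normr_ge0 //; apply: term.
  rewrite mulrACA -expr2 -exprD ler_wpM2l ?exprn_ge0 //.
  by apply: ler_wiXn2l => //; rewrite ?ltW // -leq_subLR.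
have prod : (fun n => pseries a x n * pseries b x n) @ \oo -->
    limn (pseries a x) * limn (pseries b x) by apply: cvgM.
have d0 : (fun n => pseries a x n * pseries b x n - pseries (cauchy_conv a b) x n)
    @ \oo --> 0.
  apply/norm_cvg0P.
  apply: (@squeeze_cvgr _ _ _ _ (fun=> 0)
      (fun n => C ^+ 2 * (n%:R ^+ 2 * r ^+ n))).
  - by apply: nearW => n; rewrite normr_ge0 diff.
  - exact: cvg_cst.
  - rewrite -[X in _ --> X](mulr0 (C ^+ 2)).
    by apply: cvgM; [exact: cvg_cst|exact: cvg_sqr_geom].
rewrite -[X in _ --> X]subr0.
suff -> : pseries (cauchy_conv a b) x = (fun n => pseries a x n * pseries b x n -
    (pseries a x n * pseries b x n - pseries (cauchy_conv a b) x n)) by exact: cvgB.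
by apply/funext => n; rewrite opprB addrC subrK.
Qed.
End PowerSeries.

(** * Quadratic differential systems *)

Section QuadraticODE.
Context {R : realType}.
Implicit Types (F : nat -> seq (R * nat * nat)) (y z : nat -> R).

(** A quadratic vector field is given by its list of monomials: the triple
    (c, j, k) in the list F i stands for the term c y_j y_k of the i-th
    component.  Unknowns are numbered by nat, so that no bound on their number
    has to be carried along; lower order terms are obtained by adding an
    unknown that is constantly 1. *)
Definition quad F y (i : nat) : R :=
  \sum_(m <- F i) m.1.1 * (y m.1.2 * y m.2).

Definition weight F (i : nat) : R := \sum_(m <- F i) `|m.1.1|.

Lemma weight_ge0 F i : 0 <= weight F i.
Proof. by rewrite sumr_ge0. Qed.

(** The recursion for the Taylor coefficients is a course-of-values recursion;
    the list of all earlier coefficients is carried along. *)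
Fixpoint taylor_hist F y (m : nat) : seq (nat -> R) :=
  if m is m'.+1 then
    let h := taylor_hist F y m' in
    rcons h (fun i => m%:R^-1 * \sum_(t <- F i)
      t.1.1 * cauchy_conv (fun l => nth (fun=> 0) h l t.1.2)
                   (fun l => nth (fun=> 0) h l t.2) m')
  else [:: y].

Definition taylor F y (m : nat) : nat -> R := nth (fun=> 0) (taylor_hist F y m) m.

Lemma size_taylor_hist F y m : size (taylor_hist F y m) = m.+1.
Proof. by elim: m => //= m IH; rewrite size_rcons IH. Qed.

Lemma nth_taylor_hist F y m l : (l <= m)%N ->
  nth (fun=> 0) (taylor_hist F y m) l = taylor F y l.
Proof.
elim: m => [|m IH]; first by rewrite leqn0 => /eqP ->.
rewrite leq_eqVlt => /orP[/eqP -> //|lm].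
by rewrite /= nth_rcons size_taylor_hist lm IH.
Qed.

Lemma taylor0 F y i : taylor F y 0 i = y i.
Proof. by []. Qed.

Lemma taylorS F y m i : m.+1%:R * taylor F y m.+1 i =
  \sum_(t <- F i) t.1.1 * cauchy_conv (taylor F y ^~ t.1.2) (taylor F y ^~ t.2) m.
Proof.
rewrite /taylor /= nth_rcons size_taylor_hist ltnn eqxx mulVKf ?pnatr_eq0 //.
apply: eq_bigr => t _; congr (_ * _); apply: eq_big_nat => l /andP[_ lm].
by rewrite !nth_taylor_hist // leq_subr.
Qed.

(** The convolution of order m has m + 1 terms, and this is exactly what the
    factor 1 / (m + 1) coming from the integration cancels, so a geometric
    bound reproduces itself. *)
Lemma taylor_bound F y (beta C : R) : 0 <= C -> (forall i, weight F i <= beta) ->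
  (forall i, `|y i| <= C) ->
  forall m i, `|taylor F y m i| <= C * (beta * C) ^+ m.
Proof.
move=> C0 wb yC m; have b0 : 0 <= beta := le_trans (weight_ge0 F 0) (wb 0%N).
have [n] := ubnP m; elim: n m => // n IH [|m] mn i; rewrite ltnS in mn.
  by rewrite expr0 mulr1 taylor0.
have m0 : 0 < (m.+1%:R : R) by rewrite ltr0n.
rewrite -(ler_pM2l m0) -{1}[X in X * _](ger0_norm (ltW m0)) -normrM taylorS.
have cb j k : `|cauchy_conv (taylor F y ^~ j) (taylor F y ^~ k) m| <=
    m.+1%:R * (C ^+ 2 * (beta * C) ^+ m).
  apply: (le_trans (ler_norm_sum _ _ _)).
  apply: (@le_trans _ _ (\sum_(0 <= l < m.+1) (C ^+ 2 * (beta * C) ^+ m))).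
    apply: ler_sum_nat => l /andP[_ lm]; rewrite normrM.
    have lm' : (l <= m)%N by [].
    apply: (@le_trans _ _ ((C * (beta * C) ^+ l) * (C * (beta * C) ^+ (m - l)))).
      apply: ler_pM => //; apply: IH; first exact: leq_ltn_trans mn.
      exact: leq_ltn_trans (leq_subr _ _) mn.
    by rewrite mulrACA -exprD subnKC.
  by rewrite sumr_const_nat subn0 -[leLHS]mulr_natl.
apply: (le_trans (ler_norm_sum _ _ _)).
apply: (@le_trans _ _
   (\sum_(t <- F i) `|t.1.1| * (m.+1%:R * (C ^+ 2 * (beta * C) ^+ m)))).
  by apply: ler_sum => t _; rewrite normrM ler_wpM2l.
rewrite -mulr_suml; apply: (@le_trans _ _ (beta * (m.+1%:R * (C ^+ 2 * (beta * C) ^+ m)))).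
  by rewrite ler_wpM2r ?wb // !mulr_ge0 ?exprn_ge0 ?mulr_ge0.
rewrite [_ ^+ m.+1]exprS le_eqVlt; apply/orP; left; apply/eqP.
by move: (_ ^+ m) => X; ring.
Qed.

Theorem quad_ode_exists F (y0 : nat -> R) (beta C : R) :
  0 <= C -> (forall i, weight F i <= beta) -> (forall i, `|y0 i| <= C) ->
  exists2 r : R, 0 < r & exists y : R -> nat -> R,
  [/\ forall i, y 0 i = y0 i,
      forall (s : R) i, `|s| < r -> is_derive s 1 (y ^~ i) (quad F (y s) i) &
      exists a : nat -> nat -> R, forall (s : R) i, `|s| < r ->
        pseries (a i) s @ \oo --> y s i].
Proof.
move=> C0 wb yC; have b0 : 0 <= beta := le_trans (weight_ge0 F 0) (wb 0%N).
set K := beta * C + 1.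
have K1 : 1 <= K by rewrite lerDr mulr_ge0.
have K0 : 0 < K by apply: lt_le_trans K1.
pose a i m := taylor F y0 m i.
have ab i m : `|a i m| <= C * K ^+ m.
  apply: le_trans (taylor_bound C0 wb yC m i) _; rewrite ler_wpM2l // lerXn2r //.
  - by rewrite nnegrE mulr_ge0.
  - by rewrite nnegrE ltW.
  - by rewrite lerDl.
(* differentiating twice costs a factor 4 in the geometric rate (see
   pseries_diffs_geom), and the Cauchy product needs 4 K r < 1; the rate is
   increased by 1 so that it is positive *)
pose r := (8 * K)^-1.
have r0 : 0 < r by rewrite invr_gt0 mulr_gt0.
have Kr : K * `|r| = 8^-1.
  by rewrite gtr0_norm // /r invfM mulrCA mulfV ?mulr1 // gt_eqF.
have Ks (s : R) : `|s| < r -> K * `|s| < 8^-1.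
  by move=> sr; rewrite -Kr ltr_pM2l // [ltRHS]gtr0_norm.
exists r => //; exists (fun s i => limn (pseries (a i) s)); split.
- move=> i; apply/cvg_lim => //; rewrite -(taylor0 F y0 i).
  apply: cvg_near_cst; near=> n.
  rewrite /pseries /series /=; have n0 : (0 < n)%N by near: n; exists 1%N.
  rewrite big_ltn // expr0 mulr1 big_nat_cond big1 ?addr0 // => k /andP[/andP[k0 _] _].
  by rewrite expr0n gtn_eqF // mulr0.
- move=> s i sr; have Kss := Ks _ sr.
  have -> : quad F (fun j => limn (pseries (a j) s)) i =
      limn (pseries (pseries_diffs (a i)) s).
    apply/esym/cvg_lim => //.
    have -> : pseries_diffs (a i) = (fun m => \sum_(t <- F i)
       t.1.1 * cauchy_conv (a t.1.2) (a t.2) m).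
      by apply/funext => m; rewrite /pseries_diffs /a taylorS.
    rewrite /quad; elim: (F i) => [|t l IH].
      rewrite big_nil; apply: cvg_near_cst; apply: nearW => n.
      by rewrite /pseries /series /= big1 // => k _; rewrite big_nil mul0r.
    rewrite big_cons.
    rewrite [X in X @ _ --> _](_ : _ = (fun n =>
       t.1.1 * pseries (cauchy_conv (a t.1.2) (a t.2)) s n +
       pseries (fun m => \sum_(t <- l) t.1.1 * cauchy_conv (a t.1.2) (a t.2) m) s n)).
      apply: cvgD => //; apply: cvgM; first exact: cvg_cst.
      by apply: (@cvg_pseries_conv _ _ _ C K) => //; [lra|exact: ltW].
    apply/funext => n; rewrite /pseries /series /= big_distrr /= -big_split /=.
    by apply: eq_bigr => k _; rewrite big_cons; ring.
  have K20 : 0 <= 2 * K by rewrite mulr_ge0 // ltW.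
  apply: (@pseries_snd_diffs _ _ r); last by rewrite [ltRHS]gtr0_norm.
  + by apply: cvg_pseries_geom (ab i) _ (ltW K0); rewrite Kr; lra.
  + apply: cvg_pseries_geom (pseries_diffs_geom (ab i) (ltW K0)) _ K20.
    by rewrite -mulrA Kr; lra.
  + apply: cvg_pseries_geom
      (pseries_diffs_geom (pseries_diffs_geom (ab i) (ltW K0)) K20) _ _.
      by rewrite -!mulrA Kr; lra.
    by rewrite mulr_ge0.
- exists a => s i sr; have Kss := Ks _ sr.
  suff : cvgn (pseries (a i) s) by [].
  by apply: cvg_pseries_geom (ab i) _ (ltW K0); lra.
Unshelve. all: by end_near. Qed.
End QuadraticODE.

Section Gronwall.
Context {R : realType}.

Lemma derive_within_continuous (f df : R -> R) (a b : R) :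
  (forall t, a <= t <= b -> is_derive t 1 f (df t)) ->
  {within `[a, b], continuous f}.
Proof.
move=> fd; apply: derivable_within_continuous => t; rewrite in_itv /= => tab.
by have [] := fd _ tab.
Qed.

Lemma MVT_le (f df : R -> R) (a b : R) : a <= b ->
  (forall t, a <= t <= b -> is_derive t 1 f (df t)) ->
  exists2 c, a <= c <= b & f b - f a = df c * (b - a).
Proof.
move=> ab fd; have [|c cab ->] := @MVT_segment R f df a b ab _ (derive_within_continuous fd).
  by move=> t; rewrite in_itv /= => /andP[/ltW ta /ltW tb]; apply: fd; rewrite ta.
by exists c.
Qed.

(** D times an exponential is monotone, on either side of s0. *)
Lemma gronwall0 (D dD : R -> R) (s0 s C : R) :
  (forall t, `|t - s0| <= `|s - s0| -> is_derive t 1 D (dD t)) ->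
  (forall t, `|t - s0| <= `|s - s0| -> `|dD t| <= C * D t) ->
  0 <= D s -> D s0 = 0 -> D s = 0.
Proof.
move=> Dd Db Ds Ds0.
have exd (k t : R) : is_derive t 1 (fun t => expR (k * (t - s0))) (k * expR (k * (t - s0))).
  apply: is_derive_eq (is_derive1_comp (f := expR) (g := fun t => k * (t - s0))
    (is_derive_expR _) (derM (derC k t 1) (derB (is_derive_id t 1) (derC s0 t 1)))) _.
  by rewrite /=; ring.
have Ed (k t : R) : `|t - s0| <= `|s - s0| ->
    is_derive t 1 (fun t => D t * expR (k * (t - s0)))
      ((dD t + k * D t) * expR (k * (t - s0))).
  move=> /Dd dt; apply: is_derive_eq (derM dt (exd k t)) _.
  by ring.
have [s0s|ss0] := leP s0 s.
- have rng t : s0 <= t <= s -> `|t - s0| <= `|s - s0|.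
    move=> /andP[a b]; rewrite !ger0_norm ?subr_ge0 //; lra.
  have [t tI Et] := MVT_le s0s (fun t h => Ed (- C) t (rng t h)).
  move: Et; rewrite Ds0 mul0r subr0 => Et.
  have : D s * expR (- C * (s - s0)) <= 0.
    rewrite Et mulr_le0_ge0 ?subr_ge0 // mulr_le0_ge0 ?expR_ge0 //.
    by have := Db _ (rng t tI); rewrite ler_norml => /andP[]; lra.
  by rewrite pmulr_lle0 ?expR_gt0 // => h; apply/eqP; rewrite eq_le h.
- have rng t : s <= t <= s0 -> `|t - s0| <= `|s - s0|.
    move=> /andP[a b]; rewrite !ler0_norm ?subr_le0 ?(ltW ss0) //; lra.
  have [t tI Et] := MVT_le (ltW ss0) (fun t h => Ed C t (rng t h)).
  move: Et; rewrite Ds0 mul0r sub0r => Et.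
  have : 0 <= - (D s * expR (C * (s - s0))).
    rewrite Et mulr_ge0 ?subr_ge0 ?(ltW ss0) // mulr_ge0 ?expR_ge0 //.
    by have := Db _ (rng t tI); rewrite ler_norml => /andP[]; lra.
  by rewrite oppr_ge0 pmulr_lle0 ?expR_gt0 // => h; apply/eqP; rewrite eq_le h.
Qed.

Lemma bounded_on_segment (f df : R -> R) (s0 s : R) :
  (forall t, `|t - s0| <= `|s - s0| -> is_derive t 1 f (df t)) ->
  exists M, forall t, `|t - s0| <= `|s - s0| -> f t <= M.
Proof.
move=> fd; have := normr_ge0 (s - s0); move: `|s - s0| fd => e fd e0.
have rng t : s0 - e <= t <= s0 + e -> `|t - s0| <= e.
  by move=> /andP[a b]; rewrite ler_norml; apply/andP; split; lra.
have [|c _ cM] := @EVT_max R f (s0 - e) (s0 + e) _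
  (derive_within_continuous (fun t h => fd t (rng t h))).
  by lra.
exists (f c) => t; rewrite ler_norml => /andP[a b]; apply: cM.
by rewrite in_itv /=; apply/andP; split; lra.
Qed.
End Gronwall.

Section QuadraticUniqueness.
Context {R : realType}.

(** A quadratic field is Lipschitz on bounded sets, since
    y_j y_k - z_j z_k = y_j (y_k - z_k) + (y_j - z_j) z_k. *)
Lemma quad_diff_le F (y z : nat -> R) (M D : R) n i : (i < n)%N ->
  all (fun m => (m.1.2 < n) && (m.2 < n))%N (F i) ->
  (forall j, (j < n)%N -> `|y j| <= M) -> (forall j, (j < n)%N -> `|z j| <= M) ->
  (forall j, (j < n)%N -> (y j - z j) ^+ 2 <= D) ->
  `|(y i - z i) * (quad F y i - quad F z i)| <= 2 * M * weight F i * D.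
Proof.
move=> ilt /allP allF yM zM dD.
have prodD j k : (j < n)%N -> (k < n)%N -> `|y j - z j| * `|y k - z k| <= D.
  move=> jn kn; have := dD _ jn; have := dD _ kn.
  rewrite -[(y k - _) ^+ 2]real_normK ?num_real // -[(y j - _) ^+ 2]real_normK ?num_real //.
  have : 0 <= (`|y j - z j| - `|y k - z k|) ^+ 2 by rewrite sqr_ge0.
  rewrite sqrrB; lra.
have M0 : 0 <= M by apply: le_trans (yM _ ilt).
rewrite /quad -sumrB big_distrr /=.
apply: (le_trans (ler_norm_sum _ _ _)).
rewrite /weight mulrAC mulr_sumr big_seq [leRHS]big_seq.
apply: ler_sum => m mF; have /andP[jn kn] := allF _ mF.
rewrite [leRHS]mulrC -mulrBr mulrCA normrM ler_wpM2l //.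
have -> : y m.1.2 * y m.2 - z m.1.2 * z m.2 =
  y m.1.2 * (y m.2 - z m.2) + (y m.1.2 - z m.1.2) * z m.2 by ring.
rewrite mulrDr; apply: (le_trans (ler_normD _ _)).
rewrite (_ : 2 * M * D = M * D + M * D); last by ring.
apply: lerD.
- rewrite mulrCA !normrM; apply: ler_pM; rewrite ?mulr_ge0 //.
    exact: yM.
  exact: prodD.
- rewrite mulrA mulrC !normrM; apply: ler_pM; rewrite ?mulr_ge0 //.
    exact: zM.
  exact: prodD.
Qed.

(** Gronwall's inequality for the sum of the squares of the differences, the
    two solutions being bounded on a compact interval.  The first hypothesis
    says that the first n unknowns form a closed subsystem. *)
Theorem quad_ode_unique F n (y z : R -> nat -> R) (s0 s : R) :
  (forall i, (i < n)%N -> all (fun m => (m.1.2 < n) && (m.2 < n))%N (F i)) ->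
  (forall t i, (i < n)%N -> `|t - s0| <= `|s - s0| ->
     is_derive t 1 (y ^~ i) (quad F (y t) i)) ->
  (forall t i, (i < n)%N -> `|t - s0| <= `|s - s0| ->
     is_derive t 1 (z ^~ i) (quad F (z t) i)) ->
  (forall i, (i < n)%N -> y s0 i = z s0 i) ->
  forall i, (i < n)%N -> y s i = z s i.
Proof.
move=> allF yd zd yz0.
pose G t := \sum_(i < n) (y t i ^+ 2 + z t i ^+ 2).
have [M0 GM0] : exists M, forall t, `|t - s0| <= `|s - s0| -> G t <= M.
  apply: (@bounded_on_segment _ _ (fun t => \sum_(i < n)
    (2 * (y t i * quad F (y t) i) + 2 * (z t i * quad F (z t) i)))).
  move=> t ts; apply: (der_sum_nat (f := fun i t => y t i ^+ 2 + z t i ^+ 2)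
    (df := fun i => 2 * (y t i * quad F (y t) i) + 2 * (z t i * quad F (z t) i))).
  by move=> i ilt; apply: derD; apply: derX2; [exact: yd|exact: zd].
set M := M0 + 1.
have G0 t : 0 <= G t by apply: sumr_ge0 => i _; rewrite addr_ge0 ?sqr_ge0.
have leG t i (w : R) : (i < n)%N -> w ^+ 2 <= y t i ^+ 2 + z t i ^+ 2 ->
    `|t - s0| <= `|s - s0| -> `|w| <= M.
  move=> ilt wyz /GM0 GM; have wG : w ^+ 2 <= G t.
    rewrite /G (bigD1 (Ordinal ilt)) //=; apply: (le_trans wyz).
    by rewrite lerDl sumr_ge0 // => j _; rewrite addr_ge0 ?sqr_ge0.
  rewrite -(real_normK (num_real w)) in wG.
  have := sqr_ge0 (`|w| - 1); rewrite sqrrB1 /M; have := normr_ge0 w; lra.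
have yM t i : `|t - s0| <= `|s - s0| -> (i < n)%N -> `|y t i| <= M.
  by move=> ts ilt; apply: (leG t i) => //; rewrite lerDl sqr_ge0.
have zM t i : `|t - s0| <= `|s - s0| -> (i < n)%N -> `|z t i| <= M.
  by move=> ts ilt; apply: (leG t i) => //; rewrite lerDr sqr_ge0.
pose D t := \sum_(i < n) (y t i - z t i) ^+ 2.
have Dle t i : (i < n)%N -> (y t i - z t i) ^+ 2 <= D t.
  move=> ilt; rewrite /D (bigD1 (Ordinal ilt)) //= lerDl.
  by apply: sumr_ge0 => j _; rewrite sqr_ge0.
have D0 t : 0 <= D t by apply: sumr_ge0 => j _; rewrite sqr_ge0.
pose dD t := \sum_(i < n) 2 * ((y t i - z t i) * (quad F (y t) i - quad F (z t) i)).
have : D s = 0.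
  apply: (@gronwall0 _ D dD s0 s (\sum_(i < n) 2 * (2 * M * weight F i))).
  - move=> t ts; apply: (der_sum_nat (f := fun i t => (y t i - z t i) ^+ 2)
      (df := fun i => 2 * ((y t i - z t i) * (quad F (y t) i - quad F (z t) i)))).
    move=> i ilt; apply: (derX2 (f := fun t => y t i - z t i)).
    by apply: derB; [exact: yd|exact: zd].
  - move=> t ts; rewrite mulr_suml; apply: (le_trans (ler_norm_sum _ _ _)).
    apply: ler_sum => i _; rewrite normrM (@ger0_norm _ 2) // -[leRHS]mulrA ler_wpM2l //.
    apply: (@quad_diff_le F (y t) (z t) M (D t) n) => //.
    + exact: allF.
    + by move=> j; apply: yM.
    + by move=> j; apply: zM.
    + by move=> j; apply: Dle.
  - exact: D0.
  - by apply: big1 => i _; rewrite yz0 // subrr expr0n.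
move=> Ds i ilt; have := Dle s i ilt; rewrite Ds => h.
by apply/eqP; rewrite -subr_eq0 -sqrf_eq0 eq_le h sqr_ge0.
Qed.
End QuadraticUniqueness.

(** * Directional derivatives and regularity of class C^n *)

Section DirectionalDerivatives.
Context {R : realType} {V : normedModType R}.

(** Directional derivatives are derivatives along lines; this lemma and its
    converse der_line0 transport the one-variable theory. *)
Lemma der_line (W : normedModType R) (f : V -> W) (y v : V) (a : R) df :
  is_derive (y + a *: v) v f df -> is_derive a (1 : R) (fun b => f (y + b *: v)) df.
Proof.
have E : (fun h : R => h^-1 *: ((fun b => f (y + b *: v)) \o shift a) (h *: (1 : R)) -
    h^-1 *: f (y + a *: v)) = (fun h : R => h^-1 *: ((f \o shift (y + a *: v)) (h *: v)) -
    h^-1 *: f (y + a *: v)).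
  apply/funext => h /=; congr (_ *: f _ - _).
  by rewrite -[h *: 1]/(h * 1) mulr1 scalerDl addrCA.
have {}E : (fun h : R => h^-1 *: (((fun b => f (y + b *: v)) \o shift a) (h *: (1 : R)) -
    f (y + a *: v))) = (fun h : R => h^-1 *: ((f \o shift (y + a *: v)) (h *: v) -
    f (y + a *: v))).
  by apply/funext => h; rewrite !scalerBr; have /(congr1 (@^~ h)) := E.
by move=> [fd <-]; apply: DeriveDef; rewrite /derivable /derive E.
Qed.

Lemma der_line0 (W : normedModType R) (f : V -> W) (y v : V) df :
  is_derive (0 : R) (1 : R) (fun b => f (y + b *: v)) df -> is_derive y v f df.
Proof.
have E : (fun h : R => h^-1 *: (((fun b => f (y + b *: v)) \o shift 0) (h *: (1 : R)) -
    f (y + 0 *: v))) = (fun h : R => h^-1 *: ((f \o shift y) (h *: v) - f y)).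
  apply/funext => h /=; congr (_ *: (f _ - f _)).
  - by rewrite -[h *: 1]/(h * 1) mulr1 addr0 addrC.
  - by rewrite scale0r addr0.
by move=> [fd <-]; apply: DeriveDef; [move: fd|]; rewrite /derivable /derive E.
Qed.

Lemma der_comp (f : R -> R) (g : V -> R) x v a b :
  is_derive (g x) 1 f a -> is_derive x v g b ->
  is_derive x v (fun y => f (g y)) (a * b).
Proof.
move=> fd gd; apply: der_line0.
apply: (is_derive1_comp (f := f) (g := fun b => g (x + b *: v))).
  by rewrite scale0r addr0.
by apply: der_line; rewrite scale0r addr0.
Qed.

Lemma der_rV n (f : V -> 'rV[R]_n) x v (df : 'rV[R]_n) :
  (forall j, is_derive x v (fun y => f y 0 j) (df 0 j)) -> is_derive x v f df.
Proof.
move=> fd; have fx : derivable f x v.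
  by apply/derivable_mxP => i j; rewrite ord1; case: (fd j).
apply: DeriveDef => //; rewrite derive_mx //; apply/rowP => j; rewrite mxE.
exact: derive_val.
Qed.

Lemma der_coord n (f : V -> 'rV[R]_n) x v (df : 'rV[R]_n) j :
  is_derive x v f df -> is_derive x v (fun y => f y 0 j) (df 0 j).
Proof.
move=> [fx <-]; apply: DeriveDef; first by move/derivable_mxP: fx.
by rewrite derive_mx // mxE.
Qed.

End DirectionalDerivatives.

Section VectorValued.
Context {R : realType} {V : normedModType R}.

Lemma der_scale_dir n (f : V -> 'rV[R]_n) x v df (k : R) :
  is_derive x v f df -> is_derive x (k *: v) f (k *: df).
Proof.
move=> fd; apply: der_line0; apply: der_rV => j; rewrite mxE mulrC.
have -> : (fun b : R => f (x + b *: (k *: v)) 0 j) =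
    (fun c : R => f (x + c *: v) 0 j) \o (fun b : R => b * k).
  by apply/funext => b /=; rewrite scalerA.
apply: is_derive1_comp.
  by apply: (der_coord j); apply: der_line; rewrite mul0r scale0r addr0.
by apply: is_derive_eq (derM (is_derive_id (0 : R) 1) (derC k (0 : R) 1)) _; ring.
Qed.

Lemma derDv n (f g : V -> 'rV[R]_n) x v df dg :
  is_derive x v f df -> is_derive x v g dg ->
  is_derive x v (fun y => f y + g y) (df + dg).
Proof. exact: is_deriveD. Qed.

Lemma derZv n (c : V -> R) (f : V -> 'rV[R]_n) x v dc df :
  is_derive x v c dc -> is_derive x v f df ->
  is_derive x v (fun y => c y *: f y) (dc *: f x + c x *: df).
Proof.
move=> cd fd; apply: der_rV => j; rewrite !mxE.
under eq_fun do rewrite mxE.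
by apply: derM => //; exact: der_coord.
Qed.

Lemma der_near (W : normedModType R) (U : set V) (f g : V -> W) x v df :
  open U -> U x -> (forall y, U y -> f y = g y) ->
  is_derive x v f df -> is_derive x v g df.
Proof.
move=> oU Ux fg; apply: near_eq_is_derive.
by near=> y; apply: fg; near: y; apply: open_nbhs_nbhs.
Unshelve. all: by end_near. Qed.

Lemma derive_near (W : normedModType R) (U : set V) (f g : V -> W) x v :
  open U -> U x -> (forall y, U y -> f y = g y) -> 'D_v f x = 'D_v g x.
Proof.
move=> oU Ux fg; apply: near_eq_derive.
by near=> y; apply: fg; near: y; apply: open_nbhs_nbhs.
Unshelve. all: by end_near. Qed.

Lemma is_deriveE (W : normedModType R) (f : V -> W) x v df : 
  is_derive x v f df -> 'D_v f x = df.
Proof. by move=> fd; rewrite derive_val. Qed.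
End VectorValued.

Section CoordinateFunctions.
Context {R : realType}.

Lemma der_proj (x v : 'rV[R]_2) i : is_derive x v (fun y => y 0 i) (v 0 i).
Proof. exact: (der_coord i (is_derive_id x v)). Qed.

Lemma der_fun_coord (f : R -> R) (df : R) (x v : 'rV[R]_2) i :
  is_derive (x 0 i) 1 f df -> is_derive x v (fun y => f (y 0 i)) (v 0 i * df).
Proof. by rewrite mulrC => fd; apply: der_comp => //; exact: der_proj. Qed.
End CoordinateFunctions.

Section Regularity.
Context {R : realType} {V : normedModType R}.
Implicit Types (U : set V).

Lemma Ck_on_le (W : normedModType R) n m U (f : V -> W) : (m <= n)%N ->
  Ck_on n U f -> Ck_on m U f.
Proof.
elim: n m f => [|n IH] [|m] f //= mn [cf df]; split => // v.
by split; [exact: (df v).1|apply: IH (df v).2].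
Qed.

Lemma Ck_on_eq (W : normedModType R) n U (f g : V -> W) : open U ->
  (forall x, U x -> f x = g x) -> Ck_on n U f -> Ck_on n U g.
Proof.
move=> oU; elim: n f g => [|n IH] f g fg [cf df].
- split=> // x Ux; suff : g @ x --> g x by []; rewrite -(fg x Ux).
  apply: cvg_trans (cf x Ux); apply: near_eq_cvg.
  by near=> y; rewrite fg //; near: y; exact: open_nbhs_nbhs.
- split=> [x Ux|v].
    suff : g @ x --> g x by []; rewrite -(fg x Ux).
    apply: cvg_trans (cf x Ux); apply: near_eq_cvg.
    by near=> y; rewrite fg //; near: y; exact: open_nbhs_nbhs.
  split=> [x Ux|].
    have /derivableP fd := (df v).1 _ Ux.
    by have [] := der_near oU Ux fg fd.
  by apply: IH (df v).2 => x Ux; exact: derive_near oU Ux fg.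
Unshelve. all: by end_near. Qed.

Lemma Ck_on_continuous (W : normedModType R) n U (f : V -> W) :
  Ck_on n U f -> forall x, U x -> {for x, continuous f}.
Proof. by case: n => [|n] []. Qed.

Lemma Ck_on_is_derive (W : normedModType R) n U (f : V -> W) x v :
  Ck_on n.+1 U f -> U x -> is_derive x v f ('D_v f x).
Proof. by move=> [_ /(_ v) [fd _]] /fd; apply: derivableP. Qed.

(** The way to prove regularity: compute all directional derivatives on the
    open set, and show that the result is regular of the previous order. *)
Lemma Ck_onS (W : normedModType R) n U (f : V -> W) (df : V -> V -> W) :
  open U -> (forall x, U x -> {for x, continuous f}) ->
  (forall v x, U x -> is_derive x v f (df v x)) ->
  (forall v, Ck_on n U (df v)) -> Ck_on n.+1 U f.
Proof.
move=> oU cf fd dfC; split=> // v; split=> [x Ux|].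
  by have [] := fd v x Ux.
by apply: Ck_on_eq (dfC v) => // x Ux; rewrite (is_deriveE (fd v x Ux)).
Qed.

Lemma Ck_on_cst (W : normedModType R) n U (c : W) : open U -> Ck_on n U (fun=> c).
Proof.
move=> oU; elim: n c => [|n IH] c.
  by split=> // x _; exact: cvg_cst.
apply: (@Ck_onS _ _ _ _ (fun _ _ => 0)) => //.
by move=> x _; exact: cvg_cst.
Qed.

Lemma Ck_onD (W : normedModType R) n U (f g : V -> W) : open U ->
  Ck_on n U f -> Ck_on n U g -> Ck_on n U (fun x => f x + g x).
Proof.
move=> oU; have cD (f' g' : V -> W) m x : Ck_on m U f' -> Ck_on m U g' -> U x ->
    {for x, continuous (fun x => f' x + g' x : W)}.
  by move=> /Ck_on_continuous cf /Ck_on_continuous cg Ux; apply: cvgD; [exact: cf|exact: cg].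
elim: n f g => [|n IH] f g Cf Cg; first by split=> // x; apply: cD Cf Cg.
apply: (@Ck_onS _ _ _ _ (fun v x => 'D_v f x + 'D_v g x)) => //.
- by move=> x; apply: cD Cf Cg.
- by move=> v x Ux; apply: is_deriveD; [exact: Ck_on_is_derive Cf _|exact: Ck_on_is_derive Cg _].
- by move=> v; apply: IH; [exact: (Cf.2 v).2|exact: (Cg.2 v).2].
Qed.

Lemma Ck_onM n U (f g : V -> R) : open U ->
  Ck_on n U f -> Ck_on n U g -> Ck_on n U (fun x => f x * g x).
Proof.
move=> oU; have cM (f' g' : V -> R) m x : Ck_on m U f' -> Ck_on m U g' -> U x ->
    {for x, continuous (fun x => f' x * g' x : R)}.
  by move=> /Ck_on_continuous cf /Ck_on_continuous cg Ux; apply: cvgM; [exact: cf|exact: cg].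
elim: n f g => [|n IH] f g Cf Cg; first by split=> // x; apply: cM Cf Cg.
apply: (@Ck_onS _ _ _ _ (fun v x => 'D_v f x * g x + f x * 'D_v g x)) => //.
- by move=> x; apply: cM Cf Cg.
- by move=> v x Ux; apply: derM; [exact: Ck_on_is_derive Cf _|exact: Ck_on_is_derive Cg _].
- move=> v; apply: Ck_onD => //; apply: IH; try exact: (Ck_on_le (leqnSn n)).
    exact: (Cf.2 v).2.
  exact: (Cg.2 v).2.
Qed.

Lemma Ck_on_sum n U (I : Type) (r : seq I) (f : I -> V -> R) : open U ->
  (forall i, Ck_on n U (f i)) -> Ck_on n U (fun x => \sum_(i <- r) f i x).
Proof.
move=> oU fC; elim: r => [|i r IH].
  by under eq_fun do rewrite big_nil; exact: Ck_on_cst.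
by under eq_fun do rewrite big_cons; apply: Ck_onD.
Qed.

Lemma continuous_rV n (f : V -> 'rV[R]_n) x :
  (forall j, {for x, continuous (fun y => f y 0 j)}) -> {for x, continuous f}.
Proof.
move=> fc; apply/cvgrPdist_le => /= e e0.
near=> y.
rewrite /Num.Def.normr/= mx_normrE (bigmax_le _ (ltW e0))//= => i _.
rewrite !mxE ord1 /=.
move: i; near: y; apply: filter_forall => /= i.
exact: ((cvgrPdist_le _ _).1 (fc i.2)).
Unshelve. all: by end_near. Qed.

Lemma Ck_on_rV n m U (f : V -> 'rV[R]_m) : open U ->
  (forall j, Ck_on n U (fun x => f x 0 j)) -> Ck_on n U f.
Proof.
move=> oU; elim: n f => [|n IH] f fC.
  by split=> // x Ux; apply: continuous_rV => j; exact: (Ck_on_continuous (fC j)).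
apply: (@Ck_onS _ _ _ _ (fun v x => \row_j 'D_v (fun y => f y 0 j) x)) => //.
- by move=> x Ux; apply: continuous_rV => j; exact: (Ck_on_continuous (fC j)).
- by move=> v x Ux; apply: der_rV => j; rewrite mxE; exact: (Ck_on_is_derive v (fC j)).
- move=> v; apply: IH => j; under eq_fun do rewrite mxE.
  exact: ((fC j).2 v).2.
Qed.

Lemma Ck_on_coord n m U (f : V -> 'rV[R]_m) j : open U ->
  Ck_on n U f -> Ck_on n U (fun x => f x 0 j).
Proof.
move=> oU; elim: n f => [|n IH] f fC.
  split=> // x Ux; have := Ck_on_continuous fC Ux.
  by move=> fc; apply: (@continuous_comp _ _ _ f (fun M : 'rV_m => M 0 j)) => //;
    exact: coord_continuous.
apply: (@Ck_onS _ _ _ _ (fun v x => 'D_v f x 0 j)) => //.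
- move=> x Ux; have := Ck_on_continuous fC Ux.
  by move=> fc; apply: (@continuous_comp _ _ _ f (fun M : 'rV_m => M 0 j)) => //;
    exact: coord_continuous.
- by move=> v x Ux; apply: der_coord; exact: Ck_on_is_derive fC Ux.
- by move=> v; apply: IH; exact: (fC.2 v).2.
Qed.
End Regularity.

Section CoordinateRegularity.
Context {R : realType}.

Lemma is_derive_dir (f : R -> R) (s v df : R) : is_derive s 1 f df ->
  is_derive s v f (df * v).
Proof. by move=> fd; exact: (der_comp fd (is_derive_id s v)). Qed.

Lemma Ck_on_fun_coord n (I : set R) (U : set 'rV[R]_2) (f : R -> R) i :
  open U -> (forall x, U x -> I (x 0 i)) -> Ck_on n I f ->
  Ck_on n U (fun x => f (x 0 i)).
Proof.
move=> oU UI; have cf (g : R -> R) m x : Ck_on m I g -> U x ->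
    {for x, continuous (fun x : 'rV[R]_2 => g (x 0 i) : R)}.
  move=> /Ck_on_continuous cg /UI /cg cgx.
  by apply: (@continuous_comp _ _ _ (fun M : 'rV_2 => M 0 i) g) => //;
    exact: coord_continuous.
elim: n f => [|n IH] f fC; first by split=> // x; apply: cf fC.
apply: (@Ck_onS R 'rV[R]_2 R n U (fun x => f (x 0 i)) (fun v x => v 0 i * 'D_1 f (x 0 i))) => //.
- by move=> x; apply: cf fC.
- by move=> v x Ux; apply: der_fun_coord; exact: Ck_on_is_derive fC (UI _ Ux).
- move=> v; apply: Ck_onM => //; first exact: Ck_on_cst.
  exact: (IH ('D_1 f) (fC.2 1).2).
Qed.

(** The derivative of a solution is a polynomial in the solution, whence
    smoothness by induction on the order. *)
Lemma quad_ode_Ck F n (I : set R) (Y : R -> nat -> R) : open I ->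
  (forall s i, I s -> is_derive s 1 (Y ^~ i) (quad F (Y s) i)) ->
  forall i, Ck_on n I (Y ^~ i).
Proof.
move=> oI Yd; have cY s i : I s -> {for s, continuous (Y ^~ i)}.
  move=> Is; apply: differentiable_continuous; apply/derivable1_diffP.
  by have [] := Yd s i Is.
elim: n => [|n IH] i; first by split=> // s; exact: cY.
apply: (@Ck_onS R R R n I (Y ^~ i) (fun v s => quad F (Y s) i * v)) => // [s|v s Is|v].
- exact: cY.
- by apply: is_derive_dir; exact: Yd.
- apply: Ck_onM => //; last exact: Ck_on_cst.
  apply: Ck_on_sum => // m; apply: Ck_onM => //; first exact: Ck_on_cst.
  exact: Ck_onM.
Qed.
End CoordinateRegularity.

(** * Analytic solutions of the profile system *)

Section Analyticity.
Context {R : realType}.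

Lemma sym_itvE (d s : R) : sym_itv d s = (`|s| < d) :> Prop.
Proof. by rewrite /sym_itv /= ltr_norml. Qed.

Lemma open_sym_itv (d : R) : open (sym_itv d).
Proof.
rewrite (_ : sym_itv d = `]- d, d[%classic); first exact: interval_open.
by apply/seteqP; split=> t; rewrite /sym_itv /= in_itv.
Qed.

(** The terms of a convergent series tend to 0, hence are bounded. *)
Lemma cvg_pseries_coef_bound (a : nat -> R) (h : R) : 0 < h ->
  cvgn (pseries a h) -> exists C, forall m, `|a m| <= C * h^-1 ^+ m.
Proof.
move=> h0 /cvg_series_cvg_0 /cvgP /cvg_seq_bounded [C [_ /(_ (C + 1))]].
rewrite ltrDl ltr01 => /(_ isT) Cb; exists (C + 1) => m.
have hm : 0 < h ^+ m by rewrite exprn_gt0.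
rewrite exprVn ler_pdivlMr // -{1}(gtr0_norm hm) -normrM.
exact: Cb.
Qed.

(** Needed for p = u (p / u), as p is not among the unknowns of the quadratic
    system. *)
Lemma real_analytic_onM (I : set R) (f g : R -> R) :
  real_analytic_on I f -> real_analytic_on I g ->
  real_analytic_on I (fun s => f s * g s).
Proof.
move=> fa ga s0 Is0.
have [a [r r0 ar]] := fa _ Is0; have [b [r' r'0 br]] := ga _ Is0.
pose h := Num.min r r' / 2.
have m0 : 0 < Num.min r r' by rewrite lt_min r0.
have h0 : 0 < h by rewrite divr_gt0.
have hm : h < Num.min r r' by rewrite /h; lra.
move: (hm); rewrite lt_min => /andP[hr hr'].
have [|C aC] := @cvg_pseries_coef_bound a h h0.
  have := ar (s0 + h); rewrite addrC addKr gtr0_norm // addrC => /(_ hr).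
  by move=> ac; apply/cvg_ex; exists (f (s0 + h)); rewrite addrC.
have [|C' bC] := @cvg_pseries_coef_bound b h h0.
  have := br (s0 + h); rewrite addrC addKr gtr0_norm // addrC => /(_ hr').
  by move=> bc; apply/cvg_ex; exists (g (s0 + h)); rewrite addrC.
have hV m : 0 <= h^-1 ^+ m by rewrite exprn_ge0 // invr_ge0 ltW.
exists (cauchy_conv a b), (h / 8); first by rewrite divr_gt0.
move=> s sh.
have sr : `|s - s0| < r by lra.
have sr' : `|s - s0| < r' by lra.
have := @cvg_pseries_conv R a b (Num.max C C') h^-1 (s - s0).
rewrite (cvg_lim _ (ar _ sr)) // (cvg_lim _ (br _ sr')) //; apply.
- by move=> m; apply: (le_trans (aC m)); rewrite ler_wpM2r // le_max lexx.
- by move=> m; apply: (le_trans (bC m)); rewrite ler_wpM2r // le_max lexx orbT.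
- by rewrite mulrCA mulrC ltr_pdivrMr // mul1r; lra.
- by rewrite invr_ge0 ltW.
Qed.

Lemma der_translate (f : R -> R) (s0 s df : R) : is_derive (s - s0) 1 f df ->
  is_derive s 1 (fun t => f (t - s0)) df.
Proof.
move=> fd; have gd := derB (is_derive_id s 1) (derC s0 s 1).
apply: is_derive_eq (is_derive1_comp (f := f) (g := fun t => t - s0) fd gd) _.
by rewrite subr0 mulr1.
Qed.

(** Rather than re-expanding a power series at s0, solve again from there: the
    power series solution with initial value y s0 agrees with y near s0 by
    uniqueness. *)
Theorem quad_ode_analytic F n (y : R -> nat -> R) (beta d : R) :
  (forall i, (i < n)%N -> all (fun m => (m.1.2 < n) && (m.2 < n))%N (F i)) ->
  (forall i, weight F i <= beta) ->
  (forall s i, (i < n)%N -> sym_itv d s ->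
     is_derive s 1 (y ^~ i) (quad F (y s) i)) ->
  forall i, (i < n)%N -> real_analytic_on (sym_itv d) (y ^~ i).
Proof.
move=> allF wb yd i ilt s0; rewrite sym_itvE => s0d.
have [||r r0 [z [z0 zd [a za]]]] := @quad_ode_exists R F
  (fun i => if (i < n)%N then y s0 i else 0) beta (\sum_(i < n) `|y s0 i|) _ wb _.
- exact: sumr_ge0.
- move=> j; case: ifP => [jn|_]; last by rewrite normr0 sumr_ge0.
  by rewrite (bigD1 (Ordinal jn)) //= lerDl sumr_ge0.
exists (a i), (Num.min r (d - `|s0|)); first by rewrite lt_min r0 subr_gt0.
move=> s; rewrite lt_min => /andP[sr sd].
rewrite (_ : y s i = z (s - s0) i); first exact: za.
apply: (@quad_ode_unique R F n y (fun t => z (t - s0)) s0 s) => //.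
- move=> t j jn ts; apply: yd => //; rewrite sym_itvE.
  have := ler_normD (t - s0) s0; rewrite subrK; lra.
- move=> t j jn ts; apply: (der_translate (f := z ^~ j)).
  by apply: zd; apply: le_lt_trans sr.
- by move=> j jn; rewrite subrr z0 jn.
Qed.

Lemma weight_nth_le (s : seq (seq (R * nat * nat))) i :
  weight (nth [::] s) i <= \sum_(l <- s) \sum_(m <- l) `|m.1.1|.
Proof.
rewrite /weight; elim: s i => [|l s IH] [|i] /=.
- by rewrite !big_nil.
- by rewrite !big_nil.
- by rewrite big_cons lerDl sumr_ge0 // => l' _; apply: sumr_ge0.
- by rewrite big_cons; apply: (le_trans (IH i)); rewrite lerDr sumr_ge0.
Qed.

Lemma norm_nth_le (s : seq R) i : `|nth 0 s i| <= \sum_(x <- s) `|x|.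
Proof.
elim: s i => [|x s IH] [|i] /=; rewrite ?big_nil ?normr0 //.
- by rewrite big_cons lerDl sumr_ge0.
- by rewrite big_cons; apply: (le_trans (IH i)); rewrite lerDr.
Qed.

Lemma pos_near (f : R -> R) (df : R) : is_derive (0 : R) 1 f df -> 0 < f 0 ->
  exists2 e : R, 0 < e & forall s : R, `|s| < e -> 0 < f s.
Proof.
move=> fd f0; have : {for 0, continuous f}.
  by apply: differentiable_continuous; apply/derivable1_diffP; case: fd.
move/cvgrPdist_lt => /(_ _ f0) /nbhs_ballP [e /= e0 be].
exists e => // s se; have := be s; rewrite /ball /= sub0r normrN => /(_ se).
rewrite ltr_norml => /andP[_]; lra.
Qed.
End Analyticity.

Section ProfileSystem.
Context {R : realType}.
Implicit Types (y z : profile R) (L d s : R).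

Definition mono (c : R) (j k : nat) : R * nat * nat := (c, j, k).

(** The unknowns are numbered as follows: 0 is the constant 1, then 1 rho, 2 u,
    3 p / u, 4 k1, 5 k2, 6 q.  The constant c is 1 / L^2. *)
Definition profile_field (c : R) : seq (seq (R * nat * nat)) :=
  [:: [::];
      [:: mono 1 6 1];
      [:: mono 1 3 2];
      [:: mono (-1) 6 3; mono (-1) 4 4; mono (-1) 5 5; mono (2 * c) 0 0; mono (-1) 3 3];
      [:: mono (-2) 4 3; mono (-1) 6 4; mono 1 6 5];
      [:: mono 1 6 4; mono (-1) 6 5];
      [:: mono c 0 0; mono 1 4 5; mono (-1) 6 6]].

(** The equations A' = B, B' = A / L^2 - k1 X, X' = - k1 B, which the
    coordinates of phi, e1 and xi satisfy along a curve t = constant; j is the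
    number of the unknown A, followed by B and X. *)
Definition frame_field (c : R) (j : nat) : seq (seq (R * nat * nat)) :=
  [:: [:: mono 1 0 j.+1];
      [:: mono c 0 j; mono (-1) 4 j.+2];
      [:: mono (-1) 4 j.+1]].

(** Three copies of the frame equations, for a fundamental system of
    solutions. *)
Definition full_field (c : R) : seq (seq (R * nat * nat)) :=
  profile_field c ++ frame_field c 7 ++ frame_field c 10 ++ frame_field c 13.

Definition profile_state y s : nat -> R :=
  nth 0 [:: 1; rho_of y s; u_of y s; p_of y s / u_of y s;
            k1_of y s; k2_of y s; q_of y s].

(** Dividing p by u is what removes the quotient from the equation for k1'
    and the cubic terms from the equation for p'. *)
Lemma profile_state_ode L d y : solves_system L d y ->
  forall s i, (i < 7)%N -> sym_itv d s ->
  is_derive s 1 (profile_state y ^~ i)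
    (quad (nth [::] (profile_field (L ^+ 2)^-1)) (profile_state y s) i).
Proof.
move=> sol s i i7 sd; have [[u0 rd ud pd] [k2d k1d qd]] := sol _ sd.
case: i i7 => [|[|[|[|[|[|[|]]]]]]] //= _;
  rewrite /quad /profile_state /= ?big_cons big_nil /=.
- exact: derC.
- by apply: is_derive_eq rd _; ring.
- by apply: is_derive_eq ud _; field.
- apply: is_derive_eq (derM pd (derV u0 ud)) _.
  by rewrite /=; move: (L ^+ 2)^-1 => c; field.
- by apply: is_derive_eq k1d _; ring.
- by apply: is_derive_eq k2d _; ring.
- by apply: is_derive_eq qd _; rewrite div1r; ring.
Qed.

Lemma profile_field_closed c i : (i < 7)%N ->
  all (fun m => (m.1.2 < 7) && (m.2 < 7))%N (nth [::] (profile_field c) i).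
Proof. by case: i => [|[|[|[|[|[|[|]]]]]]]. Qed.

Lemma full_field_closed c i : (i < 16)%N ->
  all (fun m => (m.1.2 < 16) && (m.2 < 16))%N (nth [::] (full_field c) i).
Proof. by do 16?[case: i => [|i] //]. Qed.

Lemma system_unique L (rho0 u0 p0 a0 b0 q0 : R) d d' y z :
  solves_system L d y -> initial_data rho0 u0 p0 a0 b0 q0 y ->
  solves_system L d' z -> initial_data rho0 u0 p0 a0 b0 q0 z ->
  forall s, sym_itv d s -> sym_itv d' s -> profile_eq y z s.
Proof.
move=> ys [[y1 y2 y3] [y4 y5 y6]] zs [[z1 z2 z3] [z4 z5 z6]] s sd sd'.
have E := @quad_ode_unique R (nth [::] (profile_field (L ^+ 2)^-1)) 7
  (profile_state y) (profile_state z) 0 s (profile_field_closed _) _ _ _.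
have {}E i : (i < 7)%N -> profile_state y s i = profile_state z s i.
  apply: E => [t j jn|t j jn|j jn]; rewrite ?subr0.
  - move=> ts; apply: (profile_state_ode ys) => //.
    by move: sd; rewrite !sym_itvE; apply: le_lt_trans.
  - move=> ts; apply: (profile_state_ode zs) => //.
    by move: sd'; rewrite !sym_itvE; apply: le_lt_trans.
  - by rewrite /profile_state y1 y2 y3 y4 y5 y6 z1 z2 z3 z4 z5 z6.
have [[yu _ _ _] _] := ys _ sd; have [[zu _ _ _] _] := zs _ sd'.
have ue : u_of y s = u_of z s := E 2%N isT.
split; split; [exact: (E 1%N isT)|exact: ue| |exact: (E 4%N isT)
  |exact: (E 5%N isT)|exact: (E 6%N isT)].
have := E 3%N isT; rewrite /profile_state /= ue => /(congr1 ( *%R^~ (u_of z s))).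
by rewrite !mulfVK.
Qed.

Definition frame_ode L d y (A B X : R -> R) : Prop :=
  forall s, sym_itv d s ->
  [/\ is_derive s 1 A (B s), is_derive s 1 B (A s / L ^+ 2 - k1_of y s * X s) &
      is_derive s 1 X (- (k1_of y s * B s))].

(** The interval is chosen so small that rho stays positive and u nonzero; the unknown
    with number 0 is then shown to be constantly 1. *)
Theorem system_exists L (rho0 u0 p0 a0 b0 q0 : R) : 0 < rho0 -> u0 != 0 ->
  exists (d : R) (y : profile R) (A B X : 'I_3 -> R -> R),
  [/\ 0 < d, analytic_solution L rho0 u0 p0 a0 b0 q0 d y,
      forall s, sym_itv d s -> 0 < rho_of y s,
      forall j, frame_ode L d y (A j) (B j) (X j) /\
        [/\ smooth_on (sym_itv d) (A j), smooth_on (sym_itv d) (B j)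
           & smooth_on (sym_itv d) (X j)] &
      forall j, [/\ A j 0 = (j == 0)%:R, B j 0 = (j == 1)%:R
                  & X j 0 = (j == 2%:R)%:R]].
Proof.
move=> rho0_gt0 u0_neq0; pose F := nth [::] (full_field (L ^+ 2)^-1).
pose init := [:: 1; rho0; u0; p0 / u0; a0; b0; q0; 1; 0; 0; 0; 1; 0; 0; 0; 1].
have [|r r0 [Y [Y0 Yd _]]] := @quad_ode_exists R F (nth 0 init) _ _ _
  (weight_nth_le _) (norm_nth_le _).
  exact: sumr_ge0.
have at0 i := Yd 0 i; rewrite normr0 r0 in at0.
have [e1 e10 rhoP] : exists2 e : R, 0 < e & forall s : R, `|s| < e -> 0 < Y s 1%N.
  by apply: pos_near (at0 _ isT) _; rewrite Y0.
have [e2 e20 uP] : exists2 e : R, 0 < e & forall s : R, `|s| < e -> 0 < Y s 2%N ^+ 2.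
  by apply: pos_near (derX2 (at0 2%N isT)) _; rewrite Y0 /= exprn_even_gt0.
pose d := Num.min r (Num.min e1 e2).
have dP s : sym_itv d s -> [/\ `|s| < r, `|s| < e1 & `|s| < e2].
  by rewrite sym_itvE !lt_min => /and3P[].
pose y := Profile (Y ^~ 1%N) (Y ^~ 2%N) (fun s => Y s 3%N * Y s 2%N)
  (Y ^~ 4%N) (Y ^~ 5%N) (Y ^~ 6%N).
have Yd' (s : R) i : sym_itv d s -> is_derive s 1 (Y ^~ i) (quad F (Y s) i).
  by move=> /dP[sr _ _]; apply: Yd.
have Yan i : (i < 16)%N -> real_analytic_on (sym_itv d) (Y ^~ i).
  by apply: (quad_ode_analytic (full_field_closed _) (weight_nth_le _)).
have Y1 s : sym_itv d s -> Y s 0%N = 1.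
  move=> sd.
  suff : (Y s 0%N - 1) ^+ 2 = 0 by move/eqP; rewrite sqrf_eq0 subr_eq0 => /eqP.
  apply: (@gronwall0 R (fun t => (Y t 0%N - 1) ^+ 2) (fun=> 0) 0 s 0).
  - move=> t; rewrite !subr0 => ts; have td : sym_itv d t.
      by move: sd; rewrite !sym_itvE; apply: le_lt_trans.
    apply: is_derive_eq (derX2 (derB (Yd' t 0%N td) (derC 1 t 1))) _.
    by rewrite /quad /= big_nil subr0 !mulr0.
  - by move=> t _; rewrite normr0 mul0r.
  - exact: sqr_ge0.
  - by rewrite Y0 /= subrr expr0n.
exists d, y, (fun j => Y ^~ (nth 0 [:: 7; 10; 13] j)%N),
  (fun j => Y ^~ (nth 0 [:: 8; 11; 14] j)%N),
  (fun j => Y ^~ (nth 0 [:: 9; 12; 15] j)%N); split.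
- by rewrite !lt_min r0 e10.
- split.
  + split; split; rewrite /=; try exact: Yan.
    by apply: real_analytic_onM; exact: Yan.
  + move=> s sd; have [sr s1 s2] := dP _ sd.
    have u0s : Y s 2%N != 0 by have := uP _ s2; rewrite exprn_even_gt0.
    have Ys i := Yd' s i sd; have := Y1 _ sd => Ys0.
    split; split; rewrite //=.
    * by apply: is_derive_eq (Ys 1%N) _; rewrite /quad /= ?big_cons big_nil /= ?Ys0; ring.
    * by apply: is_derive_eq (Ys 2%N) _; rewrite /quad /= ?big_cons big_nil /= ?Ys0; ring.
    * apply: is_derive_eq (derM (Ys 3%N) (Ys 2%N)) _.
      by rewrite /quad /= ?big_cons !big_nil /= ?Ys0; ring.
    * by apply: is_derive_eq (Ys 5%N) _; rewrite /quad /= ?big_cons big_nil /= ?Ys0; ring.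
    * apply: is_derive_eq (Ys 4%N) _; rewrite /quad /= ?big_cons big_nil /= ?Ys0.
      by rewrite mulfK //; ring.
    * by apply: is_derive_eq (Ys 6%N) _; rewrite /quad /= ?big_cons big_nil /= ?Ys0; ring.
  + by split; split; rewrite /= ?Y0 //= mulfVK.
- by move=> s /dP[_ s1 _]; apply: rhoP.
- move=> j; split; last first.
    have odI := @open_sym_itv R d.
    by split=> n; apply: (quad_ode_Ck n odI Yd').
  move=> s sd; have Ys i := Yd' s i sd; have Ys0 := Y1 _ sd.
  by case: j => [[|[|[|]]] //= _]; split;
    apply: is_derive_eq (Ys _) _; rewrite /quad /= ?big_cons big_nil /= ?Ys0; ring.
- by case=> [[|[|[|]]] //= ?]; rewrite !Y0.
Qed.
End ProfileSystem.

(** * Symmetry of second derivatives *)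

Section MixedPartials.
Context {R : realType} {V : normedModType R}.

Lemma MVT_line (f df : R -> R) (h : R) : 0 < h ->
  (forall t, 0 <= t <= h -> is_derive t 1 f (df t)) ->
  exists2 c, 0 <= c <= h & f h - f 0 = df c * h.
Proof.
move=> h0 fd; have [c ch E] := MVT_le (ltW h0) fd.
by exists c => //; rewrite E subr0.
Qed.

(** The mean value theorem, used once in each of the two directions. *)
Lemma second_difference (U : set V) (f : V -> R) (x v w : V) (h : R) : 0 < h ->
  (forall a b : R, 0 <= a <= h -> 0 <= b <= h -> U (x + a *: v + b *: w)) ->
  Ck_on 2 U f ->
  exists a b, [/\ 0 <= a <= h, 0 <= b <= h &
    f (x + h *: v + h *: w) - f (x + h *: v) - f (x + h *: w) + f x =
    'D_w ('D_v f) (x + a *: v + b *: w) * h * h].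
Proof.
move=> h0 hU fC; have hh : 0 <= h <= h by rewrite lexx ltW.
have h00 : 0 <= (0 : R) <= h by rewrite lexx ltW.
have [|a ah E] := @MVT_line
   (fun a => f (x + h *: w + a *: v) - f (x + a *: v))
   (fun a => 'D_v f (x + h *: w + a *: v) - 'D_v f (x + a *: v)) h h0 _.
  move=> a ah; apply: derB; apply: der_line; apply: (Ck_on_is_derive v fC).
    by rewrite addrAC; apply: hU.
  by have := hU _ _ ah h00; rewrite scale0r addr0.
have [|b bh E'] := @MVT_line
   (fun b => 'D_v f (x + a *: v + b *: w))
   (fun b => 'D_w ('D_v f) (x + a *: v + b *: w)) h h0 _.
  move=> b bh; apply: (der_line (f := 'D_v f)); apply: (@Ck_on_is_derive _ _ _ 0 U).
    exact: (fC.2 v).2.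
  exact: hU.
exists a, b; split => //; rewrite -E'.
move: E; rewrite !scale0r !addr0 (addrAC x (h *: w)) (addrAC x (h *: w)) => <-.
by move: (f _) (f _) (f _) (f _) => A B C D; ring.
Qed.

Lemma dist_common_le (A B C e : R) :
  `|A - C| < e / 2 -> `|B - C| < e / 2 -> `|A - B| <= e.
Proof.
rewrite !ltr_norml ler_norml => /andP[? ?] /andP[? ?].
by apply/andP; split; lra.
Qed.

(** The second difference is symmetric in v and w, so the two iterated
    derivatives agree at points arbitrarily close to x; conclude by their
    continuity. *)
Theorem mixed_partials (U : set V) (f : V -> R) (x v w : V) : open U -> U x ->
  Ck_on 2 U f -> 'D_w ('D_v f) x = 'D_v ('D_w f) x.
Proof.
move=> oU Ux fC; apply/eqP; rewrite -subr_eq0 -normr_le0; apply/ler_addgt0Pr => e e0.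
rewrite add0r.
have c1 : {for x, continuous ('D_w ('D_v f))}.
  exact: (@Ck_on_continuous R V R 0 U _ ((fC.2 v).2.2 w).2 x Ux).
have c2 : {for x, continuous ('D_v ('D_w f))}.
  exact: (@Ck_on_continuous R V R 0 U _ ((fC.2 w).2.2 v).2 x Ux).
have e2 : 0 < e / 2 by rewrite divr_gt0.
move/cvgrPdist_lt : c1 => /(_ _ e2) /nbhs_ballP [r1 /= r10 b1].
move/cvgrPdist_lt : c2 => /(_ _ e2) /nbhs_ballP [r2 /= r20 b2].
have /nbhs_ballP [r3 /= r30 b3] : nbhs x U by exact: open_nbhs_nbhs.
pose r := Num.min r1 (Num.min r2 r3).
have r0 : 0 < r by rewrite !lt_min r10 r20.
(* small enough for the whole parallelogram to stay in the ball of radius r *)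
pose h := r / (2 * (`|v| + `|w| + 1)).
have vw0 : 0 < `|v| + `|w| + 1 by rewrite ltr_wpDl // addr_ge0.
have h0 : 0 < h by rewrite divr_gt0 // mulr_gt0.
have near_x a b : 0 <= a <= h -> 0 <= b <= h -> ball x r (x + a *: v + b *: w).
  move=> /andP[a0 ah] /andP[b0 bh]; rewrite -ball_normE /= opprD addrA opprD addrA subrr add0r.
  rewrite -opprD normrN; apply: (le_lt_trans (ler_normD _ _)).
  rewrite !normrZ !ger0_norm //.
  apply: (@le_lt_trans _ _ (h * (`|v| + `|w| + 1))).
    rewrite !mulrDr mulr1 -[leLHS]addr0; apply: lerD; last exact: ltW.
    by apply: lerD; apply: ler_wpM2r.
  by rewrite /h invfM mulrA mulrVK ?unitfE ?gt_eqF //; lra.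
have hU a b : 0 <= a <= h -> 0 <= b <= h -> U (x + a *: v + b *: w).
  move=> ah bh; apply: b3; apply: le_ball (near_x _ _ ah bh).
  by rewrite !ge_min lexx !orbT.
have [a [b [ah bh E]]] := second_difference h0 hU fC.
have hU' b' a' : 0 <= b' <= h -> 0 <= a' <= h -> U (x + b' *: w + a' *: v).
  by move=> ? ?; rewrite addrAC; apply: hU.
have [b' [a' [bh' ah' E']]] := second_difference h0 hU' fC.
have E2 : 'D_w ('D_v f) (x + a *: v + b *: w) =
    'D_v ('D_w f) (x + b' *: w + a' *: v).
  move: E E'; rewrite (addrAC x (h *: w)).
  move: ('D_w ('D_v f) _) ('D_v ('D_w f) _) => A B.
  move: (f _) (f _) (f _) (f _) => f1 f2 f3 f4 E E'.
  have hn : h != 0 by exact: lt0r_neq0.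
  by apply: (mulIf hn); apply: (mulIf hn); rewrite -E -E'; ring.
have n1 := b1 _ (le_ball _ (near_x _ _ ah bh)).
have n2 := b2 _ (le_ball _ (near_x _ _ ah' bh')).
have r1r : r <= r1 by rewrite /r ge_min lexx.
have r2r : r <= r2 by rewrite /r !ge_min lexx orbT.
have {}n1 := n1 r1r; have {}n2 := n2 r2r; rewrite /= in n1 n2.
rewrite (addrAC x (a' *: v)) -E2 in n2.
exact: dist_common_le n1 n2.
Qed.
End MixedPartials.

(** * Constancy criteria and matrix-valued functions *)

Lemma ord2P (j : 'I_2) : j = 0 \/ j = 1.
Proof. by case: j => [[|[|]] //= ?]; [left|right]; apply/val_inj. Qed.

Section Constancy.
Context {R : realType}.

Lemma cst_of_derive0 (f : R -> R) (s0 s : R) :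
  (forall t, `|t - s0| <= `|s - s0| -> is_derive t 1 f 0) -> f s = f s0.
Proof.
move=> fd; suff : (f s - f s0) ^+ 2 = 0 by move/eqP; rewrite sqrf_eq0 subr_eq0 => /eqP.
apply: (@gronwall0 R (fun t => (f t - f s0) ^+ 2) (fun=> 0) s0 s 0).
- move=> t /fd ft.
  by apply: is_derive_eq (derX2 (derB ft (derC (f s0) t 1))) _; rewrite subr0 !mulr0.
- by move=> t _; rewrite normr0 mul0r.
- exact: sqr_ge0.
- by rewrite subrr expr0n.
Qed.

(** Balls are squares for the norm of row vectors, so a point of the ball is
    reached from its centre along the two coordinate directions. *)
Lemma cst_on_ball (f : 'rV[R]_2 -> R) (x : 'rV[R]_2) (e : R) :
  (forall y, ball x e y -> forall i, is_derive y (coord_vec i) f 0) ->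
  forall y, ball x e y -> f y = f x.
Proof.
move=> fd y [e0 xey]; have xy i : `|y 0 i - x 0 i| < e.
  by have := xey 0 i; rewrite /ball /= distrC.
pose z := x + (y 0 0 - x 0 0) *: coord_vec 0.
have yz : y = z + (y 0 1 - x 0 1) *: coord_vec 1.
  by apply/rowP => j; rewrite !mxE; have [->|->] := ord2P j; rewrite /=; ring.
have in_ball (a b : R) : `|a| < e -> `|b| < e ->
    ball x e (x + a *: coord_vec 0 + b *: coord_vec 1).
  move=> ae be; split=> // i j; rewrite ord1 /ball /= !mxE.
  rewrite -addrA opprD addrA subrr add0r normrN.
  by have [->|->] := ord2P j; rewrite /= !(mulr0, mulr1, addr0, add0r).
have -> : f y = f z.
  rewrite yz -[in RHS](addr0 z) -(scale0r (coord_vec 1)).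
  apply: (cst_of_derive0 (f := fun b => f (z + b *: coord_vec 1))) => t.
  rewrite !subr0 => te; apply: der_line; apply: fd; apply: in_ball => //.
  exact: le_lt_trans (xy 1).
rewrite /z -[in RHS](addr0 x) -(scale0r (coord_vec 0)).
apply: (cst_of_derive0 (f := fun b => f (x + b *: coord_vec 0))) => t.
rewrite !subr0 => te; apply: der_line; apply: fd.
rewrite -[X in ball _ _ X]addr0 -(scale0r (coord_vec 1)); apply: in_ball.
  exact: le_lt_trans (xy 0).
by rewrite normr0.
Qed.
End Constancy.

Section MatrixDerivative.
Context {R : realType} {V : normedModType R}.

(** Kept entrywise rather than as a derivative in the normed space of matrices:
    the product rule then holds in all dimensions, with no norm involved. *)
Definition mder m n (x v : V) (F : V -> 'M[R]_(m, n)) (dF : 'M[R]_(m, n)) : Prop :=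
  forall i j, is_derive x v (fun y => F y i j) (dF i j).

Lemma mder_eq m n x v (F : V -> 'M[R]_(m, n)) dF dF' :
  mder x v F dF -> dF = dF' -> mder x v F dF'.
Proof. by move=> FdF <-. Qed.

Lemma mderC m n x v (A : 'M[R]_(m, n)) : mder x v (fun=> A) 0.
Proof. by move=> i j; rewrite mxE; exact: derC. Qed.

Lemma mderT m n x v (F : V -> 'M[R]_(m, n)) dF :
  mder x v F dF -> mder x v (fun y => (F y)^T) dF^T.
Proof. by move=> FdF i j; rewrite mxE; under eq_fun do rewrite mxE; exact: FdF. Qed.

Lemma mderD m n x v (F G : V -> 'M[R]_(m, n)) dF dG :
  mder x v F dF -> mder x v G dG -> mder x v (fun y => F y + G y) (dF + dG).
Proof.
move=> FdF GdG i j; rewrite mxE; under eq_fun do rewrite mxE.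
by apply: derD.
Qed.

Lemma mderZ m n x v (c : V -> R) dc (A : 'M[R]_(m, n)) :
  is_derive x v c dc -> mder x v (fun y => c y *: A) (dc *: A).
Proof.
move=> cd i j; rewrite mxE; under eq_fun do rewrite mxE.
by apply: is_derive_eq (derM cd (derC (A i j) x v)) _; rewrite mulr0 addr0.
Qed.

Lemma mderM m n p x v (F : V -> 'M[R]_(m, n)) (G : V -> 'M[R]_(n, p)) dF dG :
  mder x v F dF -> mder x v G dG ->
  mder x v (fun y => F y *m G y) (dF *m G x + F x *m dG).
Proof.
move=> FdF GdG i j; rewrite !mxE -big_split /=; under eq_fun do rewrite mxE.
by apply: der_sum => k _; apply: derM; [exact: FdF|exact: GdG].
Qed.
End MatrixDerivative.

Lemma mder_cst (R : realType) m n (F : R -> 'M[R]_(m, n)) (s : R) :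
  (forall t : R, `|t| <= `|s| -> mder t 1 F 0) -> F s = F 0.
Proof.
move=> Fd; apply/matrixP => i j.
apply: (cst_of_derive0 (f := fun t => F t i j)) => t; rewrite !subr0 => ts.
by have := Fd t ts i j; rewrite mxE.
Qed.

Lemma mder_coord (R : realType) m n (F : R -> 'M[R]_(m, n)) dF
    (x v : 'rV[R]_2) i : mder (x 0 i : R) 1 F dF ->
  mder x v (fun y => F (y 0 i)) (v 0 i *: dF).
Proof.
by move=> Fd a b; rewrite mxE; apply: (der_fun_coord (f := fun t => F t a b)).
Qed.

(** * The connection matrices of an adapted frame *)

Section MatrixTables.
Context {R : realType}.
Implicit Types (c : R) (t u : seq (seq R)).

(** Matrices given by a table of entries, on which products compute; see mx4M. *)
Definition mx4 (t : seq (seq R)) : 'M[R]_4 := \matrix_(i, j) nth 0 (nth [::] t i) j.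

Lemma mx4M t u : mx4 t *m mx4 u = mx4 (mkseq (fun i => mkseq (fun j =>
  nth 0 (nth [::] t i) 0 * nth 0 (nth [::] u 0) j +
  (nth 0 (nth [::] t i) 1 * nth 0 (nth [::] u 1) j +
  (nth 0 (nth [::] t i) 2 * nth 0 (nth [::] u 2) j +
   nth 0 (nth [::] t i) 3 * nth 0 (nth [::] u 3) j))) 4) 4).
Proof.
apply/matrixP => i j; rewrite !mxE !nth_mkseq //.
by rewrite !big_ord_recl big_ord0 !mxE addr0.
Qed.

Lemma mx4D t u : mx4 t + mx4 u = mx4 (mkseq (fun i => mkseq (fun j =>
  nth 0 (nth [::] t i) j + nth 0 (nth [::] u i) j) 4) 4).
Proof. by apply/matrixP => i j; rewrite !mxE !nth_mkseq. Qed.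

Lemma mx4N t : - mx4 t = mx4 (mkseq (fun i => mkseq (fun j =>
  - nth 0 (nth [::] t i) j) 4) 4).
Proof. by apply/matrixP => i j; rewrite !mxE !nth_mkseq. Qed.

Lemma mx4Z c t : c *: mx4 t = mx4 (mkseq (fun i => mkseq (fun j =>
  c * nth 0 (nth [::] t i) j) 4) 4).
Proof. by apply/matrixP => i j; rewrite !mxE !nth_mkseq. Qed.

Lemma mx4T t : (mx4 t)^T = mx4 (mkseq (fun i => mkseq (fun j =>
  nth 0 (nth [::] t j) i) 4) 4).
Proof. by apply/matrixP => i j; rewrite !mxE !nth_mkseq. Qed.

Lemma mx4_cst c : c%:M = mx4 [:: [:: c; 0; 0; 0]; [:: 0; c; 0; 0];
  [:: 0; 0; c; 0]; [:: 0; 0; 0; c]].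
Proof.
by apply/matrixP; case=> [[|[|[|[|]]]] //= ?]; case=> [[|[|[|[|]]]] //= ?]; rewrite !mxE.
Qed.

Lemma mx4_0 : 0 = mx4 [:: [:: 0; 0; 0; 0]; [:: 0; 0; 0; 0];
  [:: 0; 0; 0; 0]; [:: 0; 0; 0; 0]].
Proof. by rewrite -mx4_cst; apply/matrixP => i j; rewrite !mxE mul0rn. Qed.

End MatrixTables.

Ltac mx4_eq := rewrite ?(mx4T, mx4M) /= ?(mx4Z, mx4N) /= ?mx4D /=;
  congr (mx4 [:: [:: _; _; _; _]; [:: _; _; _; _]; [:: _; _; _; _]; [:: _; _; _; _]]);
  rewrite /=.

Section FrameAlgebra.
Context {R : realType}.
Implicit Types (L k q a b : R).

Definition ip_mx : 'M[R]_4 :=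
  mx4 [:: [:: -1; 0; 0; 0]; [:: 0; -1; 0; 0]; [:: 0; 0; 1; 0]; [:: 0; 0; 0; 1]].

(** The scalar products of the vectors of an adapted frame (phi, e1, e2, xi). *)
Definition gram L : 'M[R]_4 :=
  mx4 [:: [:: - L ^+ 2; 0; 0; 0]; [:: 0; 1; 0; 0]; [:: 0; 0; 1; 0]; [:: 0; 0; 0; -1]].

Definition gramV L : 'M[R]_4 :=
  mx4 [:: [:: - (L ^+ 2)^-1; 0; 0; 0]; [:: 0; 1; 0; 0]; [:: 0; 0; 1; 0]; [:: 0; 0; 0; -1]].

(** The Gauss and Weingarten formulas: the derivative of an adapted frame in
    the direction a e1 + b e2 is this matrix times the frame.  Its first row
    says d phi = a e1 + b e2, its last row d xi = - a k1 e1 - b k2 e2, and q is,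
    up to sign, the geodesic curvature of the curves s = constant. *)
Definition conn (L k1 k2 q a b : R) : 'M[R]_4 :=
  mx4 [:: [:: 0; a; b; 0];
          [:: a / L ^+ 2; 0; b * q; - (a * k1)];
          [:: b / L ^+ 2; - (b * q); 0; - (b * k2)];
          [:: 0; - (a * k1); - (b * k2); 0]].

Definition frame0 L : 'M[R]_4 :=
  mx4 [:: [:: L; 0; 0; 0]; [:: 0; 0; 1; 0]; [:: 0; 0; 0; 1]; [:: 0; 1; 0; 0]].

Lemma ip_mxK : ip_mx *m ip_mx = 1%:M.
Proof. by rewrite /ip_mx mx4_cst; mx4_eq; ring. Qed.

Lemma ip_mx_sym : ip_mx^T = ip_mx.
Proof. by rewrite /ip_mx; mx4_eq. Qed.

Lemma gramVK L : L != 0 -> gramV L *m gram L = 1%:M.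
Proof. by move=> L0; rewrite /gram /gramV mx4_cst; mx4_eq; field. Qed.

Lemma gramV_sym L : (gramV L)^T = gramV L.
Proof. by rewrite /gramV; mx4_eq. Qed.

(** The connection matrix lies in the Lie algebra of the isometry group of the
    scalar product described by gram. *)
Lemma conn_antisym (L k1 k2 q a b : R) :
  (conn L k1 k2 q a b)^T *m gramV L + gramV L *m conn L k1 k2 q a b = 0.
Proof. by rewrite /gramV /conn mx4_0; mx4_eq; ring. Qed.

(** In the direction of e2, the derivatives of phi, e1 and xi are multiples of
    e2, and the second derivative of e2 is a multiple of e2 again. *)
Lemma conn_cube (L k1 k2 q b : R) :
  let Om := conn L k1 k2 q 0 b in
  Om *m Om *m Om = (b ^+ 2 * ((L ^+ 2)^-1 - q ^+ 2 + k2 ^+ 2)) *: Om.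
Proof. by rewrite /= /conn; mx4_eq; ring. Qed.

(** At s = 0 the frame is phi = L E0, e1 = E2, e2 = E3, xi = E1.  An
    adapted frame F satisfies F ip_mx F^T = gram L; the equivalent dual
    relation used here is the one that is constant along the flow. *)
Lemma frame0_gram L : L != 0 -> (frame0 L)^T *m gramV L *m frame0 L = ip_mx.
Proof. by move=> L0; rewrite /frame0 /gramV /ip_mx; mx4_eq; field. Qed.

Lemma conn_linear (L k1 k2 q a b : R) :
  conn L k1 k2 q a b = a *: conn L k1 k2 q 1 0 + b *: conn L k1 k2 q 0 1.
Proof. by rewrite /conn; mx4_eq; ring. Qed.

(** The coefficients of b, b q and b k2 in the connection matrix in the direction
    of e2. *)
Definition conn_rot L : 'M[R]_4 := mx4 [:: [:: 0; 0; 1; 0]; [:: 0; 0; 0; 0];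
  [:: (L ^+ 2)^-1; 0; 0; 0]; [:: 0; 0; 0; 0]].

Definition conn_geod : 'M[R]_4 := mx4 [:: [:: 0; 0; 0; 0]; [:: 0; 0; 1; 0];
  [:: 0; -1; 0; 0]; [:: 0; 0; 0; 0]].

Definition conn_norm : 'M[R]_4 := mx4 [:: [:: 0; 0; 0; 0]; [:: 0; 0; 0; 0];
  [:: 0; 0; 0; -1]; [:: 0; 0; -1; 0]].

Lemma conn_split (L k1 k2 q b : R) : conn L k1 k2 q 0 b =
  b *: conn_rot L + ((b * q) *: conn_geod + (b * k2) *: conn_norm).
Proof. by rewrite /conn /conn_rot /conn_geod /conn_norm; mx4_eq; ring. Qed.

Lemma conn_commutator (L k1 k2 q b : R) :
  conn L k1 k2 q 1 0 *m conn L k1 k2 q 0 b - conn L k1 k2 q 0 b *m conn L k1 k2 q 1 0 =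
  (b * q) *: conn_rot L +
  ((b * ((L ^+ 2)^-1 + k1 * k2)) *: conn_geod + (b * q * k1) *: conn_norm).
Proof. by rewrite /conn /conn_rot /conn_geod /conn_norm; mx4_eq; ring. Qed.
End FrameAlgebra.

(** * Construction of the moving frame *)

Section ConstantCoefficients.
Context {R : realType}.

Lemma is_derive_expM (k t : R) :
  is_derive t 1 (fun t => expR (k * t)) (k * expR (k * t)).
Proof.
apply: is_derive_eq (der_comp (f := expR) (is_derive_expR _)
  (derM (derC k t 1) (is_derive_id t 1))) _; ring.
Qed.

Lemma is_derive_sinM (k t : R) :
  is_derive t 1 (fun t => sin (k * t)) (k * cos (k * t)).
Proof.
apply: is_derive_eq (der_comp (f := sin) (is_derive_sin _)
  (derM (derC k t 1) (is_derive_id t 1))) _; ring.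
Qed.

Lemma is_derive_cosM (k t : R) :
  is_derive t 1 (fun t => cos (k * t)) (- (k * sin (k * t))).
Proof.
apply: is_derive_eq (der_comp (f := cos) (is_derive_cos _)
  (derM (derC k t 1) (is_derive_id t 1))) _; ring.
Qed.

(** The coefficients of exp (t N) = 1 + S(t) N + C(t) N^2 when N^3 = mu N:
    trigonometric, hyperbolic or polynomial according to the sign of mu. *)
Lemma cubic_exp_coefs (mu : R) : exists S C : R -> R,
  [/\ S 0 = 0, C 0 = 0 & forall t : R,
      is_derive t 1 S (1 + mu * C t) /\ is_derive t 1 C (S t)].
Proof.
have [mu0|mu0|->] := ltgtP mu 0.
- pose w := Num.sqrt (- mu).
  have w0 : w != 0 by rewrite sqrtr_eq0 -ltNge oppr_gt0.
  have muE : mu = - w ^+ 2 by rewrite sqr_sqrtr ?opprK // oppr_ge0 ltW.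
  exists (fun t => sin (w * t) * w^-1), (fun t => (cos (w * t) - 1) * mu^-1).
  split; [by rewrite mulr0 sin0 mul0r|by rewrite mulr0 cos0 subrr mul0r|].
  move=> t; split.
    apply: is_derive_eq (derM (is_derive_sinM w t) (derC w^-1 t 1)) _.
    by rewrite muE; field.
  apply: is_derive_eq (derM (derB (is_derive_cosM w t) (derC 1 t 1)) (derC mu^-1 t 1)) _.
  by rewrite muE; field.
- pose w := Num.sqrt mu.
  have w0 : w != 0 by rewrite sqrtr_eq0 -ltNge.
  have muE : mu = w ^+ 2 by rewrite sqr_sqrtr // ltW.
  exists (fun t => (expR (w * t) - expR (- w * t)) * (2 * w)^-1),
         (fun t => (expR (w * t) + expR (- w * t) - 2) * (2 * mu)^-1).
  split; [by rewrite !mulr0 subrr mul0r| |].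
    by rewrite !mulr0 expR0 -[2]/(1 + 1) subrr mul0r.
  move=> t; split.
    apply: is_derive_eq (derM (derB (is_derive_expM w t) (is_derive_expM (- w) t))
      (derC (2 * w)^-1 t 1)) _.
    by rewrite muE; field.
  apply: is_derive_eq (derM (derB (derD (is_derive_expM w t) (is_derive_expM (- w) t))
    (derC 2 t 1)) (derC (2 * mu)^-1 t 1)) _.
  by rewrite muE; field.
- exists id, (fun t => t ^+ 2 * 2^-1); split => //; first by rewrite expr0n mul0r.
  move=> t; split; first by rewrite mul0r addr0; exact: is_derive_id.
  apply: is_derive_eq (derM (derX2 (is_derive_id t 1)) (derC 2^-1 t 1)) _.
  by field.
Qed.

(** The two functions solve a quadratic system, together with the constant 1. *)
Lemma cubic_exp_coefs_smooth (mu : R) (S C : R -> R) :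
  (forall t : R, is_derive t 1 S (1 + mu * C t) /\ is_derive t 1 C (S t)) ->
  smooth_on setT S /\ smooth_on setT C.
Proof.
move=> SC.
pose F := nth [::] [:: [::]; [:: mono 1 0 0; mono mu 0 2]; [:: mono 1 0 1]].
pose Y t : nat -> R := nth 0 [:: 1; S t; C t].
have Yd (t : R) i : setT t -> is_derive t 1 (Y ^~ i) (quad F (Y t) i).
  move=> _; have [Sd Cd] := SC t.
  case: i => [|[|[|i]]]; rewrite /quad /F /Y /= ?nth_nil ?big_cons big_nil /=.
  - exact: derC.
  - by apply: is_derive_eq Sd _; ring.
  - by apply: is_derive_eq Cd _; ring.
  - by under eq_fun do rewrite ?nth_nil; exact: derC.
by split=> n; [apply: (quad_ode_Ck n openT Yd 1)|apply: (quad_ode_Ck n openT Yd 2)].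
Qed.

Lemma matrix_exp_cubic (N : 'M[R]_4) (mu : R) : N *m N *m N = mu *: N ->
  exists E : R -> 'M[R]_4, [/\ E 0 = 1%:M,
    forall t : R, mder t 1 E (N *m E t) &
    forall i j, smooth_on setT (fun t => E t i j)].
Proof.
move=> N3; have [S [C [S0 C0 SC]]] := cubic_exp_coefs mu.
have [Ss Cs] := cubic_exp_coefs_smooth SC.
exists (fun t => 1%:M + (S t *: N + C t *: (N *m N))); split.
- by rewrite S0 C0 !scale0r !addr0.
- move=> t; have [Sd Cd] := SC t.
  apply: mder_eq (mderD (mderC t 1 1%:M) (mderD (mderZ N Sd) (mderZ (N *m N) Cd))) _.
  rewrite add0r !mulmxDr mulmx1 -!scalemxAr mulmxA N3 scalerA scalerDl scale1r.
  by rewrite -addrA [S t *: _ + _]addrC (mulrC mu).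
- move=> i j n; under eq_fun do rewrite !mxE.
  have o := @openT R^o.
  apply: (Ck_onD o); first exact: Ck_on_cst.
  by apply: Ck_onD => //; apply: Ck_onM => //; exact: Ck_on_cst.
Qed.
End ConstantCoefficients.

Section FrameConstruction.
Context {R : realType}.
Implicit Types (y : profile R) (L d : R).

(** In the coordinates (s, t), a vector v has components v_0 and rho v_1 in the
    basis (e1, e2). *)
Definition surface_conn L y (x v : 'rV[R]_2) : 'M[R]_4 :=
  conn L (k1_of y (x 0 0)) (k2_of y (x 0 0)) (q_of y (x 0 0))
    (v 0 0) (rho_of y (x 0 0) * v 0 1).

Definition s_conn L y (s : R) := conn L (k1_of y s) (k2_of y s) (q_of y s) 1 0.
Definition t_conn L y (s : R) :=
  conn L (k1_of y s) (k2_of y s) (q_of y s) 0 (rho_of y s).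

Lemma surface_connE L y x v : surface_conn L y x v =
  v 0 0 *: s_conn L y (x 0 0) + v 0 1 *: t_conn L y (x 0 0).
Proof.
rewrite /surface_conn conn_linear; congr (_ + _).
by rewrite /t_conn [in RHS]conn_linear scale0r add0r scalerA mulrC.
Qed.

(** The Gauss equation K = - 1/L^2 - k1 k2 is the equation for q', as
    K = - rho'' / rho = - q' - q^2; the Codazzi equation is the equation for
    k2'. *)
Lemma codazzi_gauss L d y s : solves_system L d y -> sym_itv d s ->
  mder s 1 (t_conn L y)
    (s_conn L y s *m t_conn L y s - t_conn L y s *m s_conn L y s).
Proof.
move=> sol sd; have [[u0 rd _ _] [k2d _ qd]] := sol _ sd.
rewrite conn_commutator.
have rqd := derM rd qd; have rk2d := derM rd k2d.
have E := mderD (mderZ (conn_rot L) rd)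
  (mderD (mderZ (@conn_geod R) rqd) (mderZ (@conn_norm R) rk2d)).
have {}E := mder_eq E (_ : _ = (rho_of y s * q_of y s) *: conn_rot L +
  ((rho_of y s * ((L ^+ 2)^-1 + k1_of y s * k2_of y s)) *: @conn_geod R +
   (rho_of y s * q_of y s * k1_of y s) *: @conn_norm R)).
move=> i j; under eq_fun do rewrite /t_conn conn_split.
apply: E; congr (_ *: _ + (_ *: _ + _ *: _)); rewrite ?div1r; ring.
Qed.
End FrameConstruction.

Section FrameExistence.
Context {R : realType}.
Implicit Types (y : profile R) (L d : R).

Lemma mder_mx4 (V : normedModType R) (x v : V) (t : V -> seq (seq R)) dt :
  (forall i j, (i < 4)%N -> (j < 4)%N ->
    is_derive x v (fun z => nth 0 (nth [::] (t z) i) j) (nth 0 (nth [::] dt i) j)) ->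
  mder x v (fun z => mx4 (t z)) (mx4 dt).
Proof.
move=> td i j; under eq_fun do rewrite mxE.
by rewrite mxE; apply: td.
Qed.

(** The columns are the solutions of the frame equations with the initial values
    prescribed by frame0; the third row is e2, which is parallel along the
    curves t = constant. *)
Definition profile_frame L (A B X : 'I_3 -> R -> R) (s : R) : 'M[R]_4 :=
  mx4 [:: [:: L * A 0 s; A 2%:R s; A 1 s; 0];
          [:: L * B 0 s; B 2%:R s; B 1 s; 0];
          [:: 0; 0; 0; 1];
          [:: L * X 0 s; X 2%:R s; X 1 s; 0]].

Lemma profile_frame_ode L d y A B X s : 
  (forall j, frame_ode L d y (A j) (B j) (X j)) -> sym_itv d s ->
  mder s 1 (profile_frame L A B X) (s_conn L y s *m profile_frame L A B X s).
Proof.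
move=> ode sd.
have Ad j : is_derive s 1 (A j) (B j s) by have [] := ode j s sd.
have Bd j : is_derive s 1 (B j) (A j s / L ^+ 2 - k1_of y s * X j s).
  by have [] := ode j s sd.
have Xd j : is_derive s 1 (X j) (- (k1_of y s * B j s)) by have [] := ode j s sd.
have -> : s_conn L y s *m profile_frame L A B X s = mx4
  [:: [:: 0 * (A 0 s) + L * B 0 s; B 2%:R s; B 1 s; 0];
      [:: 0 * (B 0 s) + L * (A 0 s / L ^+ 2 - k1_of y s * X 0 s);
          A 2%:R s / L ^+ 2 - k1_of y s * X 2%:R s;
          A 1 s / L ^+ 2 - k1_of y s * X 1 s; 0];
      [:: 0; 0; 0; 0];
      [:: 0 * (X 0 s) + L * - (k1_of y s * B 0 s); - (k1_of y s * B 2%:R s);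
          - (k1_of y s * B 1 s); 0]].
  by rewrite /s_conn /conn /profile_frame; mx4_eq; ring.
apply: mder_mx4 => i j i4 j4.
case: i i4 => [|[|[|[|i]]]] i4; case: j j4 => [|[|[|[|j]]]] j4;
  rewrite /=; solve [exact: derC | exact: Ad | exact: Bd | exact: Xd
    | exact: derM (derC L s 1) (Ad 0) | exact: derM (derC L s 1) (Bd 0)
    | exact: derM (derC L s 1) (Xd 0) | by [] ].
Qed.

Lemma profile_frame0 L (A B X : 'I_3 -> R -> R) :
  (forall j, [/\ A j 0 = (j == 0)%:R, B j 0 = (j == 1)%:R & X j 0 = (j == 2%:R)%:R]) ->
  profile_frame L A B X 0 = frame0 L.
Proof.
move=> init; rewrite /profile_frame /frame0.
have [-> -> ->] := init 0; have [-> -> ->] := init 1; have [-> -> ->] := init 2%:R.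
by rewrite /= !mulr0 mulr1.
Qed.

(** The inverse of a frame F with F^T gramV F = ip_mx. *)
Definition frame_inv L (F : 'M[R]_4) : 'M[R]_4 := ip_mx *m F^T *m gramV L.

Lemma frame_inv_mul L F : F^T *m gramV L *m F = ip_mx -> frame_inv L F *m F = 1%:M.
Proof. by move=> FF; rewrite /frame_inv -!mulmxA (mulmxA F^T) FF ip_mxK. Qed.

Lemma mul_frame_inv L F : F^T *m gramV L *m F = ip_mx -> F *m frame_inv L F = 1%:M.
Proof. by move=> /frame_inv_mul; exact: mulmx1C. Qed.

Lemma frame_gram L F : L != 0 -> F^T *m gramV L *m F = ip_mx ->
  F *m ip_mx *m F^T = gram L.
Proof.
move=> L0 FF; have := mul_frame_inv FF; rewrite /frame_inv !mulmxA => E.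
by rewrite -[LHS]mulmx1 -(gramVK L0) mulmxA E mul1mx.
Qed.

Lemma gram_frame L F : L != 0 -> F *m ip_mx *m F^T = gram L ->
  F^T *m gramV L *m F = ip_mx.
Proof.
move=> L0 FF; have : frame_inv L F *m F = 1%:M.
  by apply: mulmx1C; rewrite /frame_inv !mulmxA FF mulmx1C // gramVK.
rewrite /frame_inv -!mulmxA => /(congr1 (mulmx ip_mx)).
by rewrite mulmx1 !mulmxA ip_mxK mul1mx.
Qed.

(** Infinitesimal isometries preserve the scalar products of the frame. *)
Lemma mder_gram (V : normedModType R) L (x v : V) (F : V -> 'M[R]_4) Om :
  Om^T *m gramV L + gramV L *m Om = 0 -> mder x v F (Om *m F x) ->
  mder x v (fun z => (F z)^T *m gramV L *m F z) 0.
Proof.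
move=> anti Fd; apply: mder_eq (mderM (mderM (mderT Fd) (mderC x v (gramV L))) Fd) _.
rewrite trmx_mul mulmx0 addr0 !mulmxA -mulmxDl -!(mulmxA (F x)^T) -mulmxDr anti.
by rewrite mulmx0 mul0mx.
Qed.

Lemma frame_inv_deriv L Om (F : 'M[R]_4) :
  Om^T *m gramV L + gramV L *m Om = 0 ->
  frame_inv L (Om *m F) = - (frame_inv L F *m Om).
Proof.
move=> /eqP; rewrite addr_eq0 => /eqP anti.
by rewrite /frame_inv trmx_mul -!mulmxA anti !mulmxN.
Qed.

Lemma mder_frame_inv (V : normedModType R) L (x v : V) (F : V -> 'M[R]_4) dF :
  mder x v F dF -> mder x v (fun z => frame_inv L (F z)) (frame_inv L dF).
Proof.
move=> Fd; apply: mder_eq (mderM (mderM (mderC x v ip_mx) (mderT Fd)) (mderC x v (gramV L))) _.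
by rewrite mul0mx add0r mulmx0 addr0.
Qed.

(** M intertwines N and T. *)
Lemma similar_cube n (M iM T N : 'M[R]_n) mu : iM *m M = 1%:M ->
  M *m N = T *m M -> T *m T *m T = mu *: T -> N *m N *m N = mu *: N.
Proof.
move=> iMM MN T3; rewrite -[LHS]mul1mx -[RHS]mul1mx -iMM -!(mulmxA iM).
congr (iM *m _); rewrite !mulmxA MN -(mulmxA T) MN !mulmxA -(mulmxA _ M) MN.
by rewrite !mulmxA T3 -scalemxAr MN -scalemxAl.
Qed.

(** The profile frame M solves the equation in s.  The Lax equation for T makes
    N = M^-1 T M constant, so M(s) exp (t N) solves the equation in t as
    well. *)
Theorem frame_exists L d y (A B X : 'I_3 -> R -> R) : 0 < L -> 0 < d ->
  solves_system L d y ->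
  (forall j, frame_ode L d y (A j) (B j) (X j) /\
     [/\ smooth_on (sym_itv d) (A j), smooth_on (sym_itv d) (B j)
       & smooth_on (sym_itv d) (X j)]) ->
  (forall j, [/\ A j 0 = (j == 0)%:R, B j 0 = (j == 1)%:R & X j 0 = (j == 2%:R)%:R]) ->
  exists F : 'rV[R]_2 -> 'M[R]_4,
  [/\ forall x : 'rV[R]_2, sym_itv d (x 0 0) -> F x *m ip_mx *m (F x)^T = gram L,
      forall x v : 'rV[R]_2, sym_itv d (x 0 0) -> mder x v F (surface_conn L y x v *m F x) &
      forall U : set 'rV[R]_2, open U -> (forall x, U x -> sym_itv d (x 0 0)) ->
        forall a b, smooth_on U (fun x => F x a b)].
Proof.
move=> L_gt0 d_gt0 sol hABX init; have L0 : L != 0 by rewrite gt_eqF.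
have ode j : frame_ode L d y (A j) (B j) (X j) by have [] := hABX j.
pose M := profile_frame L A B X.
have Md s : sym_itv d s -> mder s 1 M (s_conn L y s *m M s).
  by move=> sd; exact: profile_frame_ode.
have le_itv s t : sym_itv d s -> `|t| <= `|s| -> sym_itv d t.
  by rewrite !sym_itvE => sd ts; exact: le_lt_trans sd.
have s_anti s : (s_conn L y s)^T *m gramV L + gramV L *m s_conn L y s = 0.
  exact: conn_antisym.
have t_anti s : (t_conn L y s)^T *m gramV L + gramV L *m t_conn L y s = 0.
  exact: conn_antisym.
have M0 : M 0 = frame0 L by exact: profile_frame0.
have MM s : sym_itv d s -> (M s)^T *m gramV L *m M s = ip_mx.
  move=> sd; rewrite -(frame0_gram L0) -M0.
  apply: (mder_cst (F := fun s => (M s)^T *m gramV L *m M s)) => t ts.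
  by apply: mder_gram (s_anti t) _; apply: Md; exact: le_itv ts.
pose N s := frame_inv L (M s) *m (t_conn L y s *m M s).
have NE s : sym_itv d s -> N s = N 0.
  move=> sd; apply: (mder_cst (F := N)) => t ts; have td := le_itv _ _ sd ts.
  apply: mder_eq (mderM (mder_frame_inv L (Md t td))
    (mderM (codazzi_gauss sol td) (Md t td))) _.
  by rewrite (frame_inv_deriv _ (s_anti t)) mulNmx mulmxBl !mulmxA subrK !mulmxA addNr.
pose mu := rho_of y 0 ^+ 2 * ((L ^+ 2)^-1 - q_of y 0 ^+ 2 + k2_of y 0 ^+ 2).
have d0 : sym_itv d 0 by rewrite sym_itvE normr0.
have [n [MN N3 Neta]] : exists n, [/\ forall s, sym_itv d s -> M s *m n = t_conn L y s *m M s,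
    n *m n *m n = mu *: n & n^T *m ip_mx + ip_mx *m n = 0].
  have MN s : sym_itv d s -> M s *m N 0 = t_conn L y s *m M s.
    by move=> sd; rewrite -(NE s sd) /N mulmxA (mul_frame_inv (MM s sd)) mul1mx.
  exists (N 0); split => //.
    apply: (similar_cube (frame_inv_mul (MM 0 d0)) (MN 0 d0)).
    exact: conn_cube.
  have := t_anti 0 => /(congr1 (fun Z => (M 0)^T *m Z *m M 0)).
  rewrite mulmx0 mul0mx => <-.
  have etaN : ip_mx *m N 0 = (M 0)^T *m (gramV L *m t_conn L y 0) *m M 0.
    by rewrite /N /frame_inv !mulmxA ip_mxK mul1mx.
  have NTe : (N 0)^T *m ip_mx = (M 0)^T *m ((t_conn L y 0)^T *m gramV L) *m M 0.
    rewrite -[LHS]trmxK trmx_mul trmxK ip_mx_sym etaN.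
    by rewrite !trmx_mul trmxK gramV_sym !mulmxA.
  by rewrite etaN NTe mulmxDr mulmxDl.
have [E [E0 Ed Es]] := matrix_exp_cubic N3.
have EE t : (E t)^T *m ip_mx *m E t = ip_mx.
  transitivity ((E 0)^T *m ip_mx *m E 0); last by rewrite E0 trmx1 mul1mx mulmx1.
  apply: (mder_cst (F := fun t => (E t)^T *m ip_mx *m E t)) => u _.
  apply: mder_eq (mderM (mderM (mderT (Ed u)) (mderC u 1 ip_mx)) (Ed u)) _.
  rewrite trmx_mul mulmx0 addr0 !mulmxA -mulmxDl -!(mulmxA (E u)^T) -mulmxDr.
  by rewrite Neta mulmx0 mul0mx.
exists (fun x => M (x 0 0) *m E (x 0 1)); split.
- move=> x xd; apply: (frame_gram L0).
  by rewrite trmx_mul !mulmxA -!(mulmxA (E _)^T) (MM _ xd) !mulmxA EE.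
- move=> x v xd.
  apply: mder_eq (mderM (mder_coord v (Md _ xd)) (mder_coord v (Ed (x 0 1)))) _.
  rewrite surface_connE mulmxDl -!scalemxAl -!scalemxAr -!mulmxA.
  by rewrite (mulmxA (M _)) MN // -mulmxA.
- move=> U oU Ud a b m; under eq_fun do rewrite mxE.
  apply: Ck_on_sum => // k; apply: Ck_onM => //; last first.
    by apply: (Ck_on_fun_coord oU _ (Es k b m)).
  apply: (Ck_on_fun_coord (f := fun s => M s a k) oU Ud).
  have oI := @open_sym_itv R d.
  have As j := hABX j.
  rewrite /M /profile_frame; under eq_fun do rewrite mxE.
  have cst c : Ck_on m (sym_itv d) (fun=> c : R) by exact: Ck_on_cst.
  case: a => [[|[|[|[|a]]]] a4]; case: k => [[|[|[|[|k]]]] k4]; rewrite /=;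
    solve [exact: cst | by have [_ [s1 s2 s3]] := As 2%:R
      | by have [_ [s1 s2 s3]] := As 1
      | by have [_ [s1 s2 s3]] := As 0; apply: Ck_onM | by []].
Qed.
End FrameExistence.

(** * Vector fields in a moving frame *)

Section IndefiniteProduct.
Context {R : realType}.
Implicit Types (L k : R) (u v w x : 'rV[R]_4).

Lemma ip_mxE v w : ip v w = (v *m ip_mx *m w^T) 0 0.
Proof.
rewrite !mxE !big_ord_recl big_ord0 !mxE !big_ord_recl !big_ord0 !mxE /= /ip.
have -> : inord 2 = lift ord0 (lift ord0 ord0) :> 'I_4 by apply/val_inj; rewrite /= inordK.
have -> : inord 3 = lift ord0 (lift ord0 (lift ord0 ord0)) :> 'I_4.
  by apply/val_inj; rewrite /= inordK.
have -> : 1 = lift ord0 ord0 :> 'I_4 by apply/val_inj.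
by ring.
Qed.

Lemma ipC v w : ip v w = ip w v.
Proof. by rewrite /ip; ring. Qed.

Lemma ipDl u v w : ip (u + v) w = ip u w + ip v w.
Proof. by rewrite !ip_mxE !mulmxDl mxE. Qed.

Lemma ipZl k v w : ip (k *: v) w = k * ip v w.
Proof. by rewrite !ip_mxE -!scalemxAl mxE. Qed.

Lemma ipZr k v w : ip w (k *: v) = k * ip w v.
Proof. by rewrite ipC ipZl (ipC w). Qed.

Lemma der_ip (V : normedModType R) (f g : V -> 'rV[R]_4) (x v : V) df dg :
  is_derive x v f df -> is_derive x v g dg ->
  is_derive x v (fun z => ip (f z) (g z)) (ip df (g x) + ip (f x) dg).
Proof.
move=> fd gd; have fj j := der_coord j fd; have gj j := der_coord j gd.
apply: is_derive_eq (derD (derD (derB (derN (derM (fj 0) (gj 0))) (derM (fj 1) (gj 1)))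
  (derM (fj (inord 2)) (gj (inord 2)))) (derM (fj (inord 3)) (gj (inord 3)))) _.
by rewrite /ip; ring.
Qed.
End IndefiniteProduct.

Section FrameCombinations.
Context {R : realType}.
Implicit Types (F : 'M[R]_4).

(** Vector fields along the surface are handled through their coefficients in a
    moving frame, so that identities between fields reduce to identities
    between scalars. *)
Definition cmb F (a b c d : R) : 'rV[R]_4 := (\row_j nth 0 [:: a; b; c; d] j) *m F.

Lemma cmbD F a b c d a' b' c' d' :
  cmb F a b c d + cmb F a' b' c' d' = cmb F (a + a') (b + b') (c + c') (d + d').
Proof.
rewrite /cmb -mulmxDl; congr (_ *m F); apply/rowP => j; rewrite !mxE.
by case: j => [[|[|[|[|j]]]] j4].
Qed.

Lemma cmbZ F k a b c d : k *: cmb F a b c d = cmb F (k * a) (k * b) (k * c) (k * d).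
Proof.
rewrite /cmb scalemxAl; congr (_ *m F); apply/rowP => j; rewrite !mxE.
by case: j => [[|[|[|[|j]]]] j4].
Qed.

Lemma cmbN F a b c d : - cmb F a b c d = cmb F (- a) (- b) (- c) (- d).
Proof. by rewrite -scaleN1r cmbZ !mulN1r. Qed.

Lemma cmbB F a b c d a' b' c' d' :
  cmb F a b c d - cmb F a' b' c' d' = cmb F (a - a') (b - b') (c - c') (d - d').
Proof. by rewrite cmbN cmbD. Qed.

Lemma cmb_eq0 F (a b c d : R) : a = 0 -> b = 0 -> c = 0 -> d = 0 -> cmb F a b c d = 0.
Proof.
move=> -> -> -> ->; rewrite /cmb (_ : (\row__ _) = 0) ?mul0mx //.
by apply/rowP => j; rewrite !mxE; case: j => [[|[|[|[|j]]]] j4].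
Qed.

Lemma cmb_congr F (a b c d a' b' c' d' : R) : a = a' -> b = b' -> c = c' -> d = d' ->
  cmb F a b c d = cmb F a' b' c' d'.
Proof. by move=> -> -> -> ->. Qed.

Lemma cmb_row F (i : 'I_4) : row i F =
  cmb F (i == 0 :> nat)%:R (i == 1%N :> nat)%:R (i == 2%N :> nat)%:R (i == 3%N :> nat)%:R.
Proof.
rewrite /cmb rowE; congr (_ *m F); apply/rowP => j; rewrite !mxE eqxx /=.
by case: i => [[|[|[|[|i]]]] i4]; case: j => [[|[|[|[|j]]]] j4].
Qed.

Lemma ip_cmb (L : R) F a b c d a' b' c' d' : F *m ip_mx *m F^T = gram L ->
  ip (cmb F a b c d) (cmb F a' b' c' d') =
    - (L ^+ 2 * (a * a')) + b * b' + c * c' - d * d'.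
Proof.
move=> FF; rewrite ip_mxE /cmb trmx_mul !mulmxA -!(mulmxA _ _ F^T) -(mulmxA _ F).
rewrite !mulmxA -(mulmxA _ F) -(mulmxA _ _ F^T) FF.
rewrite !mxE !big_ord_recl !big_ord0 !mxE !big_ord_recl !big_ord0 !mxE /=.
by ring.
Qed.

(** The position vector phi is normal to AdS, and is the first frame vector. *)
Lemma tproj_cmb (L : R) F a b c d : L != 0 -> F *m ip_mx *m F^T = gram L ->
  tproj L (cmb F 1 0 0 0) (cmb F a b c d) = cmb F 0 b c d.
Proof.
move=> L0 FF; rewrite /tproj (ip_cmb _ _ _ _ _ _ _ _ FF) cmbZ cmbD.
by apply: cmb_congr; field.
Qed.

End FrameCombinations.

Section AdaptedFrames.
Context {R : realType}.
Variables (L : R) (y : profile R) (U : set 'rV[R]_2) (F : 'rV[R]_2 -> 'M[R]_4).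

Definition adapted_frame : Prop :=
  (forall x, U x -> F x *m ip_mx *m (F x)^T = gram L) /\
  (forall x v, U x -> mder x v F (surface_conn L y x v *m F x)).

Hypothesis hF : adapted_frame.

(** Leibniz rule and the Gauss and Weingarten formulas. *)
Lemma der_cmb x v (c0 c1 c2 c3 : 'rV[R]_2 -> R) d0 d1 d2 d3 : U x ->
  is_derive x v c0 d0 -> is_derive x v c1 d1 ->
  is_derive x v c2 d2 -> is_derive x v c3 d3 ->
  let a := v 0 0 in let b := rho_of y (x 0 0) * v 0 1 in
  let k1 := k1_of y (x 0 0) in let k2 := k2_of y (x 0 0) in
  let q := q_of y (x 0 0) in
  is_derive x v (fun z => cmb (F z) (c0 z) (c1 z) (c2 z) (c3 z))
    (cmb (F x) (d0 + (c1 x * a + c2 x * b) / L ^+ 2)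
               (d1 + c0 x * a - c2 x * (b * q) - c3 x * (a * k1))
               (d2 + c0 x * b + c1 x * (b * q) - c3 x * (b * k2))
               (d3 - c1 x * (a * k1) - c2 x * (b * k2))).
Proof.
move=> Ux d0P d1P d2P d3P /=.
have cd : mder x v (fun z => \row_j nth 0 [:: c0 z; c1 z; c2 z; c3 z] j : 'rV[R]_4)
    (\row_j nth 0 [:: d0; d1; d2; d3] j).
  move=> i j; rewrite mxE; under eq_fun do rewrite mxE.
  by case: j => [[|[|[|[|j]]]] j4].
have Fd := hF.2 x v Ux.
apply: der_rV => j.
apply: is_derive_eq (mderM cd Fd 0 j) _.
rewrite mulmxA -mulmxDl /cmb; congr ((_ *m F x) 0 j).
apply/rowP => k; rewrite !mxE !big_ord_recl big_ord0 !mxE /=.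
by case: k => [[|[|[|[|k]]]] k4] //=; ring.
Qed.
End AdaptedFrames.

(** * The conformal metric *)

Lemma sum_ord2 (V : nmodType) (f : 'I_2 -> V) : \sum_i f i = f 0 + f 1.
Proof.
rewrite big_ord_recl big_ord1; congr (_ + f _).
by apply/val_inj.
Qed.

Lemma sum_diag2 (R : pzRingType) (V : lmodType R) (c : 'I_2 -> 'I_2 -> R) g
    (N : 'I_2 -> 'I_2 -> V) : (forall k l, c k l = if k == l then g k else 0) ->
  \sum_i \sum_j c i j *: N i j = g 0 *: N 0 0 + g 1 *: N 1 1.
Proof. by move=> cg; rewrite !sum_ord2 !cg /= !scale0r addr0 add0r. Qed.

Section ConformalMetric.
Context {R : realType}.
Variables (y : profile R).
Implicit Types (x v : 'rV[R]_2).

Definition conf_diag (j : 'I_2) (s : R) : R :=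
  (lambda_sq y s)^-1 * (if j == 0 then 1 else rho_of y s ^+ 2).

Lemma metric_confE x j l :
  metric_conf y x j l = if j == l then conf_diag j (x 0 0) else 0.
Proof. by rewrite !mxE; case: eqP => // _; rewrite mulr0. Qed.

Lemma invmx_of_mul1 n (A B : 'M[R]_n) : A *m B = 1%:M -> invmx A = B.
Proof.
move=> AB; have [uA _] := mulmx1_unit AB.
by rewrite -[RHS]mul1mx -(mulVmx uA) -mulmxA AB mulmx1.
Qed.

Lemma invmx_metric_conf x k l :
  (forall j, conf_diag j (x 0 0) != 0) ->
  invmx (metric_conf y x) k l = if k == l then (conf_diag k (x 0 0))^-1 else 0.
Proof.
move=> n0; rewrite (@invmx_of_mul1 _ _
    (\matrix_(k, l) if k == l then (conf_diag k (x 0 0))^-1 else 0)) ?mxE //.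
apply/matrixP => i j; rewrite mxE (bigD1 i) //= big1 => [|m mi].
  rewrite metric_confE eqxx !mxE addr0; case: eqP => _; rewrite ?mulr0 //.
  by rewrite mulfV.
by rewrite metric_confE eq_sym (negbTE mi) mul0r.
Qed.

Lemma der_metric_conf x v (dG : 'I_2 -> R) j l :
  (forall j, is_derive (x 0 0) 1 (conf_diag j) (dG j)) ->
  is_derive x v (fun z => metric_conf y z j l) (if j == l then v 0 0 * dG j else 0).
Proof.
move=> Gd; under eq_fun do rewrite metric_confE.
by case: eqP => _; [exact: der_fun_coord|exact: derC].
Qed.

Lemma coord_vecE (i j : 'I_2) : (coord_vec i : 'rV[R]_2) 0 j = (j == i)%:R.
Proof. by rewrite mxE eqxx. Qed.

(** The metric is diagonal and depends on s only, so all derivatives in the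
    direction t vanish. *)
Lemma christoffel_conf x (dG : 'I_2 -> R) i j k :
  (forall j, conf_diag j (x 0 0) != 0) ->
  (forall j, is_derive (x 0 0) 1 (conf_diag j) (dG j)) ->
  christoffel (metric_conf y) x i j k = (2 * conf_diag k (x 0 0))^-1 *
    ((i == 0)%:R * (j == k)%:R * dG k + (j == 0)%:R * (i == k)%:R * dG k
      - (k == 0)%:R * (i == j)%:R * dG i).
Proof.
move=> n0 Gd; rewrite /christoffel (bigD1 k) //= big1 => [|l lk]; last first.
  by rewrite (invmx_metric_conf _ _ n0) eq_sym (negbTE lk) mul0r.
rewrite (invmx_metric_conf _ _ n0) eqxx addr0.
rewrite !(is_deriveE (der_metric_conf _ _ _ Gd)) !coord_vecE.
rewrite [in RHS]invfM -[RHS]mulrA; congr (_ * (_ * _)).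
have [->|->] := ord2P i; have [->|->] := ord2P j; have [->|->] := ord2P k;
  by rewrite /=; ring.
Qed.
End ConformalMetric.

(** * The surface and its tension field *)

Section Surface.
Context {R : realType}.
Variables (L d : R) (y : profile R) (U : set 'rV[R]_2) (F : 'rV[R]_2 -> 'M[R]_4).
Hypothesis L_gt0 : 0 < L.
Hypothesis oU : open U.
Hypothesis Ud : forall x, U x -> sym_itv d (x 0 0).
Hypothesis sol : solves_system L d y.
Hypothesis rho_gt0 : forall s, sym_itv d s -> 0 < rho_of y s.
Hypothesis hF : adapted_frame L y U F.
Hypothesis smF : forall a b, smooth_on U (fun x => F x a b).

Definition surf (x : 'rV[R]_2) : 'rV[R]_4 := cmb (F x) 1 0 0 0.
Definition normal (x : 'rV[R]_2) : 'rV[R]_4 := cmb (F x) 0 0 0 1.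

Let L_neq0 : L != 0. Proof. by rewrite gt_eqF. Qed.
Let FF x : U x -> F x *m ip_mx *m (F x)^T = gram L. Proof. exact: hF.1. Qed.
Let rho_neq0 x : U x -> rho_of y (x 0 0) != 0.
Proof. by move=> Ux; rewrite gt_eqF // rho_gt0 //; exact: Ud. Qed.

Lemma der_rho x v : U x -> is_derive x v (fun z => rho_of y (z 0 0))
  (v 0 0 * (q_of y (x 0 0) * rho_of y (x 0 0))).
Proof. by move=> /Ud /sol [[_ rd _ _] _]; exact: der_fun_coord. Qed.

Lemma der_k1 x v : U x -> is_derive x v (fun z => k1_of y (z 0 0))
  (v 0 0 * (- (2 * k1_of y (x 0 0) * (p_of y (x 0 0) / u_of y (x 0 0)))
         - q_of y (x 0 0) * (k1_of y (x 0 0) - k2_of y (x 0 0)))).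
Proof. by move=> /Ud /sol [_ [_ k1d _]]; exact: der_fun_coord. Qed.

Lemma der_k2 x v : U x -> is_derive x v (fun z => k2_of y (z 0 0))
  (v 0 0 * (q_of y (x 0 0) * (k1_of y (x 0 0) - k2_of y (x 0 0)))).
Proof. by move=> /Ud /sol [_ [k2d _ _]]; exact: der_fun_coord. Qed.

Lemma der_u x v : U x -> is_derive x v (fun z => u_of y (z 0 0))
  (v 0 0 * p_of y (x 0 0)).
Proof. by move=> /Ud /sol [[_ _ ud _] _]; exact: der_fun_coord. Qed.

Lemma der_p x v : U x -> is_derive x v (fun z => p_of y (z 0 0))
  (v 0 0 * (- (q_of y (x 0 0) * p_of y (x 0 0))
     - (k1_of y (x 0 0) ^+ 2 + k2_of y (x 0 0) ^+ 2 - 2 / L ^+ 2) * u_of y (x 0 0))).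
Proof. by move=> /Ud /sol [[_ _ _ pd] _]; exact: der_fun_coord. Qed.

Lemma der_surf x v : U x -> is_derive x v surf
  (cmb (F x) 0 (v 0 0) (rho_of y (x 0 0) * v 0 1) 0).
Proof.
move=> Ux; apply: is_derive_eq (der_cmb hF Ux (derC 1 x v) (derC 0 x v)
  (derC 0 x v) (derC 0 x v)) _.
by apply: cmb_congr; rewrite /=; ring.
Qed.

Lemma der_normal x v : U x -> is_derive x v normal
  (cmb (F x) 0 (- (v 0 0 * k1_of y (x 0 0)))
     (- (rho_of y (x 0 0) * v 0 1 * k2_of y (x 0 0))) 0).
Proof.
move=> Ux; apply: is_derive_eq (der_cmb hF Ux (derC 0 x v) (derC 0 x v)
  (derC 0 x v) (derC 1 x v)) _.
by apply: cmb_congr; rewrite /=; ring.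
Qed.

Lemma smooth_row i : smooth_on U (fun x => row i (F x)).
Proof.
move=> n; apply: Ck_on_rV => // j.
by under eq_fun do rewrite mxE; exact: smF.
Qed.

Lemma surf_row x : surf x = row 0 (F x). Proof. by rewrite cmb_row. Qed.
Lemma normal_row x : normal x = row 3%:R (F x). Proof. by rewrite cmb_row. Qed.

Lemma pullback_surf x : U x -> pullback_metric surf x = metric_g y x.
Proof.
move=> Ux; apply/matrixP => i j; rewrite !mxE.
rewrite !(is_deriveE (der_surf _ Ux)) (ip_cmb _ _ _ _ _ _ _ _ (FF Ux)) !coord_vecE.
by have [->|->] := ord2P i; have [->|->] := ord2P j; rewrite /=; ring.
Qed.

Theorem surf_realizes : realizes L y U surf normal.
Proof.
have pos x v : U x -> v != 0 -> 0 < metric_app (pullback_metric surf) x v v.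
  move=> Ux v0; rewrite /metric_app pullback_surf //.
  have -> : (v *m metric_g y x *m v^T) 0 0 =
      v 0 0 ^+ 2 + (rho_of y (x 0 0) * v 0 1) ^+ 2.
    by rewrite !mxE sum_ord2 !mxE !sum_ord2 !mxE /=; ring.
  have [v00|v00] := eqVneq (v 0 0) 0; last first.
    by rewrite ltr_pwDl ?sqr_ge0 // exprn_even_gt0.
  rewrite ltr_wpDl ?sqr_ge0 // exprn_even_gt0 //= mulf_neq0 ?rho_neq0 //.
  apply: contra_neq v0 => v01; apply/rowP => j; rewrite mxE.
  by have [->|->] := ord2P j.
have met v x : U x -> metric_app (pullback_metric surf) x v v =
    ip ('D_v surf x) ('D_v surf x).
  move=> Ux; rewrite /metric_app pullback_surf // (is_deriveE (der_surf _ Ux)).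
  rewrite (ip_cmb _ _ _ _ _ _ _ _ (FF Ux)) !mxE sum_ord2 !mxE !sum_ord2 !mxE /=; ring.
split.
- split => //.
  + by rewrite (_ : surf = (fun x => row 0 (F x))); [exact: smooth_row|exact/funext/surf_row].
  + by move=> x Ux; rewrite /AdS /= /surf (ip_cmb _ _ _ _ _ _ _ _ (FF Ux)); ring.
  + move=> x v Ux Dv; apply/eqP/negPn/negP => /(pos _ _ Ux).
    by rewrite met // Dv ip_mxE !mul0mx mxE ltxx.
- exact: pullback_surf.
- split.
    rewrite (_ : normal = (fun x => row 3%:R (F x))); first exact: smooth_row.
    exact/funext/normal_row.
  move=> x Ux; split; rewrite /tangent_AdS /normal /surf.
  + by rewrite (ip_cmb _ _ _ _ _ _ _ _ (FF Ux)); ring.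
  + by move=> v; rewrite (is_deriveE (der_surf _ Ux)) (ip_cmb _ _ _ _ _ _ _ _ (FF Ux)); ring.
  + by rewrite (ip_cmb _ _ _ _ _ _ _ _ (FF Ux)); ring.
- exists (fun x => \matrix_(i, j) if i == j then
      (if i == 0 then k1_of y (x 0 0) else k2_of y (x 0 0)) else 0).
    move=> x v Ux; rewrite /nablaphi (is_deriveE (der_normal _ Ux)).
    rewrite /surf (tproj_cmb _ _ _ _ L_neq0 (FF Ux)) (is_deriveE (der_surf _ Ux)) cmbN.
    by apply: cmb_congr; rewrite ?mxE ?sum_ord2 ?mxE /=; ring.
  move=> x Ux; split; apply/rowP => j; rewrite !mxE sum_ord2 !mxE /=;
    have [->|->] := ord2P j; rewrite /=; ring.
Qed.

Section Tension.
Hypothesis lambda_gt0 : forall s, sym_itv d s -> 0 < lambda_sq y s.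

Lemma conf_diag_gt0 x : U x -> forall j, 0 < conf_diag y j (x 0 0).
Proof.
move=> Ux j; rewrite /conf_diag mulr_gt0 ?invr_gt0 ?lambda_gt0 //; first exact: Ud.
by case: eqP => // _; rewrite exprn_gt0 // rho_gt0 //; exact: Ud.
Qed.

Let conf_neq0 x (Ux : U x) j : conf_diag y j (x 0 0) != 0.
Proof. by rewrite gt_eqF // conf_diag_gt0. Qed.

Lemma mean_curv_neq0 s : sym_itv d s -> mean_curv y s != 0.
Proof.
move=> /lambda_gt0; rewrite /lambda_sq; case: eqP => // ->.
by rewrite invr0 mulr0 ltxx.
Qed.

Lemma der_conf_factor s : sym_itv d s ->
  exists df, is_derive s 1 (fun s => (lambda_sq y s)^-1) df.
Proof.
move=> sd; have [[u0 _ ud _] [k2d k1d _]] := sol sd.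
have lam0 : lambda_sq y s != 0 by rewrite gt_eqF // lambda_gt0.
have Hd := derN (derM (derD k1d k2d) (derC 2^-1 s 1)).
have ld := derM ud (derV (mean_curv_neq0 sd) Hd).
by eexists; exact: (derV (f := lambda_sq y) lam0 ld).
Qed.

(** The derivative of the metric coefficients in terms of the derivative df of
    the conformal factor.  The value of df is never computed: it cancels both
    in the tension field and in the bitension field. *)
Definition conf_dG (s df : R) (j : 'I_2) : R :=
  if j == 0 then df
  else df * rho_of y s ^+ 2 +
       (lambda_sq y s)^-1 * (2 * (rho_of y s * (q_of y s * rho_of y s))).

Lemma der_conf_diag s df : sym_itv d s ->
  is_derive s 1 (fun s => (lambda_sq y s)^-1) df ->
  forall j, is_derive s 1 (conf_diag y j) (conf_dG s df j).
Proof.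
move=> sd fd j; have [[_ rd _ _] _] := sol sd.
rewrite /conf_diag /conf_dG; case: (j == 0).
  by apply: is_derive_eq (derM fd (derC 1 s 1)) _; ring.
by apply: is_derive_eq (derM fd (derX2 rd)) _.
Qed.

(** The coefficient of e1 vanishes identically: the terms in df cancel, as well
    as those in q.  The coefficient of xi is - (k1 + k2) lambda^2, that is
    2 H lambda^2, and lambda^2 = u / H. *)
Lemma tension_surf x : U x ->
  tension_field L (metric_conf y) surf x = (2 * u_of y (x 0 0)) *: normal x.
Proof.
move=> Ux; have sd := Ud Ux; have [df fd] := der_conf_factor sd.
have Gd := der_conf_diag sd fd; have n0 := conf_neq0 Ux.
have [[u0 _ _ _] _] := sol sd.
have lam0 : lambda_sq y (x 0 0) != 0 by rewrite gt_eqF // lambda_gt0.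
have H0 := mean_curv_neq0 sd; have rho0 := rho_neq0 Ux.
have nabMk (i : 'I_2) k : nablaM (metric_conf y) (fun=> coord_vec i)
    (fun=> coord_vec i) x 0 k = christoffel (metric_conf y) x i i k.
  rewrite /nablaM derive_cst add0r mxE (bigD1 i) //= [X in _ + X]big1 => [|a ai].
    rewrite (bigD1 i) //= [X in _ + X + _]big1 => [|b bi].
      by rewrite !coord_vecE eqxx !addr0 !mulr1.
    by rewrite (coord_vecE i b) (negbTE bi) mulr0.
  by rewrite big1 // => b _; rewrite (coord_vecE i a) (negbTE ai) mulr0 mul0r.
have D1 i : is_derive x (coord_vec i : 'rV[R]_2) (fun z => 'D_(coord_vec i) surf z)
    (cmb (F x) ((i == 0)%:R / L ^+ 2 + (i == 1)%:R * rho_of y (x 0 0) ^+ 2 / L ^+ 2)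
      (- ((i == 1)%:R * rho_of y (x 0 0) ^+ 2 * q_of y (x 0 0))) 0
      (- ((i == 0)%:R * k1_of y (x 0 0)) -
         (i == 1)%:R * rho_of y (x 0 0) ^+ 2 * k2_of y (x 0 0))).
  apply: (der_near oU Ux (f := fun z =>
      cmb (F z) 0 ((coord_vec i : 'rV[R]_2) 0 0)
       (rho_of y (z 0 0) * (coord_vec i : 'rV[R]_2) 0 1) 0)).
    by move=> z Uz; rewrite (is_deriveE (der_surf _ Uz)).
  apply: is_derive_eq (der_cmb hF Ux (derC 0 x _) (derC _ x _)
    (derM (der_rho _ Ux) (derC _ x _)) (derC 0 x _)) _.
  by rewrite !coord_vecE; have [->|->] := ord2P i; apply: cmb_congr; rewrite /=; ring.
have nab i : nabla_dphi L (metric_conf y) surf (fun=> coord_vec i) (fun=> coord_vec i) x =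
   cmb (F x) 0
     (- ((i == 1)%:R * rho_of y (x 0 0) ^+ 2 * q_of y (x 0 0))
       - christoffel (metric_conf y) x i i 0)
     (- (rho_of y (x 0 0) * christoffel (metric_conf y) x i i 1))
     (- ((i == 0)%:R * k1_of y (x 0 0)) -
         (i == 1)%:R * rho_of y (x 0 0) ^+ 2 * k2_of y (x 0 0)).
  rewrite /nabla_dphi /nablaphi (is_deriveE (D1 i)) [surf x]/surf.
  rewrite (tproj_cmb _ _ _ _ L_neq0 (FF Ux)) (is_deriveE (der_surf _ Ux)) !nabMk cmbB.
  by apply: cmb_congr; ring.
rewrite /tension_field (sum_diag2 _ (fun k l => invmx_metric_conf k l n0)).
rewrite !nab /normal !cmbZ cmbD.
rewrite !(christoffel_conf _ _ _ n0 Gd) /= /conf_diag /conf_dG /=.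
move: u0 lam0 H0 rho0 df {fd Gd n0 nab D1 nabMk}.
rewrite /lambda_sq.
have HE : k2_of y (x 0 0) = - 2 * mean_curv y (x 0 0) - k1_of y (x 0 0).
  by rewrite /mean_curv; field.
move: (mean_curv y _) (k1_of _ _) (k2_of _ _) (rho_of _ _) (q_of _ _) (u_of _ _) HE.
move=> H k1 k2 rho q u -> u0 lam0 H0 rho0 df.
apply: cmb_congr.
- ring.
- by field; rewrite u0 H0 rho0.
- by field; rewrite u0 H0 rho0.
- by field; rewrite u0 H0 rho0.
Qed.
End Tension.
End Surface.

(** * Curvature of anti-de Sitter space *)

Section Curvature.
Context {R : realType}.
Implicit Types (L : R) (v w z x : 'rV[R]_4).

Lemma der_ipr (V : normedModType R) (f : V -> 'rV[R]_4) (x v : V) df z :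
  is_derive x v f df -> is_derive x v (fun t => ip z (f t)) (ip z df).
Proof.
move=> fd; apply: is_derive_eq (der_ip (is_derive_cst z x v) fd) _.
by rewrite -{1}(scale0r z) ipZl mul0r add0r.
Qed.

Lemma der_tproj L x v (T : 'rV[R]_4 -> 'rV[R]_4) dT : is_derive x v T dT ->
  is_derive x v (fun t => tproj L t (T t))
   (dT + ((ip dT x + ip (T x) v) / L ^+ 2 *: x + (ip (T x) x / L ^+ 2) *: v)).
Proof.
move=> Td; have idd := is_derive_id x v.
have cd := derM (der_ip Td idd) (derC (L ^+ 2)^-1 x v).
apply: is_derive_eq (derDv Td (derZv cd idd)) _.
by rewrite mulr0 addr0.
Qed.

Lemma der_tproj_cst L x v z : is_derive x v (tproj L ^~ z)
  ((ip z v / L ^+ 2) *: x + (ip z x / L ^+ 2) *: v).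
Proof.
apply: is_derive_eq (der_tproj L (is_derive_cst z x v)) _.
by rewrite add0r -{1}(scale0r z) ipZl mul0r add0r.
Qed.

Lemma tproj_tangent L x v : ip v x = 0 -> tproj L x v = v.
Proof. by move=> vx; rewrite /tproj vx mul0r scale0r addr0. Qed.

(** Constant curvature - 1/L^2.  Extended by tangential projection, a constant
    vector z satisfies nabla_w z = (<z, y> / L^2) w at y, up to terms that
    vanish to first order on AdS; the bracket of two such fields vanishes at
    x. *)
Theorem curvature_AdS L x v w z : L != 0 -> AdS L x ->
  ip v x = 0 -> ip w x = 0 -> ip z x = 0 ->
  curvature L x v w z = (ip v z / L ^+ 2) *: w - (ip w z / L ^+ 2) *: v.
Proof.
move=> L0 xx; rewrite /AdS /= in xx.
have cov v' w' : ip v' x = 0 -> ip w' x = 0 -> ip z x = 0 ->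
    nablaN L (tproj L ^~ v') (nablaN L (tproj L ^~ w') (tproj L ^~ z)) x =
    (ip v' z / L ^+ 2) *: w'.
  move=> vx wx zx.
  pose W t := tproj L t w'.
  pose T t := (ip z (W t) / L ^+ 2) *: t + (ip z t / L ^+ 2) *: W t.
  have NE : nablaN L (tproj L ^~ w') (tproj L ^~ z) = fun t => tproj L t (T t).
    apply/funext => t; rewrite /nablaN /T.
    by rewrite (is_deriveE (der_tproj_cst L t (W t) z)).
  have Wx : W x = w' by rewrite /W tproj_tangent.
  have Wd : is_derive x v' W ((ip w' v' / L ^+ 2) *: x).
    apply: is_derive_eq (der_tproj_cst L x v' w') _.
    by rewrite wx mul0r scale0r addr0.
  have cL (f : 'rV[R]_4 -> R) df : is_derive x v' f df ->
      is_derive x v' (fun t => f t / L ^+ 2) (df / L ^+ 2).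
    move=> fd; apply: is_derive_eq (derM fd (derC (L ^+ 2)^-1 x v')) _.
    by rewrite mulr0 addr0.
  have Td : is_derive x v' T ((ip z w' / L ^+ 2) *: v' + (ip v' z / L ^+ 2) *: w').
    apply: is_derive_eq (derDv (derZv (cL _ _ (der_ipr z Wd)) (is_derive_id x v'))
      (derZv (cL _ _ (der_ipr z (is_derive_id x v'))) Wd)) _.
    by rewrite Wx ipZr zx mulr0 !mul0r !scale0r add0r addr0 (ipC z v').
  rewrite {1}/nablaN NE (tproj_tangent L vx) (is_deriveE (der_tproj L Td)).
  have Tx : T x = (ip z w' / L ^+ 2) *: x.
    by rewrite /T Wx zx mul0r scale0r addr0.
  rewrite Tx ipDl !ipZl vx wx (ipC x v') vx xx !mulr0 !addr0 mul0r scale0r add0r.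
  have -> : ip z w' / L ^+ 2 * - L ^+ 2 / L ^+ 2 = - (ip z w' / L ^+ 2) by field.
  by rewrite scaleNr addrAC subrr add0r tproj_tangent // ipZl wx mulr0.
move=> vx wx zx; rewrite /curvature /curvature_field !cov //.
have -> : nablaN L (lie_bracket (tproj L ^~ v) (tproj L ^~ w)) (tproj L ^~ z) x = 0.
  have bracket0 : lie_bracket (tproj L ^~ v) (tproj L ^~ w) x = 0.
    rewrite /lie_bracket (tproj_tangent L vx) (tproj_tangent L wx).
    rewrite (is_deriveE (der_tproj_cst L x v w)) (is_deriveE (der_tproj_cst L x w v)).
    by rewrite vx wx !mul0r !scale0r !addr0 (ipC w v) subrr.
  by rewrite /nablaN bracket0 derive0 tproj_tangent // -(scale0r x) ipZl mul0r.
by rewrite subr0.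
Qed.
End Curvature.

(** * The bitension field *)

Section Bitension.
Context {R : realType}.
Variables (L d : R) (y : profile R) (U : set 'rV[R]_2) (F : 'rV[R]_2 -> 'M[R]_4).
Hypothesis L_gt0 : 0 < L.
Hypothesis oU : open U.
Hypothesis Ud : forall x, U x -> sym_itv d (x 0 0).
Hypothesis sol : solves_system L d y.
Hypothesis rho_gt0 : forall s, sym_itv d s -> 0 < rho_of y s.
Hypothesis hF : adapted_frame L y U F.
Hypothesis lambda_gt0 : forall s, sym_itv d s -> 0 < lambda_sq y s.

Let L_neq0 : L != 0. Proof. by rewrite gt_eqF. Qed.
Let FF x : U x -> F x *m ip_mx *m (F x)^T = gram L. Proof. exact: hF.1. Qed.
Let rho_neq0 x : U x -> rho_of y (x 0 0) != 0.
Proof. by move=> Ux; rewrite gt_eqF // rho_gt0 //; exact: Ud. Qed.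

Let G := metric_conf y.
Let V := tension_field L G (surf F).

(** Along U, the tension field 2 u xi has derivative 2 p ds xi + 2 u d xi. *)
Lemma nablaphi_tension x v : U x -> nablaphi L (surf F) v V x =
  cmb (F x) 0 (- (2 * u_of y (x 0 0) * k1_of y (x 0 0) * v 0 0))
    (- (2 * u_of y (x 0 0) * k2_of y (x 0 0) * rho_of y (x 0 0) * v 0 1))
    (2 * p_of y (x 0 0) * v 0 0).
Proof.
move=> Ux; rewrite /nablaphi.
have Vd : is_derive x v V (cmb (F x) 0 (- (2 * u_of y (x 0 0) * k1_of y (x 0 0) * v 0 0))
    (- (2 * u_of y (x 0 0) * k2_of y (x 0 0) * rho_of y (x 0 0) * v 0 1))
    (2 * p_of y (x 0 0) * v 0 0)).
  apply: (der_near oU Ux (f := fun z => cmb (F z) 0 0 0 (2 * u_of y (z 0 0)))).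
    move=> z Uz; rewrite /V /G (tension_surf L_gt0 oU Ud sol rho_gt0 hF lambda_gt0 Uz).
    by rewrite /normal cmbZ; apply: cmb_congr; ring.
  apply: is_derive_eq (der_cmb hF Ux (derC 0 x v) (derC 0 x v) (derC 0 x v)
    (derM (derC 2 x v) (der_u Ud sol v Ux))) _.
  by apply: cmb_congr; rewrite /=; ring.
by rewrite (is_deriveE Vd) /surf (tproj_cmb _ _ _ _ L_neq0 (FF Ux)).
Qed.

(** One summand of the rough Laplacian, for an arbitrary frame field e = (a, b).
    The derivatives of a and b cancel, and what remains is a quadratic form in
    (a, b); the sum of the products a b over an orthonormal frame is 0, which removes
    the term in X because X is the same for all frames. *)
Lemma rough_laplacian_term x df : U x ->
  is_derive (x 0 0) 1 (fun s => (lambda_sq y s)^-1) df ->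
  let s := x 0 0 in
  let c := df / (lambda_sq y s)^-1 in
  exists X : R, forall (W : set 'rV[R]_2) (e : 'rV[R]_2 -> 'rV[R]_2),
  open W -> W `<=` U -> smooth_on W e -> W x ->
  let a := e x 0 0 in let b := e x 0 1 in
  nablaphi L (surf F) (e x) (fun z => nablaphi L (surf F) (e z) V z) x
     - nablaphi L (surf F) (nablaM G e e x) V x =
  cmb (F x) 0
   (a * a * (2 * q_of y s * u_of y s * (k1_of y s - k2_of y s)
               + u_of y s * k1_of y s * c) +
    b * b * (2 * u_of y s * k2_of y s * q_of y s * rho_of y s ^+ 2
      - u_of y s * k1_of y s * rho_of y s ^+ 2 * (c + 2 * q_of y s)))
   (a * b * X)
   (a * a * (2 * (- (q_of y s * p_of y s)
     - (k1_of y s ^+ 2 + k2_of y s ^+ 2 - 2 / L ^+ 2) * u_of y s)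
        + 2 * u_of y s * k1_of y s ^+ 2 - p_of y s * c) +
    b * b * (rho_of y s ^+ 2 * (2 * u_of y s * k2_of y s ^+ 2
      + p_of y s * (c + 2 * q_of y s)))).
Proof.
move=> Ux fd s c; have sd := Ud Ux; pose g := (lambda_sq y s)^-1.
have [[u0 _ _ _] _] := sol sd.
have lam0 : lambda_sq y s != 0 by rewrite gt_eqF // lambda_gt0.
have rho0 := rho_neq0 Ux.
have Gd := der_conf_diag sol sd fd.
have n0 j : conf_diag y j (x 0 0) != 0.
  by rewrite gt_eqF // (conf_diag_gt0 Ud rho_gt0 lambda_gt0 Ux).
pose C := (2 * conf_diag y 1 s)^-1 * conf_dG y s df 1 * 2.
exists (- 2 * (p_of y s * k2_of y s * rho_of y s +
    u_of y s * (q_of y s * (k1_of y s - k2_of y s)) * rho_of y s +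
    u_of y s * k2_of y s * q_of y s * rho_of y s) -
  2 * u_of y s * k1_of y s * rho_of y s * q_of y s
  - 2 * p_of y s * rho_of y s * k2_of y s
  + 2 * u_of y s * k2_of y s * rho_of y s * C) => W e oW WU se Wx a b.
have ed : is_derive x (e x) e ('D_(e x) e x) := Ck_on_is_derive (e x) (se 1%N) Wx.
set a' := 'D_(e x) e x 0 0; set b' := 'D_(e x) e x 0 1.
have ad : is_derive x (e x) (fun z => e z 0 0) a' := der_coord 0 ed.
have bd : is_derive x (e x) (fun z => e z 0 1) b' := der_coord 1 ed.
have w0 : nablaM G e e x 0 0 = a' + (c / 2 * a ^+ 2
    - rho_of y s ^+ 2 * (c + 2 * q_of y s) / 2 * b ^+ 2).
  rewrite /nablaM !mxE -/a' !sum_ord2 /G !(christoffel_conf _ _ _ n0 Gd) /=.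
  rewrite /conf_diag /conf_dG /= -/s -/a -/b /c.
  by field.
have w1 : nablaM G e e x 0 1 = b' + C * (a * b).
  rewrite /nablaM !mxE -/b' !sum_ord2 /G !(christoffel_conf _ _ _ n0 Gd) /= /C.
  by rewrite -/s -/a -/b; ring.
rewrite (nablaphi_tension _ Ux) w0 w1.
have two := derC 2 x (e x).
have ud := der_u Ud sol (e x) Ux; have pd := der_p Ud sol (e x) Ux.
have k1d := der_k1 Ud sol (e x) Ux; have k2d := der_k2 Ud sol (e x) Ux.
have rd := der_rho Ud sol (e x) Ux.
have Nd := der_cmb hF Ux (derC 0 x (e x))
  (derN (derM (derM (derM two ud) k1d) ad))
  (derN (derM (derM (derM (derM two ud) k2d) rd) bd))
  (derM (derM two pd) ad).
have {}Nd := der_near oW Wx (fun z Wz => esym (nablaphi_tension (e z) (WU _ Wz))) Nd.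
rewrite {1}/nablaphi (is_deriveE Nd) {1}/surf (tproj_cmb _ _ _ _ L_neq0 (FF Ux)) cmbB.
by apply: cmb_congr; rewrite -/s -/a -/b; field.
Qed.

Lemma curvature_term x v : U x ->
  curvature L (surf F x) ('D_v (surf F) x) (V x) ('D_v (surf F) x) =
  cmb (F x) 0 0 0 ((v 0 0 * v 0 0 + rho_of y (x 0 0) ^+ 2 * (v 0 1 * v 0 1))
    * (2 * u_of y (x 0 0) / L ^+ 2)).
Proof.
move=> Ux; rewrite /V /G (tension_surf L_gt0 oU Ud sol rho_gt0 hF lambda_gt0 Ux).
rewrite (is_deriveE (der_surf hF v Ux)) /normal cmbZ /surf.
have ipE := ip_cmb _ _ _ _ _ _ _ _ (FF Ux).
rewrite curvature_AdS // /AdS /= ?ipE; try by ring.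
by rewrite !cmbZ cmbB; apply: cmb_congr; field.
Qed.

(** The metric is positive definite, so all signs of the frame are 1.  If E is the
    matrix of the frame and G that of the metric, then E G E^T = 1 gives
    G E^T E = 1, that is E^T E = G^-1. *)
Lemma orthonormal_frame_inv (W : set 'rV[R]_2) eps e x :
  W `<=` U -> orthonormal_frame G W eps e -> W x ->
  (forall i, eps i = 1) /\
  forall j k, \sum_i e i x 0 j * e i x 0 k =
    if j == k then (conf_diag y j (x 0 0))^-1 else 0.
Proof.
move=> WU [epsP _ on] Wx; have Ux := WU _ Wx.
have pos := conf_diag_gt0 Ud rho_gt0 lambda_gt0 Ux.
have eps1 i : eps i = 1.
  case: (epsP i) => // epsN; have := on x i i Wx; rewrite eqxx epsN.
  rewrite /metric_app !mxE sum_ord2 !mxE !sum_ord2 /G !metric_confE /= => E.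
  have p0 := mulr_ge0 (ltW (pos 0)) (sqr_ge0 (e i x 0 0)).
  have p1 := mulr_ge0 (ltW (pos 1)) (sqr_ge0 (e i x 0 1)).
  exfalso; move: E p0 p1; rewrite !mulr0 add0r addr0.
  move: (conf_diag _ _ _) (conf_diag _ _ _) => g0 g1 E p0 p1.
  suff : 0 <= (-1 : R) by rewrite ler0N1.
  rewrite -E !expr2 in p0 p1 *; lra.
split=> // j k.
pose E := \matrix_(i, j) e i x 0 j : 'M[R]_2.
have EGE : E *m (G x *m E^T) = 1%:M.
  apply/matrixP => i l; rewrite [RHS]mxE.
  have -> : (i == l)%:R = (if i == l then eps i else 0) by rewrite eps1; case: eqP.
  rewrite -(on x i l Wx) /metric_app -mulmxA !mxE.
  apply: eq_bigr => m _; rewrite !mxE; congr (_ * _).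
  by apply: eq_bigr => m' _; rewrite !mxE.
have := mulmx1C EGE; rewrite -mulmxA => /invmx_of_mul1 EE.
have n0 i : conf_diag y i (x 0 0) != 0 by rewrite gt_eqF.
rewrite -(invmx_metric_conf j k n0) -/(G x) EE mxE.
by apply: eq_bigr => i _; rewrite !mxE.
Qed.

(** By orthonormal_frame_inv, the sum over the frame replaces a a, b b and a b by
    the entries of the inverse metric.  The equations for k1' and p', which
    make the e1 and xi components vanish, have already been used to write
    the summands in rough_laplacian_term. *)
Theorem surf_biharmonic : biharmonic_map L (metric_conf y) U (surf F).
Proof.
move=> W eps e oW WU on x Wx; have Ux := WU _ Wx.
have [eps1 sums] := orthonormal_frame_inv WU on Wx.
have [_ se _] := on.
have sd := Ud Ux; have [df fd] := der_conf_factor sol lambda_gt0 sd.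
have [X lap] := rough_laplacian_term Ux fd.
have rho0 := rho_neq0 Ux.
have lam0 : lambda_sq y (x 0 0) != 0 by rewrite gt_eqF // lambda_gt0.
pose T i := nablaphi L (surf F) (e i x) (fun z => nablaphi L (surf F) (e i z) V z) x
  - nablaphi L (surf F) (nablaM G (e i) (e i) x) V x.
pose K i := curvature L (surf F x) ('D_(e i x) (surf F) x) (V x) ('D_(e i x) (surf F) x).
have -> : bitension_field L (metric_conf y) eps e (surf F) x = \sum_i T i - \sum_i K i.
  by congr (_ - _); apply: eq_bigr => i _; rewrite eps1 scale1r.
have lapE i : T i = _ := lap W (e i) oW WU (se i) Wx.
have curvE i : K i = _ := curvature_term (e i x) Ux.
clearbody T K; rewrite (sum_ord2 T) (sum_ord2 K) (lapE 0) (lapE 1) (curvE 0) (curvE 1).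
rewrite !cmbD cmbB.
have s00 := sums 0 0; have s01 := sums 0 1; have s11 := sums 1 1.
rewrite sum_ord2 /conf_diag /= in s00; rewrite sum_ord2 /= in s01.
rewrite sum_ord2 /conf_diag /= in s11.
set A := _^-1 in s00; set B := _^-1 in s11.
have AB : A = rho_of y (x 0 0) ^+ 2 * B by rewrite /A /B; field; rewrite lam0 rho0.
have a0 := canRL (addrK _) s00; have b0 := canRL (addrK _) s11.
have ab0 := canRL (addrK _) s01.
apply: cmb_eq0.
- by ring.
- rewrite a0 b0 AB; by ring.
- by rewrite ab0; ring.
- by rewrite a0 b0 AB; ring.
Qed.
End Bitension.

(** * Local uniqueness of the immersion *)

Section LinearIsometries.
Context {R : realType}.
Implicit Types (C : 'M[R]_4) (v w x : 'rV[R]_4).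

Lemma der_mulmx C x v : is_derive x v (fun z => z *m C) (v *m C).
Proof.
have idd : mder x v (fun z : 'rV[R]_4 => z) v.
  by move=> i j; rewrite ord1; apply: (der_coord j (is_derive_id x v)).
apply: der_rV => j; apply: is_derive_eq (mderM idd (mderC x v C) 0 j) _.
by rewrite mulmx0 addr0.
Qed.

Lemma smooth_id : smooth_on setT (fun z : 'rV[R]_4 => z).
Proof.
move=> [|n]; first by split=> // x _; exact: cvg_id.
apply: (@Ck_onS _ _ _ _ _ _ (fun v _ => v)) => // [|x _|v]; first exact: openT.
- exact: cvg_id.
- by apply: Ck_on_cst; exact: openT.
Qed.

Lemma smooth_mulmx C : smooth_on setT (fun z : 'rV[R]_4 => z *m C).
Proof.
move=> n; have o := @openT 'rV[R]_4; apply: Ck_on_rV => // j.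
under eq_fun do rewrite mxE.
apply: Ck_on_sum => // k; apply: Ck_onM => //; last exact: Ck_on_cst.
by apply: (Ck_on_coord k o); exact: smooth_id.
Qed.

Lemma ip_mulmx C v w : C *m ip_mx *m C^T = ip_mx -> ip (v *m C) (w *m C) = ip v w.
Proof.
move=> CC; rewrite !ip_mxE trmx_mul !mulmxA.
by rewrite -(mulmxA v C) -(mulmxA v (C *m _)) CC.
Qed.

(** A matrix that preserves the scalar product of R^{2,2} acts on AdS, with
    inverse ip_mx C^T ip_mx. *)
Lemma isometry_mulmx (L : R) C : C *m ip_mx *m C^T = ip_mx ->
  isometry_AdS L (fun z => z *m C).
Proof.
move=> CC; pose D := ip_mx *m C^T *m ip_mx.
have CD : C *m D = 1%:M by rewrite /D !mulmxA CC ip_mxK.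
have DC : D *m C = 1%:M by exact: mulmx1C.
have DD : D *m ip_mx *m D^T = ip_mx.
  rewrite -[X in X *m D^T](_ : D *m (C *m ip_mx *m C^T) = _); last by rewrite CC.
  rewrite !mulmxA DC mul1mx -mulmxA -trmx_mul.
  by rewrite DC trmx1 mulmx1.
have stable C' : C' *m ip_mx *m C'^T = ip_mx -> forall x, AdS L x -> AdS L (x *m C').
  by move=> h x; rewrite /AdS /= ip_mulmx.
have sm C' : smooth_on_AdS L (fun z => z *m C').
  by exists setT; split => //; [exact: openT|exact: smooth_mulmx].
split => //; first exact: stable.
  exists (fun z => z *m D); split => //; first exact: stable.
    by move=> x _; rewrite -mulmxA CD mulmx1.
  by move=> x _; rewrite -mulmxA DC mulmx1.
move=> x v w _ _ _.
by rewrite !(is_deriveE (der_mulmx _ _ _)) ip_mulmx.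
Qed.
End LinearIsometries.

Section FrameRows.
Context {R : realType}.
Implicit Types (F : 'M[R]_4) (w : 'rV[R]_4).

Lemma gram_entry F a b : (F *m ip_mx *m F^T) a b = ip (row a F) (row b F).
Proof. by rewrite ip_mxE tr_row -row_mul !mxE; apply: eq_bigr => k _; rewrite !mxE. Qed.

(** The scalar product is nondegenerate, so a vector is determined by its
    products with the four frame vectors. *)
Lemma frame_eq (L : R) F w w' : L != 0 -> F *m ip_mx *m F^T = gram L ->
  (forall a, ip w (row a F) = ip w' (row a F)) -> w = w'.
Proof.
move=> L0 FF E; have : w *m (ip_mx *m F^T) = w' *m (ip_mx *m F^T).
  apply/rowP => a; have := E a; rewrite !ip_mxE tr_row !mulmxA.
  by rewrite !colE !mulmxA -!colE !mxE.
move=> /(congr1 (fun Z => Z *m gramV L *m F)).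
have inv := frame_inv_mul (gram_frame L0 FF); rewrite /frame_inv -!mulmxA in inv.
by rewrite -!mulmxA inv !mulmx1.
Qed.

Lemma row_mx4M (t : seq (seq R)) F (a : 'I_4) :
  row a (mx4 t *m F) = cmb F (nth 0 (nth [::] t a) 0) (nth 0 (nth [::] t a) 1)
                             (nth 0 (nth [::] t a) 2) (nth 0 (nth [::] t a) 3).
Proof.
rewrite row_mul /cmb; congr (_ *m F); apply/rowP => j; rewrite !mxE.
by case: j => [[|[|[|[|j]]]] j4].
Qed.

Definition row_frame (r0 r1 r2 r3 : 'rV[R]_4) : 'M[R]_4 :=
  \matrix_(i, j) nth 0 [:: r0; r1; r2; r3] i 0 j.

Lemma row_row_frame r0 r1 r2 r3 (a : 'I_4) :
  row a (row_frame r0 r1 r2 r3) = nth 0 [:: r0; r1; r2; r3] a.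
Proof. by apply/rowP => j; rewrite !mxE. Qed.
End FrameRows.

Section FrameUniqueness.
Context {R : realType}.
Variables (L : R) (y : profile R).
Hypothesis L_neq0 : L != 0.

(** Two frames with the same connection: F^-1 G has zero derivative, and it is
    an isometry because both frames have the same scalar products. *)
Lemma frames_differ_by_isometry (F G : 'rV[R]_2 -> 'M[R]_4) x e : 0 < e ->
  (forall z, ball x e z -> F z *m ip_mx *m (F z)^T = gram L) ->
  (forall z, ball x e z -> G z *m ip_mx *m (G z)^T = gram L) ->
  (forall z i, ball x e z ->
     mder z (coord_vec i) F (surface_conn L y z (coord_vec i) *m F z)) ->
  (forall z i, ball x e z ->
     mder z (coord_vec i) G (surface_conn L y z (coord_vec i) *m G z)) ->
  exists2 C : 'M[R]_4, C *m ip_mx *m C^T = ip_mx &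
    forall z, ball x e z -> G z = F z *m C.
Proof.
move=> e0 FF GG Fd Gd.
pose C z := frame_inv L (F z) *m G z.
have Cd z i : ball x e z -> mder z (coord_vec i) C 0.
  move=> xz; apply: mder_eq (mderM (mder_frame_inv L (Fd z i xz)) (Gd z i xz)) _.
  rewrite frame_inv_deriv; last exact: conn_antisym.
  by rewrite mulNmx !mulmxA addNr.
have Ccst z : ball x e z -> C z = C x.
  move=> xz; apply/matrixP => i j; apply: (cst_on_ball (f := fun z => C z i j)) xz.
  by move=> t xt k; have := Cd t k xt i j; rewrite mxE.
have xx : ball x e x by exact: ballxx.
have GE z : ball x e z -> G z = F z *m C x.
  move=> xz; rewrite -(Ccst z xz) /C mulmxA.
  by rewrite (mul_frame_inv (gram_frame L_neq0 (FF z xz))) mul1mx.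
exists (C x) => //.
have CtC : (C x)^T *m ip_mx *m C x = ip_mx.
  have := gram_frame L_neq0 (GG x xx); rewrite (GE x xx) trmx_mul !mulmxA.
  by rewrite -!(mulmxA (C x)^T) (gram_frame L_neq0 (FF x xx)) => ->.
have : (ip_mx *m (C x)^T *m ip_mx) *m C x = 1%:M.
  by rewrite -!mulmxA (mulmxA _ ip_mx) CtC ip_mxK.
move=> /mulmx1C; rewrite !mulmxA => /(congr1 (mulmxr ip_mx)) /=.
by rewrite -!mulmxA ip_mxK mulmx1 mul1mx !mulmxA.
Qed.
End FrameUniqueness.

Lemma cmb_combine (R : realType) (F : 'M[R]_4) (k l : R) v w a b c e a' b' c' e' :
  v = cmb F a b c e -> w = cmb F a' b' c' e' ->
  k *: v + l *: w =
    cmb F (k * a + l * a') (k * b + l * b') (k * c + l * c') (k * e + l * e').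
Proof. by move=> -> ->; rewrite !cmbZ cmbD. Qed.

(** The Koszul computation, isolated from analysis: p and Q stand for the first
    and second partial derivatives of the immersion, ps for its position vector
    and n for its normal.  The hypotheses on Q come from differentiating the
    scalar products of the frame vectors; symmetry of Q is what determines the
    tangential part. *)
Lemma gauss_algebra (R : realType) (L rho q k1 k2 : R) (ps n : 'rV[R]_4)
    (p : 'I_2 -> 'rV[R]_4) (Q : 'I_2 -> 'I_2 -> 'rV[R]_4) i j :
  let F := row_frame ps (p 0) (rho^-1 *: p 1) n in
  L != 0 -> rho != 0 -> F *m ip_mx *m F^T = gram L ->
  (forall i j, Q i j = Q j i) ->
  (forall i j, ip (p i) (p j) =
     if i == j then (if i == 0 then 1 else rho ^+ 2) else 0) ->
  (forall i j, ip (Q i j) ps = - ip (p j) (p i)) ->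
  (forall i j, ip (Q i j) n = (if i == 0 then k1 else k2) * ip (p j) (p i)) ->
  (forall i, ip (Q i 0) (p 0) = 0) ->
  (forall i, ip (Q i 1) (p 1) = (i == 0)%:R * (rho ^+ 2 * q)) ->
  (forall i, ip (Q i 0) (p 1) = - ip (Q i 1) (p 0)) ->
  Q i j = cmb F
    (((i == 0) && (j == 0))%:R / L ^+ 2 + ((i == 1) && (j == 1))%:R * (rho ^+ 2 / L ^+ 2))
    (- ((i == 1) && (j == 1))%:R * (rho ^+ 2 * q))
    ((i != j)%:R * (rho * q))
    (- (((i == 0) && (j == 0))%:R * k1 + ((i == 1) && (j == 1))%:R * (rho ^+ 2 * k2))).
Proof.
move=> F L0 r0 gr Qs pp Qps Qn Q00 Q11 Q01.
apply: (frame_eq L0 gr) => a.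
rewrite [in RHS]cmb_row (ip_cmb _ _ _ _ _ _ _ _ gr) row_row_frame.
have p010 : ip (Q 0 1) (p 0) = 0 by rewrite Qs Q00.
have p001 : ip (Q 0 0) (p 1) = 0 by rewrite Q01 p010 oppr0.
have p101 : ip (Q 1 0) (p 1) = rho ^+ 2 * q by rewrite Qs Q11 mul1r.
have p110 : ip (Q 1 1) (p 0) = - (rho ^+ 2 * q) by rewrite -p101 Q01 opprK.
have [->|->] := ord2P i; have [->|->] := ord2P j;
  case: a => [[|[|[|[|a]]]] a4]; rewrite /= ?ipZr ?Qps ?Qn ?pp ?Q00 ?Q11
    ?p010 ?p001 ?p101 ?p110 //=; by field; rewrite ?L0 ?r0.
Qed.

Section GaussWeingarten.
Context {R : realType}.
Variables (L d : R) (y : profile R) (W : set 'rV[R]_2).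
Variables (psi nu : 'rV[R]_2 -> 'rV[R]_4).
Hypothesis L_gt0 : 0 < L.
Hypothesis oW : open W.
Hypothesis Wd : forall x, W x -> sym_itv d (x 0 0).
Hypothesis sol : solves_system L d y.
Hypothesis rho_gt0 : forall s, sym_itv d s -> 0 < rho_of y s.
Hypothesis real : realizes L y W psi nu.

Let L_neq0 : L != 0. Proof. by rewrite gt_eqF. Qed.
Let rho_neq0 x : W x -> rho_of y (x 0 0) != 0.
Proof. by move=> Wx; rewrite gt_eqF // rho_gt0 //; exact: Wd. Qed.
Let ev (i : 'I_2) : 'rV[R]_2 := coord_vec i.
Let P (i : 'I_2) := 'D_(ev i) psi.
Let PP (i j : 'I_2) := 'D_(ev i) (P j).

Let smpsi : smooth_on W psi. Proof. by have [[]] := real. Qed.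
Let smnu : smooth_on W nu. Proof. by have [_ _ []] := real. Qed.

Let psid x v : W x -> is_derive x v psi ('D_v psi x).
Proof. by move=> Wx; exact: (Ck_on_is_derive v (smpsi 1%N)). Qed.
Let nud x v : W x -> is_derive x v nu ('D_v nu x).
Proof. by move=> Wx; exact: (Ck_on_is_derive v (smnu 1%N)). Qed.
Let Pd x v i : W x -> is_derive x v (P i) ('D_v (P i) x).
Proof. by move=> Wx; exact: (@Ck_on_is_derive _ _ _ 0 W _ _ v ((smpsi 2%N).2 (ev i)).2). Qed.

Lemma PP_sym x i j : W x -> PP i j x = PP j i x.
Proof.
move=> Wx; apply/rowP => k.
have cC := Ck_on_coord k oW (smpsi 2%N).
have PPE i' j' : PP i' j' x 0 k = 'D_(ev i') ('D_(ev j') (fun z => psi z 0 k)) x.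
  rewrite -(is_deriveE (der_coord k (Pd (ev i') j' Wx))).
  apply: (derive_near _ oW Wx) => z Wz.
  by rewrite (is_deriveE (der_coord k (psid (ev j') Wz))).
have E := mixed_partials (ev j) (ev i) oW Wx cC.
exact: etrans (PPE i j) (etrans E (esym (PPE j i))).
Qed.

Lemma ip_PP i j x : W x -> ip (P i x) (P j x) =
  if i == j then (if i == 0 then 1 else rho_of y (x 0 0) ^+ 2) else 0.
Proof.
move=> Wx; have [_ met _ _] := real; have := met x Wx.
by move/matrixP => /(_ i j); rewrite !mxE.
Qed.

Let psi_psi x : W x -> ip (psi x) (psi x) = - L ^+ 2.
Proof. by have [[_ h _ _] _ _ _] := real => /h. Qed.
Let nu_psi x : W x -> ip (nu x) (psi x) = 0.
Proof.
move=> Wx; have [_ _ [_ h] _] := real; have [h1 h2 h3] := h x Wx.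
exact: h1.
Qed.
Let nu_P x i : W x -> ip (nu x) (P i x) = 0.
Proof.
move=> Wx; have [_ _ [_ h] _] := real; have [h1 h2 h3] := h x Wx.
exact: (h2 (ev i)).
Qed.
Let nu_nu x : W x -> ip (nu x) (nu x) = -1.
Proof.
move=> Wx; have [_ _ [_ h] _] := real; have [h1 h2 h3] := h x Wx.
exact: h3.
Qed.

(** A scalar product that is prescribed on all of W may be differentiated, since
    W is open. *)
Lemma der_ip_const (f g : 'rV[R]_2 -> 'rV[R]_4) (h : 'rV[R]_2 -> R) x v df dg dh :
  W x -> (forall z, W z -> ip (f z) (g z) = h z) ->
  is_derive x v f df -> is_derive x v g dg -> is_derive x v h dh ->
  ip df (g x) + ip (f x) dg = dh.
Proof.
move=> Wx fgh fd gd hd; have := der_near oW Wx fgh (der_ip fd gd).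
by move=> /is_deriveE <-; exact: is_deriveE.
Qed.

Let P_psi x i : W x -> ip (P i x) (psi x) = 0.
Proof.
move=> Wx; have := der_ip_const Wx psi_psi (psid (ev i) Wx) (psid (ev i) Wx) (derC _ x _).
rewrite (ipC (psi x)) -/(P i x) => E; lra.
Qed.

Let kappa (i : 'I_2) (s : R) := if i == 0 then k1_of y s else k2_of y s.

(** The derivative of the normal is tangent to AdS, so the projection in the
    definition of the shape operator can be dropped. *)
Lemma weingarten x i : W x -> 'D_(ev i) nu x = - kappa i (x 0 0) *: P i x.
Proof.
move=> Wx; have [_ _ _ [A shA eig]] := real.
have Dnu_psi : ip ('D_(ev i) nu x) (psi x) = 0.
  have := der_ip_const Wx nu_psi (nud (ev i) Wx) (psid (ev i) Wx) (derC _ x _).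
  by rewrite -/(P i x) nu_P // addr0.
have := shA x (ev i) Wx; rewrite /nablaphi /tproj Dnu_psi mul0r scale0r addr0 => ->.
have -> : ev i *m A x = kappa i (x 0 0) *: ev i.
  have [e1 e2] := eig x Wx; have [->|->] := ord2P i; first exact: e1.
  move: e2; rewrite /frame_e2 -scalemxAl => /(congr1 (fun v => rho_of y (x 0 0) *: v)).
  rewrite /= !scalerA mulfV ?rho_neq0 // scale1r /ev => ->; congr (_ *: _).
  by rewrite /kappa /=; field; rewrite rho_neq0.
by rewrite (is_deriveE (der_scale_dir _ (psid (ev i) Wx))) scaleNr.
Qed.

Lemma PP_psi i j x : W x -> ip (PP i j x) (psi x) = - ip (P j x) (P i x).
Proof.
move=> Wx; have := der_ip_const Wx (fun z Wz => P_psi j Wz) (Pd (ev i) j Wx)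
  (psid (ev i) Wx) (derC _ x _).
by rewrite -/(PP i j x) -/(P i x) => /eqP; rewrite addr_eq0 => /eqP.
Qed.

Lemma PP_nu i j x : W x -> ip (PP i j x) (nu x) = kappa i (x 0 0) * ip (P j x) (P i x).
Proof.
move=> Wx.
have E : ip ('D_(ev i) nu x) (P j x) + ip (nu x) (PP i j x) = 0 :=
  der_ip_const Wx (fun z Wz => nu_P j Wz) (nud (ev i) Wx) (Pd (ev i) j Wx) (derC _ x _).
rewrite (weingarten i Wx) ipZl (ipC (P i x)) (ipC (nu x)) in E.
by move/eqP: E; rewrite addrC addr_eq0 mulNr opprK => /eqP.
Qed.

Lemma PP_P00 i x : W x -> ip (PP i 0 x) (P 0 x) = 0.
Proof.
move=> Wx; have := der_ip_const Wx (ip_PP 0 0) (Pd (ev i) 0 Wx) (Pd (ev i) 0 Wx)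
  (derC _ x _).
rewrite -/(PP i 0 x) (ipC (P 0 x)) => E; lra.
Qed.

Lemma PP_P11 i x : W x ->
  ip (PP i 1 x) (P 1 x) = (i == 0)%:R * (rho_of y (x 0 0) ^+ 2 * q_of y (x 0 0)).
Proof.
move=> Wx; have rd := der_rho (fun x => Wd (x:=x)) sol (ev i) Wx.
have := der_ip_const Wx (ip_PP 1 1) (Pd (ev i) 1 Wx) (Pd (ev i) 1 Wx) (derX2 rd).
rewrite -/(PP i 1 x) (ipC (P 1 x)) /ev coord_vecE eq_sym => E.
have {}E : ip (PP i 1 x) (P 1 x) = rho_of y (x 0 0) * ((i == 0)%:R *
   (q_of y (x 0 0) * rho_of y (x 0 0))) by lra.
by rewrite E; ring.
Qed.

(** The three lemmas PP_P00, PP_P11 and PP_P01 are the Koszul relations for the metric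
    ds^2 + rho^2 dt^2. *)
Lemma PP_P01 i x : W x -> ip (PP i 0 x) (P 1 x) = - ip (PP i 1 x) (P 0 x).
Proof.
move=> Wx.
have E : ip (PP i 0 x) (P 1 x) + ip (P 0 x) (PP i 1 x) = 0 :=
  der_ip_const Wx (ip_PP 0 1) (Pd (ev i) 0 Wx) (Pd (ev i) 1 Wx) (derC _ x _).
by move/eqP: E; rewrite (ipC (P 0 x)) addr_eq0 => /eqP.
Qed.

Definition immersion_frame (z : 'rV[R]_2) : 'M[R]_4 :=
  row_frame (psi z) (P 0 z) ((rho_of y (z 0 0))^-1 *: P 1 z) (nu z).

Lemma immersion_frame_gram z : W z ->
  immersion_frame z *m ip_mx *m (immersion_frame z)^T = gram L.
Proof.
move=> Wz; apply/matrixP => a b.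
rewrite gram_entry !row_row_frame mxE.
have r0 := rho_neq0 Wz.
case: a => [[|[|[|[|a]]]] a4]; case: b => [[|[|[|[|b]]]] b4]; rewrite /= ?ipZl ?ipZr
  ?(ipC (psi z) (P _ z)) ?(ipC (psi z) (nu z)) ?(ipC (P _ z) (nu z))
  ?psi_psi ?P_psi ?nu_psi ?nu_P ?nu_nu ?ip_PP //= ?mulr0 //.
by field.
Qed.

Lemma gauss_formula i j x : W x -> PP i j x =
  cmb (immersion_frame x)
    (((i == 0) && (j == 0))%:R / L ^+ 2 +
       ((i == 1) && (j == 1))%:R * (rho_of y (x 0 0) ^+ 2 / L ^+ 2))
    (- ((i == 1) && (j == 1))%:R * (rho_of y (x 0 0) ^+ 2 * q_of y (x 0 0)))
    ((i != j)%:R * (rho_of y (x 0 0) * q_of y (x 0 0)))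
    (- (((i == 0) && (j == 0))%:R * k1_of y (x 0 0) +
        ((i == 1) && (j == 1))%:R * (rho_of y (x 0 0) ^+ 2 * k2_of y (x 0 0)))).
Proof.
move=> Wx.
exact (@gauss_algebra R L (rho_of y (x 0 0)) (q_of y (x 0 0)) (k1_of y (x 0 0))
  (k2_of y (x 0 0)) (psi x) (nu x) (fun i => P i x) (fun i j => PP i j x) i j
  L_neq0 (rho_neq0 Wx) (immersion_frame_gram Wx) (fun a b => PP_sym a b Wx)
  (fun a b => ip_PP a b Wx) (fun a b => PP_psi a b Wx) (fun a b => PP_nu a b Wx)
  (fun a => PP_P00 a Wx) (fun a => PP_P11 a Wx) (fun a => PP_P01 a Wx)).
Qed.

Lemma immersion_frame_der z i : W z ->
  mder z (ev i) immersion_frame (surface_conn L y z (ev i) *m immersion_frame z).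
Proof.
move=> Wz; have r0 := rho_neq0 Wz.
have rd := der_rho (fun x => Wd (x:=x)) sol (ev i) Wz.
have ps : psi z = cmb (immersion_frame z) 1 0 0 0.
  by have := cmb_row (immersion_frame z) 0; rewrite row_row_frame.
have e1 : P 0 z = cmb (immersion_frame z) 0 1 0 0.
  by have := cmb_row (immersion_frame z) 1; rewrite row_row_frame.
have e2 : P 1 z = cmb (immersion_frame z) 0 0 (rho_of y (z 0 0)) 0.
  have := cmb_row (immersion_frame z) 2%:R; rewrite row_row_frame /=.
  move=> /(congr1 (fun v => rho_of y (z 0 0) *: v)); rewrite scalerA mulfV // scale1r => ->.
  by rewrite cmbZ; apply: cmb_congr; rewrite /=; ring.
have Pi : P i z = cmb (immersion_frame z) 0 (i == 0)%:R (rho_of y (z 0 0) * (i == 1)%:R) 0.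
  have [->|->] := ord2P i; rewrite /= ?mulr0 ?mulr1; [exact: e1|exact: e2].
have G0 := gauss_formula i 0 Wz; have G1 := gauss_formula i 1 Wz.
have D0 : is_derive z (ev i) psi _ := is_derive_eq (psid (ev i) Wz) Pi.
have D1 : is_derive z (ev i) (P 0) _ := is_derive_eq (Pd (ev i) 0 Wz) G0.
have D2 : is_derive z (ev i) (fun w => (rho_of y (w 0 0))^-1 *: P 1 w) _ :=
  is_derive_eq (derZv (derV (f := fun w : 'rV[R]_2 => rho_of y (w 0 0)) r0 rd)
    (Pd (ev i) 1 Wz)) (cmb_combine _ _ e2 G1).
have D3 : is_derive z (ev i) nu _ := is_derive_eq (nud (ev i) Wz)
  (etrans (weingarten i Wz) (etrans (congr1 _ Pi) (cmbZ _ _ _ _ _ _))).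
move=> a b; have row_entry : (surface_conn L y z (ev i) *m immersion_frame z) a b =
  row a (surface_conn L y z (ev i) *m immersion_frame z) 0 b by rewrite [RHS]mxE.
rewrite row_entry /surface_conn /conn row_mx4M.
under eq_fun do rewrite mxE.
rewrite {row_entry} /ev !coord_vecE; move: D0 D1 D2 D3 {Pi G0 G1 ps e1 e2}.
rewrite /ev !coord_vecE => D0 D1 D2 D3.
case: a => [[|[|[|[|a]]]] a4] //=.
- by apply: is_derive_eq (der_coord b D0) _; rewrite (eq_sym i 0) (eq_sym i 1).
- apply: (@is_derive_eq _ _ _ (fun w => P 0 w 0 b) _ _ _ _ (der_coord b D1)).
  by have [->|->] := ord2P i; congr (cmb _ _ _ _ _ 0 b); rewrite /=; field.
- apply: is_derive_eq (der_coord b D2) _.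
  by have [->|->] := ord2P i; congr (cmb _ _ _ _ _ 0 b); rewrite /=; field;
    rewrite ?L_neq0 ?r0.
- apply: is_derive_eq (der_coord b D3) _; rewrite /kappa.
  by have [->|->] := ord2P i; congr (cmb _ _ _ _ _ 0 b); rewrite /=; ring.
Qed.

Lemma immersion_frame_row0 z : row 0 (immersion_frame z) = psi z.
Proof. by rewrite row_row_frame. Qed.
End GaussWeingarten.

(** Row 0 of an adapted frame is the immersion, so the isometry relating the two
    frames relates the two immersions. *)
Theorem surf_locally_unique (R : realType) (L d : R) (y : profile R) (U : set 'rV[R]_2)
  (F : 'rV[R]_2 -> 'M[R]_4) : 0 < L -> (forall x, U x -> sym_itv d (x 0 0)) ->
  solves_system L d y -> (forall s, sym_itv d s -> 0 < rho_of y s) ->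
  adapted_frame L y U F -> locally_unique L y U (surf F).
Proof.
move=> L0 Ud sol rho0 hF W psi nu oW WU real x Wx.
have Wd z : W z -> sym_itv d (z 0 0) by move=> /WU; exact: Ud.
have /nbhs_ballP [e /= e0 be] : nbhs x W by exact: open_nbhs_nbhs.
have [|z xz|z xz|z i xz|z i xz|C CC GE] := @frames_differ_by_isometry R L y _ F
  (immersion_frame y psi nu) x e e0.
- by rewrite gt_eqF.
- by apply: hF.1; exact/WU/be.
- exact: (immersion_frame_gram oW Wd rho0 real (be _ xz)).
- by apply: hF.2; exact/WU/be.
- exact: (immersion_frame_der L0 oW Wd sol rho0 real i (be _ xz)).
exists (ball x e), (fun v => v *m C); split => //.
- exact: ball_open.
- exact: ballxx.
- exact: isometry_mulmx.
- move=> z xz; rewrite -(immersion_frame_row0 y psi nu z) (GE z xz).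
  by rewrite row_mul -surf_row.
Qed.

(** * The theorem *)

Lemma open_strip (R : realType) (d : R) (J : set R) : open J -> open (strip d J).
Proof.
move=> oJ; have oc i (A : set R) : open A -> open [set x : 'rV[R]_2 | A (x 0 i)].
  by move=> oA; apply: (open_comp _ oA) => x _; exact: coord_continuous.
by apply: openI; apply: oc => //; exact: open_sym_itv.
Qed.

Theorem theorem4p1 (R : realType) (L rho0 u0 p0 a0 b0 q0 : R)
    (hL : 0 < L) (hrho0 : 0 < rho0) (hu0 : u0 != 0) :
  exists (delta : R) (y : profile R),
    [/\ 0 < delta,
        analytic_solution L rho0 u0 p0 a0 b0 q0 delta y,
        (forall (delta' : R) (z : profile R), 0 < delta' ->
           analytic_solution L rho0 u0 p0 a0 b0 q0 delta' z ->
           forall s, sym_itv delta s -> sym_itv delta' s -> profile_eq y z s) &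
        let H0 := - ((a0 + b0) / 2) in
        H0 != 0 -> 0 < u0 / H0 ->
        exists delta1 : R,
          [/\ 0 < delta1, delta1 <= delta,
              (forall s, sym_itv delta1 s -> 0 < lambda_sq y s) &
              forall J : set R, is_interval J -> open J -> J !=set0 ->
              let U := strip delta1 J in
              exists phi xi : 'rV[R]_2 -> 'rV[R]_4,
                [/\ realizes L y U phi xi,
                    biharmonic_map L (metric_conf y) U phi,
                    ~ harmonic_map L (metric_conf y) U phi,
                    (forall x, U x ->
                       tension_field L (metric_conf y) phi x
                         = (2 * u_of y (x 0 0)) *: xi x
                       /\ (2 * u_of y (x 0 0)) *: xi x != 0) &
                    locally_unique L y U phi]]].
Proof.
have [d [y [A [B [X [d0 ys rho_gt0 frame init]]]]]] :=
  @system_exists R L rho0 u0 p0 a0 b0 q0 hrho0 hu0.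
have [_ sol y0] := ys.
exists d, y; split => //.
  move=> d' z _ [_ zs z0] s sd sd'.
  exact: (system_unique sol y0 zs z0).
move=> H0 H0_neq0 uH0.
have [F [gramF derF smF]] := frame_exists hL d0 sol frame init.
have at0 : sym_itv d 0 by rewrite sym_itvE normr0.
have [[[_ y2 _] [y4 y5 _]] [[_ _ ud _] [k2d k1d _]]] := (y0, sol 0 at0).
have Hd := derN (derM (derD k1d k2d) (derC 2^-1 (0 : R) 1)).
have lam0E : lambda_sq y 0 = u0 / H0 by rewrite /lambda_sq /mean_curv y2 y4 y5.
have mean0 : mean_curv y 0 != 0 by rewrite /mean_curv y4 y5.
have [e e0 lam_gt0] : exists2 e : R, 0 < e & forall s : R, `|s| < e -> 0 < lambda_sq y s.
  by apply: pos_near (derM ud (derV mean0 Hd)) _; rewrite -/(lambda_sq y 0) lam0E.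
(* lambda^2 is continuous at 0, with value u0 / H0 > 0 *)
pose d1 := Num.min d e.
have d1P s : sym_itv d1 s -> sym_itv d s /\ 0 < lambda_sq y s.
  by rewrite !sym_itvE lt_min => /andP[sd /lam_gt0].
exists d1; split.
- by rewrite lt_min d0.
- by rewrite ge_min lexx.
- by move=> s /d1P[].
move=> J _ oJ [t Jt] U.
have oU : open U by exact: open_strip.
have Ud x : U x -> sym_itv d1 (x 0 0) by case.
have sol1 : solves_system L d1 y by move=> s /d1P[sd _]; exact: sol.
have rho1 s : sym_itv d1 s -> 0 < rho_of y s by move=> /d1P[sd _]; exact: rho_gt0.
have lam1 s : sym_itv d1 s -> 0 < lambda_sq y s by move=> /d1P[].
have Fadapted : adapted_frame L y U F.
  by split=> [x /Ud/d1P[xd _]|x v /Ud/d1P[xd _]]; [exact: gramF|exact: derF].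
have Fsmooth a b : smooth_on U (fun x => F x a b).
  by apply: smF => // x /Ud/d1P[].
have tension x (Ux : U x) := tension_surf hL oU Ud sol1 rho1 Fadapted lam1 Ux.
have realF := surf_realizes hL oU Ud rho1 Fadapted Fsmooth.
have tension_neq0 x : U x -> (2 * u_of y (x 0 0)) *: normal F x != 0.
  move=> Ux; have [[ux _ _ _] _] := sol1 _ (Ud _ Ux).
  rewrite scaler_eq0 negb_or mulf_neq0 ?pnatr_eq0 //=.
  have [_ _ [_ /(_ x Ux)[_ _ nn]] _] := realF.
  apply: contraPneq nn => ->; rewrite -(scale0r (0 : 'rV[R]_4)) ipZl mul0r => /eqP.
  by rewrite eq_sym oppr_eq0 oner_eq0.
exists (surf F), (normal F); split => //.
- exact: (surf_biharmonic hL oU Ud sol1 rho1 Fadapted lam1).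
- pose x : 'rV[R]_2 := \row_j (if j == 0 then 0 else t).
  have Ux : U x.
    split; rewrite /= mxE //= sym_itvE normr0 lt_min d0 //.
  move=> /(_ x Ux); rewrite tension // => /eqP.
  by apply/negP; exact: tension_neq0.
- by move=> x Ux; split; [exact: tension|exact: tension_neq0].
- exact: (surf_locally_unique hL Ud sol1 rho1 Fadapted).
Qed.
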